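(* Suppose $s,q,a,t,b$ are integers with $s\ge 2$, and for each $n\ge s$ let $E(n)$ be a set of multigraphs, such that one of the following holds. (i) $a\ge 0$, $q=a\binom{s}{2}+b$ for some $0\le b\le s-2$, and $E(n)=U_a(n)$. (ii) $a\ge 1$, $q=a\binom{s}{2}-t$ for some $1\le t\le\frac{s}{2}$, and $E(n)=T_{s-t,a}(n)$. Then for all $\delta>0$ there exists $\beta>0$ such that for all sufficiently large $n$, $$\frac{|F(n,s,q)\setminus E^{\delta}(n)|}{|F(n,s,q)|}\le 2^{-\beta\binom{n}{2}}.$$
   Context: For a set $X$, $\binom{X}{t}$ is the set of $t$-element subsets of $X$; $[n]=\{1,\dots,n\}$; $\mathbb{N}=\{0,1,2,\dots\}$. A multigraph is a pair $(V,w)$ where $V$ is a finite vertex set and $w:\binom{V}{2}\to\mathbb{N}$. $F(n,s,q)$ is the set of multigraphs $([n],w)$ such that $\sum_{xy\in\binom{X}{2}}w(xy)\le q$ for every $X\in\binom{[n]}{s}$. If $G=(V,w)$ and $G'=(V,w')$, then $G$ is a submultigraph of $G'$ if $w(xy)\le w'(xy)$ for all $xy\in\binom{V}{2}$; and, with $|V|=n$, $G$ and $G'$ are $\delta$-close if $|\{xy\in\binom{V}{2}:w(xy)\ne w'(xy)\}|\le\delta n^2$. For $a\ge 0$, $\mathbb{U}_a(n)$ is the multigraph $([n],w)$ with $w(xy)=a$ for all $xy$, and $U_a(n)$ is the set of submultigraphs of $\mathbb{U}_a(n)$. For $a\ge 1$ and $n\ge r\ge 1$, $\mathbb{T}_{r,a}(n)$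 is the set of multigraphs $([n],w)$ for which there is a partition $U_1,\dots,U_r$ of $[n]$ with part sizes pairwise differing by at most $1$ such that $w(xy)=a-1$ if $xy\in\binom{U_i}{2}$ for some $i$ and $w(xy)=a$ if $x\in U_i$, $y\in U_j$ with $i\ne j$; and $T_{r,a}(n)$ is the set of multigraphs with vertex set $[n]$ that are submultigraphs of some element of $\mathbb{T}_{r,a}(n)$. For a set $E(n)$ of multigraphs on $[n]$ and $\delta>0$, $E^{\delta}(n)$ is the set of $G\in F(n,s,q)$ such that $G$ is $\delta$-close to some $G'\in E(n)$. *)

(* Defs.v *)
From HB Require Import structures.
From mathcomp Require Import all_boot all_order all_algebra.
From mathcomp Require Import finmap.
From mathcomp Require Import all_classical all_reals all_analysis.

Import Order.TTheory GRing.Theory Num.Theory.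

Local Open Scope classical_set_scope.

(* The vertex set [n] is represented by 'I_n throughout. *)

Definition edge (V : finType) : finType := {e : {set V} | #|e| == 2}.

Definition multigraph (V : finType) : choiceType := {ffun edge V -> nat}.

Section Multigraphs.
Context {V : finType}.
Implicit Types (G w : multigraph V) (X : {set V}).

Definition weight w X : nat := \sum_(e : edge V | val e \subset X) w e.

Definition submultigraph G G' : Prop := forall e, G e <= G' e.

Definition delta_close {R : realType} (delta : R) G G' : Prop :=
  (#|[set e | G e != G' e]%SET|%:R <= delta * #|V|%:R ^+ 2)%R.

End Multigraphs.

Definition F (n s q : nat) : set (multigraph 'I_n) :=
  [set w | forall X : {set 'I_n}, #|X| = s -> weight w X <= q].

Definition bbU (a n : nat) : multigraph 'I_n := [ffun=> a].

Definition U (a n : nat) : set (multigraph 'I_n) :=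
  [set G | submultigraph G (bbU a n)].

(* [finset.partition] demands nonempty parts; for n >= r this is no restriction,
   since r parts of [n] with sizes differing by at most 1 are then nonempty.
   The truncated predecessor a.-1 is meant for a >= 1 only. *)
Definition bbT (r a n : nat) : set (multigraph 'I_n) :=
  [set w | exists P : {set {set 'I_n}},
    [/\ finset.partition P [set: 'I_n]%SET /\ #|P| = r,
        {in P &, forall A B : {set 'I_n}, #|A| <= #|B| + 1},
        forall (A : {set 'I_n}) (e : edge 'I_n),
          A \in P -> val e \subset A -> w e = a.-1 &
        forall (A B : {set 'I_n}) (x y : 'I_n) (e : edge 'I_n),
          A \in P -> B \in P -> A != B -> x \in A -> y \in B ->
          val e = [set x; y]%SET -> w e = a]].

Definition T (r a n : nat) : set (multigraph 'I_n) :=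
  [set G | exists2 G', bbT r a n G' & submultigraph G G'].

Definition nearby {R : realType} {n : nat} (s q : nat) (E : set (multigraph 'I_n))
    (delta : R) : set (multigraph 'I_n) :=
  [set G | F n s q G /\ exists2 G', E G' & delta_close delta G G'].

(* [fset_set] sends infinite sets to fset0. Here [card_mg] is only applied to
   subsets of F n s q with 2 <= s <= n, which is finite: every edge lies in
   some s-set, so all multiplicities are at most q. *)
Definition card_mg {V : finType} (A : set (multigraph V)) : nat := #|` fset_set A|.

(* Main.v *)
Require Import Defs.
From mathcomp Require Import all_boot all_order all_algebra.
From mathcomp Require Import finmap.
From mathcomp Require Import all_classical all_reals all_analysis.
From mathcomp Require Import ring lra zify.
Set Implicit Arguments. Unset Strict Implicit. Unset Printing Implicit Defensive.
Import Order.TTheory GRing.Theory Num.Theory.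
Local Open Scope ring_scope.

(** The proof combines containers with a stability theorem for symmetric
    functions of two vertices.

    Containers. Fix small eps and eta. Up to eps n^2 ordered pairs, every G in
    F(n,s,q) lies below a blow-up C x y = c (p x) (p y), where p : V -> T has a
    target of bounded size and at most eta n^s of the s-tuples of vertices have
    C-weight larger than q (container_lemma). To find it, apply the weak
    regularity lemma of Frieze and Kannan (weak_regularity) to the graphs
    {G >= v}, v <= q, and let c t t' be the largest v for which {G >= v} has
    density at least eps / (q + 1) between the cells p = t and p = t'. If C had
    many heavy s-tuples, the counting lemma (counting_lemma) would produce an
    injective s-tuple that is heavy in G. There are only exp(O(n)) pairs (p, c).

    Degrees. If every vertex of a large set M has degree at least gamma |M| in M,
    then a k-tuple in M can be extended by a positive proportion of the y in M
    that send total multiplicity at least theta_k to it, for any integer theta_k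
    with theta_k - 1 < k gamma (greedy). In case (i) take gamma = a + eps and
    theta_k = k a + 1; in case (ii), with r = s - t, take gamma = a - 1/r + eps,
    theta_k = k a for k <= r, and theta_k = k a - 1 for r < k < s, where k < 2r
    because t <= r. In both cases the theta_k sum to more than q, so a positive
    proportion of the s-tuples would be heavy. Hence large sets contain vertices
    of degree at most gamma |M|, and peeling them off shows that C has total
    multiplicity at most about gamma n^2 (sum_upper).

    Stability. By concavity of the logarithm, the sum of ln (C + 1) is at most
    its extremal value, minus a constant for each pair whose multiplicity
    exceeds a in case (i), or is neither a - 1 nor a in case (ii). In case (i)
    this is all (stability_below). In case (ii), suppose that the sum is almost
    extremal. After deletion of few vertices all degrees are about (a - 1/r) n,
    so there are many r-cliques of multiplicity a, while (r+1)-cliques are rare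
    because each extends to many heavy s-tuples. For a well-chosen r-clique,
    almost every vertex is joined with multiplicity a - 1 to exactly one clique
    vertex and with multiplicity a to the others. This classifies the vertices
    into r classes of size about n/r with few inner pairs of multiplicity a or
    more (near_turan), and a balanced partition close to these classes shows
    that C is almost below a Turan multigraph (stability_turan).

    Counting. A multigraph of F(n,s,q) that is not delta-close to E(n) has a
    container whose sum of ln (C + 1) is smaller by order n^2 than that of the
    extremal multigraph, all of whose submultigraphs lie in F(n,s,q). The number
    of multigraphs with at most eps n^2 pairs above C is the product of the
    C + 1 up to a factor exp(small n^2) (count_close), and the number of
    containers is negligible (enumeration). *)

(** * Tuples and the update of one coordinate *)

(** The tuple [x] with its [i]-th coordinate replaced by [u]. *)
Definition upd {I V : finType} (x : {ffun I -> V}) (i : I) (u : V) : {ffun I -> V} :=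
  [ffun j => if j == i then u else x j].

Lemma upd_at (I V : finType) (x : {ffun I -> V}) i u : upd x i u i = u.
Proof. by rewrite ffunE eqxx. Qed.

Lemma upd_ne (I V : finType) (x : {ffun I -> V}) i u j :
  j != i -> upd x i u j = x j.
Proof. by move=> /negbTE ji; rewrite ffunE ji. Qed.

(** Resampling one coordinate: each tuple arises [#|V|] times as an update.
    This replaces every splitting of a sum over tuples into iterated sums. *)
Lemma sum_upd (R : pzSemiRingType) (I V : finType) (F : {ffun I -> V} -> R) i :
  \sum_x \sum_u F (upd x i u) = #|V|%:R * \sum_x F x.
Proof.
rewrite pair_big /=.
pose h (z : {ffun I -> V} * V) := (upd z.1 i z.2, z.1 i).
have hK : involutive h.
  move=> [x u]; rewrite /h /= upd_at; congr (_, _).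
  by apply/ffunP => j; rewrite !ffunE; case: eqP => [->|].
rewrite (reindex_inj (inv_inj hK)) /=.
rewrite (eq_bigr (fun z : {ffun I -> V} * V => F z.1)); last first.
  move=> [x u] _ /=; congr F; apply/ffunP => j; rewrite !ffunE.
  by case: eqP => [->|].
rewrite -(pair_big xpredT xpredT (fun x (u : V) => F x)) /=.
rewrite big_distrr /=; apply: eq_bigr => x _.
by rewrite sumr_const mulr_natl.
Qed.

Lemma sum_upd2 (R : pzSemiRingType) (I V : finType) (F : {ffun I -> V} -> R) i j :
  \sum_x \sum_u \sum_v F (upd (upd x i u) j v) = #|V|%:R ^+ 2 * \sum_x F x.
Proof.
rewrite (sum_upd (fun x => \sum_v F (upd x j v))) sum_upd.
by rewrite expr2 mulrA.
Qed.

(** The total multiplicity of the pairs of positions of the tuple [x]; a pair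
    of equal entries contributes the diagonal value of [C]. *)
Definition tuple_weight {V : finType} {s : nat} (C : V -> V -> nat) (x : {ffun 'I_s -> V}) : nat :=
  (\sum_(j < s) \sum_(i < s | i < j) C (x j) (x i))%N.

(** * Cut norm and weak regularity *)

Section CutNorm.
Variables (R : realType) (V : finType).
Implicit Types (f F : V -> V -> R) (g h : V -> R) (A B : {set V}).

(** Test functions with values in the unit interval. *)
Definition in01 (T : Type) (g : T -> R) := forall x, 0 <= g x <= 1.

(** The cut norm of [F], without normalization, is at most [c]. *)
Definition cut_le F (c : R) := forall A B, `|\sum_(x in A) \sum_(y in B) F x y| <= c.

Lemma sum_in01_le g (phi : V -> R) : in01 g ->
  \sum_x g x * phi x <= \sum_(x in [pred x | 0 < phi x]) phi x.
Proof.
move=> g01; rewrite [leRHS]big_mkcond /=; apply: ler_sum => x _.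
rewrite inE; have /andP[g0 g1] := g01 x.
case: ltP => [p0|p0]; first by rewrite ler_piMl // ltW.
by rewrite mulr_ge0_le0.
Qed.

Lemma cut_le_test_ub F c g h : cut_le F c -> in01 g -> in01 h ->
  \sum_x \sum_y g x * h y * F x y <= c.
Proof.
move=> Fc g01 h01.
pose phi x := \sum_y h y * F x y.
pose A : {set V} := [set x in [pred x | 0 < phi x]]%SET.
have E1 : \sum_x \sum_y g x * h y * F x y = \sum_x g x * phi x.
  by apply: eq_bigr => x _; rewrite mulr_sumr; apply: eq_bigr => y _; rewrite mulrA.
rewrite E1; apply: le_trans (sum_in01_le phi g01) _.
pose psi y := \sum_(x in A) F x y.
have E2 : \sum_(x in [pred x | 0 < phi x]) phi x = \sum_y h y * psi y.
  rewrite exchange_big /=; apply: eq_bigr => y _; rewrite mulr_sumr.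
  by apply: eq_bigl => x; rewrite !inE.
rewrite E2; apply: le_trans (sum_in01_le psi h01) _.
apply: le_trans (Fc A [set y in [pred y | 0 < psi y]]%SET).
apply: le_trans (ler_norm _); rewrite [leRHS]exchange_big /=.
by rewrite le_eqVlt; apply/orP; left; apply/eqP; apply: eq_big => y; rewrite ?inE.
Qed.

(** Sets may be replaced by functions with values in the unit interval, since
    a linear form on such functions is maximal at an indicator function. *)
Lemma cut_le_test F c g h : cut_le F c -> in01 g -> in01 h ->
  `|\sum_x \sum_y g x * h y * F x y| <= c.
Proof.
move=> Fc g01 h01; rewrite ler_norml cut_le_test_ub // andbT lerNl.
have Fc' : cut_le (fun x y => - F x y) c.
  move=> A B; under eq_bigr do rewrite sumrN.
  by rewrite sumrN normrN.
apply: le_trans (cut_le_test_ub Fc' g01 h01).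
rewrite -sumrN le_eqVlt; apply/orP; left; apply/eqP.
apply: eq_bigr => x _; rewrite -sumrN; apply: eq_bigr => y _.
by rewrite mulrN.
Qed.

End CutNorm.

(** The cells of the partition generated by [k] rectangles A x B: one records
    for each rectangle whether a vertex is in A and whether it is in B. *)
Fixpoint boxes (k : nat) : finType :=
  if k is k'.+1 then (boxes k' * (bool * bool))%type else unit.

Fixpoint boxes0 (k : nat) : boxes k :=
  if k is k'.+1 then (boxes0 k', (false, false)) else tt.

Section WeakRegularity.
Variables (R : realType) (V : finType).
Implicit Types (f : V -> V -> R).

(** Frieze-Kannan weak regularity, by L2-norm decrement: subtracting [+eps] or
    [-eps] times a rectangle that violates the cut bound lowers the squared
    norm by at least [eps ^+ 2 * #|V| ^+ 2], so [k] rectangles suffice. *)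
Lemma weak_regularity (eps : R) (k : nat) f : 0 < eps ->
  \sum_x \sum_y f x y ^+ 2 <= k%:R * (eps ^+ 2 * #|V|%:R ^+ 2) ->
  exists (p : V -> boxes k) (S : boxes k -> boxes k -> R),
    cut_le (fun x y => f x y - S (p x) (p y)) (eps * #|V|%:R ^+ 2).
Proof.
move=> eps0; elim: k f => [|k IH] f Hf.
  exists (fun _ => tt), (fun _ _ => 0) => A B.
  have f0 x y : f x y = 0.
    have s0 : \sum_x \sum_y f x y ^+ 2 = 0.
      apply/eqP; rewrite eq_le; apply/andP; split; first by rewrite mul0r in Hf.
      by do 2! apply: sumr_ge0 => ? _; exact: sqr_ge0.
    have := @psumr_eq0P _ _ xpredT (fun x => \sum_y f x y ^+ 2).
    move=> /(_ (fun i _ => sumr_ge0 _ (fun j _ => sqr_ge0 _)) s0 x isT) s1.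
    have := @psumr_eq0P _ _ xpredT (fun y => f x y ^+ 2).
    move=> /(_ (fun i _ => sqr_ge0 _) s1 y isT) /eqP.
    by rewrite sqrf_eq0 => /eqP.
  rewrite big1 ?normr0; first by rewrite mulr_ge0 ?exprn_ge0 ?ler0n // ltW.
  by move=> x _; rewrite big1 // => y _; rewrite f0 subrr.
have [Hc|] := boolP `[< cut_le f (eps * #|V|%:R ^+ 2) >].
  exists (fun _ => boxes0 k.+1), (fun _ _ => 0) => A B; move/asboolP: Hc => /(_ A B).
  by under [in X in _ -> X]eq_bigr do under eq_bigr do rewrite subr0.
move=> /asboolP /existsNP[A /existsNP[B /negP]]; rewrite -ltNge.
set S0 := \sum_(x in A) _ => HS0.
pose sg : R := Num.sg S0.
pose box x y : R := (x \in A)%:R * (y \in B)%:R.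
pose f' x y := f x y - eps * sg * box x y.
have S0E : S0 = \sum_x \sum_y f x y * box x y.
  rewrite /S0 big_mkcond; apply: eq_bigr => x _; rewrite /box.
  case: (x \in A); last by rewrite big1 // => y _; rewrite mul0r mulr0.
  rewrite big_mkcond; apply: eq_bigr => y _.
  by case: (y \in B); rewrite !(mul1r, mul0r, mulr1, mulr0).
have sg2 : sg ^+ 2 <= 1.
  by rewrite /sg sqr_sg; case: (S0 != 0).
have [] := IH f'.
  have E : \sum_x \sum_y f' x y ^+ 2 = \sum_x \sum_y f x y ^+ 2
     - 2 * eps * sg * S0 + \sum_x \sum_y eps ^+ 2 * sg ^+ 2 * box x y ^+ 2.
    rewrite S0E mulr_sumr -sumrB -big_split; apply: eq_bigr => x _ /=.
    rewrite mulr_sumr -sumrB -big_split; apply: eq_bigr => y _ /=.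
    by rewrite /f'; ring.
  have B1 : \sum_x \sum_y eps ^+ 2 * sg ^+ 2 * box x y ^+ 2 <= eps ^+ 2 * #|V|%:R ^+ 2.
    apply: (@le_trans _ _ (\sum_(x : V) \sum_(y : V) eps ^+ 2)).
      do 2! apply: ler_sum => ? _.
      rewrite -mulrA ler_piMr ?sqr_ge0 // mulr_ile1 ?sqr_ge0 //.
      by rewrite /box; case: (_ \in _); case: (_ \in _);
         rewrite ?mul1r ?mulr0 ?mul0r ?expr1n ?expr0n.
    rewrite !sumr_const -mulrnA -[eps ^+ 2 *+ _]mulr_natr.
    by rewrite natrM expr2.
  have sgS : sg * S0 = `|S0| by rewrite /sg -normrEsg.
  rewrite E -[2 * eps * sg * S0]mulrA sgS; move: Hf HS0 B1.
  rewrite -natr1 mulrDl mul1r.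
  set X := \sum_x _; set Y := \sum_x _; set m := #|V|%:R ^+ 2 => H1 H2 H3.
  have : eps * (eps * m) <= eps * `|S0| by rewrite ler_pM2l // ltW.
  rewrite -mulrA; move: H1 H3; rewrite expr2 -mulrA; move: (eps * `|S0|) (eps * (eps * m)).
  by move=> u v; lra.
move=> p [S HS].
exists (fun x => (p x, (x \in A, x \in B))).
exists (fun a b : boxes k.+1 =>
  S a.1 b.1 + eps * sg * ((a.2.1 : bool)%:R * (b.2.2 : bool)%:R)) => A' B' /=.
rewrite (_ : \sum_(x in A') _ = \sum_(x in A') \sum_(y in B') (f' x y - S (p x) (p y))).
  exact: HS.
by apply: eq_bigr => x _; apply: eq_bigr => y _; rewrite /f' /box; ring.
Qed.

End WeakRegularity.

(** * Averaging over the cells of a partition, and the counting lemma *)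

Section Averaging.
Variables (R : realType) (V T : finType) (p : V -> T).
Implicit Types (f : V -> V -> R) (g h : V -> R).

(** The uniform probability on the cell [t]. An empty cell gives [0]. *)
Definition avg_ker (t : T) (x : V) : R := (p x == t)%:R / \sum_z (p z == t)%:R.

(** The average of [f] over the product of the cells [t] and [t']. *)
Definition avg2 f (t t' : T) : R :=
  \sum_x \sum_y avg_ker t x * avg_ker t' y * f x y.

Lemma avg_ker_ge0 t x : 0 <= avg_ker t x.
Proof. by rewrite /avg_ker divr_ge0 ?ler0n // sumr_ge0. Qed.

Lemma avg_ker_sym x x' : avg_ker (p x) x' = avg_ker (p x') x.
Proof. by rewrite /avg_ker eq_sym; case: eqP => [->|] //; rewrite !mul0r. Qed.

Lemma avg_ker_const (S : T -> R) x : \sum_x' avg_ker (p x) x' * S (p x') = S (p x).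
Proof.
have c0 : \sum_z (p z == p x)%:R != 0 :> R.
  by rewrite gt_eqF // (bigD1 x) //= eqxx ltr_pwDl ?ltr01 // sumr_ge0.
rewrite -[RHS](mul1r) -(divff c0) mulr_suml mulr_suml.
by apply: eq_bigr => z _; rewrite /avg_ker; case: eqP => [->|] //; rewrite !mul0r.
Qed.

Lemma avg_ker_sum x : \sum_x' avg_ker (p x) x' = 1.
Proof.
by rewrite -(avg_ker_const (fun=> 1) x); apply: eq_bigr => z _; rewrite mulr1.
Qed.

Lemma avg_in01 g : in01 g -> in01 (fun x => \sum_x' avg_ker (p x) x' * g x').
Proof.
move=> g01 x; apply/andP; split.
  by apply: sumr_ge0 => z _; rewrite mulr_ge0 ?avg_ker_ge0 //; case/andP: (g01 z).
rewrite -(avg_ker_sum x); apply: ler_sum => z _.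
by rewrite ler_piMr ?avg_ker_ge0 //; case/andP: (g01 z).
Qed.

(** Averaging over cells is self-adjoint, as its kernel is symmetric. *)
Lemma avg2_adjoint f phi :
  \sum_x \sum_y phi x y * avg2 f (p x) (p y) =
  \sum_x \sum_y avg2 phi (p x) (p y) * f x y.
Proof.
rewrite /avg2 !pair_big /=.
pose G (z w : V * V) := phi z.1 z.2 * avg_ker (p z.1) w.1 * avg_ker (p z.2) w.2 * f w.1 w.2.
transitivity (\sum_z \sum_w G z w).
  apply: eq_bigr => z _; rewrite pair_big mulr_sumr; apply: eq_bigr => w _ /=.
  by rewrite /G; ring.
rewrite exchange_big; apply: eq_bigr => w _ /=.
rewrite pair_big mulr_suml; apply: eq_bigr => z _ /=.
by rewrite /G (avg_ker_sym z.1) (avg_ker_sym z.2); ring.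
Qed.

Lemma avg2_prod g h t t' :
  avg2 (fun x y => g x * h y) t t' =
  (\sum_x avg_ker t x * g x) * (\sum_y avg_ker t' y * h y).
Proof.
rewrite /avg2 mulr_suml; apply: eq_bigr => x _; rewrite mulr_sumr.
by apply: eq_bigr => y _; ring.
Qed.

Lemma avg2_const (S : T -> T -> R) x y :
  avg2 (fun x y => S (p x) (p y)) (p x) (p y) = S (p x) (p y).
Proof.
rewrite -[RHS](avg_ker_const (fun t => S t (p y)) x); apply: eq_bigr => x' _.
rewrite -(avg_ker_const (fun t => S (p x') t) y) mulr_sumr.
by apply: eq_bigr => y' _; rewrite mulrA.
Qed.

Lemma avg2B f1 f2 t t' :
  avg2 (fun x y => f1 x y - f2 x y) t t' = avg2 f1 t t' - avg2 f2 t t'.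
Proof.
rewrite /avg2 -sumrB; apply: eq_bigr => x _; rewrite -sumrB.
by apply: eq_bigr => y _; rewrite mulrBr.
Qed.

Lemma avg2_ge0 f t t' : (forall x y, 0 <= f x y) -> 0 <= avg2 f t t'.
Proof.
move=> f0; apply: sumr_ge0 => x _; apply: sumr_ge0 => y _.
by apply: mulr_ge0 => //; apply: mulr_ge0; exact: avg_ker_ge0.
Qed.

Lemma avg2_sym f t t' : (forall x y, f x y = f y x) -> avg2 f t t' = avg2 f t' t.
Proof.
move=> fs; rewrite /avg2 exchange_big; apply: eq_bigr => x _; apply: eq_bigr => y _.
by rewrite fs; ring.
Qed.

Lemma avg2_le1 f x y : (forall x y, 0 <= f x y <= 1) -> avg2 f (p x) (p y) <= 1.
Proof.
move=> f01; rewrite -(avg2_const (fun _ _ => 1) x y).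
rewrite /avg2; apply: ler_sum => x' _; apply: ler_sum => y' _.
apply: ler_wpM2l; first by apply: mulr_ge0; exact: avg_ker_ge0.
by have /andP[] := f01 x' y'.
Qed.

(** If some cell-wise constant function is within [c] of [f] in cut norm, then
    the cell averages of [f] are within [2 * c]: averaging is a contraction. *)
Lemma avg2_cut f (S : T -> T -> R) c g h :
  cut_le (fun x y => f x y - S (p x) (p y)) c -> in01 g -> in01 h ->
  `|\sum_x \sum_y g x * h y * (f x y - avg2 f (p x) (p y))| <= 2 * c.
Proof.
move=> fc g01 h01; pose F x y := f x y - S (p x) (p y).
pose g' x := \sum_x' avg_ker (p x) x' * g x'.
pose h' x := \sum_x' avg_ker (p x) x' * h x'.
have -> : \sum_x \sum_y g x * h y * (f x y - avg2 f (p x) (p y)) =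
    \sum_x \sum_y g x * h y * F x y - \sum_x \sum_y g' x * h' y * F x y.
  transitivity (\sum_x \sum_y g x * h y * F x y -
                \sum_x \sum_y (g x * h y) * avg2 F (p x) (p y)).
    rewrite -sumrB; apply: eq_bigr => x _; rewrite -sumrB.
    by apply: eq_bigr => y _; rewrite /F avg2B avg2_const; ring.
  congr (_ - _); rewrite avg2_adjoint; apply: eq_bigr => x _; apply: eq_bigr => y _.
  by rewrite avg2_prod.
have := cut_le_test fc g01 h01.
have := cut_le_test fc (avg_in01 g01) (avg_in01 h01).
rewrite -/F -/(g') -/(h') => H1 H2; apply: le_trans (ler_normB _ _) _.
by rewrite mulr2n mulrDl mul1r lerD.
Qed.

End Averaging.

Section CountingLemma.
Variables (R : realType) (V : finType) (s : nat).
Notation X := {ffun 'I_s -> V}.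
Notation pr := ('I_s * 'I_s)%type.
Implicit Types (chi : X -> R) (e : pr) (L : seq pr).

(** When all other coordinates are frozen, [chi] is a product of a function of
    coordinate [e.1] and a function of coordinate [e.2]. *)
Definition splits e chi := forall x : X, exists g h : V -> R,
  [/\ in01 g, in01 h & forall u v, chi (upd (upd x e.1 u) e.2 v) = g u * h v].

Lemma splits_one e : splits e (fun=> 1).
Proof. by move=> x; exists (fun=> 1), (fun=> 1); split=> [?|?|??]; rewrite ?ler01 ?lexx ?mulr1. Qed.

Lemma in01M (T : Type) (g h : T -> R) : in01 g -> in01 h -> in01 (fun x => g x * h x).
Proof.
move=> g01 h01 x; have /andP[? ?] := g01 x; have /andP[? ?] := h01 x.
by rewrite mulr_ge0 // mulr_ile1.
Qed.

Lemma splitsM e chi1 chi2 :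
  splits e chi1 -> splits e chi2 -> splits e (fun x => chi1 x * chi2 x).
Proof.
move=> H1 H2 x; have [g1 [h1 [a1 b1 E1]]] := H1 x; have [g2 [h2 [a2 b2 E2]]] := H2 x.
exists (fun u => g1 u * g2 u), (fun v => h1 v * h2 v); split; try exact: in01M.
by move=> u v; rewrite E1 E2; ring.
Qed.

Definition lt_pair e := (e.1 < e.2)%N.

Lemma splits_pair e e' (phi : V -> V -> R) : lt_pair e -> lt_pair e' -> e != e' ->
  (forall x y, 0 <= phi x y <= 1) -> splits e (fun x => phi (x e'.1) (x e'.2)).
Proof.
case: e e' => [i j] [i' j']; rewrite /lt_pair /= => ij ij' ne phi01 x.
have ji : j != i by apply: contraTneq ij => ->; rewrite ltnn.
have [jin|jnin] := boolP ((j == i') || (j == j')).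
  exists (fun=> 1), (fun v => phi (upd x j v i') (upd x j v j')).
  split=> [u|v|u v]; rewrite ?ler01 ?lexx ?phi01 // mul1r.
  have i1 : i' != i.
    apply: contraNneq ne => Ei; subst i'.
    by case/orP: jin => /eqP Ej; subst j => //; rewrite eqxx in ji.
  have i2 : j' != i.
    apply: contraTneq jin => Ei; subst j'; rewrite negb_or ji andbT.
    by apply: contraTneq ij => ->; rewrite -leqNgt ltnW.
  by congr phi; rewrite !ffunE (negbTE i1, negbTE i2).
exists (fun u => phi (upd x i u i') (upd x i u j')), (fun=> 1).
split=> [u|v|u]; rewrite ?ler01 ?lexx ?phi01 //.
move: jnin; rewrite negb_or ![j == _]eq_sym => /andP[j1 j2] v.
rewrite mulr1.
by congr phi; rewrite [LHS]ffunE /= (negbTE j1, negbTE j2).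
Qed.

Variables (Phi Psi : pr -> V -> V -> R) (c : R).
Hypothesis Phi01 : forall e x y, 0 <= Phi e x y <= 1.
Hypothesis Psi01 : forall e x y, 0 <= Psi e x y <= 1.
Hypothesis close : forall e g h, in01 g -> in01 h ->
  \sum_x \sum_y g x * h y * (Phi e x y - Psi e x y) <= c * #|V|%:R ^+ 2.
Hypothesis V0 : (0 < #|V|)%N.

(** The product over the pairs [e] of [L] of the values of [Q e] at the entries
    of [x] in the two positions of [e]. *)
Definition prodL (Q : pr -> V -> V -> R) L (x : X) : R := \prod_(e <- L) Q e (x e.1) (x e.2).

Lemma splits_prodL e L (Q : pr -> V -> V -> R) : lt_pair e -> all lt_pair L -> e \notin L ->
  (forall e x y, 0 <= Q e x y <= 1) -> splits e (prodL Q L).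
Proof.
move=> le; elim: L => [_ _ _|e' L IH /= /andP[le' lL]].
  by move=> x; have [g [h [? ? E]]] := splits_one e x; exists g, h; split=> // u v;
     rewrite -E /prodL big_nil.
rewrite inE negb_or => /andP[ne nL] Q01 x.
have := splitsM (splits_pair le le' ne (Q01 e')) (IH lL nL Q01) x.
by move=> [g [h [? ? E]]]; exists g, h; split=> // u v; rewrite -E /prodL big_cons.
Qed.

(** Freezing all coordinates but the two of [e] reduces one replacement of
    [Psi e] by [Phi e] to the cut norm. *)
Lemma counting_step e chi : lt_pair e -> splits e chi ->
  \sum_x chi x * (Phi e (x e.1) (x e.2) - Psi e (x e.1) (x e.2)) <=
    c * \sum_(x : X) 1.
Proof.
move=> le He.
have n0 : 0 < #|V|%:R ^+ 2 :> R by rewrite exprn_gt0 ?ltr0n.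
rewrite -(ler_pM2l n0) -(sum_upd2 _ e.1 e.2).
rewrite mulr_sumr mulr_sumr; apply: ler_sum => x _.
have [g [h [g01 h01 E]]] := He x.
have ne : e.1 != e.2 by apply: contraTneq le; rewrite /lt_pair => ->; rewrite ltnn.
under eq_bigr do under eq_bigr do rewrite E upd_at upd_ne // upd_at.
by apply: le_trans (close e g01 h01) _; rewrite mulr1 mulrC.
Qed.

Lemma counting_lemma_aux L chi : uniq L -> all lt_pair L ->
  (forall e, e \in L -> splits e chi) ->
  \sum_x chi x * (prodL Phi L x - prodL Psi L x) <= (size L)%:R * (c * \sum_(x : X) 1).
Proof.
elim: L chi => [|e L IH] chi /=.
  by move=> _ _ _; rewrite big1 ?mul0r // => x _; rewrite /prodL !big_nil subrr mulr0.
move=> /andP[eL uL] /andP[le lL] Hs.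
rewrite -natr1 mulrDl mul1r addrC.
have H1 : splits e (fun x => chi x * prodL Phi L x).
  by apply: splitsM; [apply: Hs; rewrite mem_head | exact: splits_prodL].
have H2 : \sum_x (chi x * Psi e (x e.1) (x e.2)) * (prodL Phi L x - prodL Psi L x) <=
    (size L)%:R * (c * \sum_(x : X) 1).
  apply: IH => // e' e'L; apply: splitsM; first by apply: Hs; rewrite inE e'L orbT.
  by apply: splits_pair => //; [exact: (allP lL) | apply: contraNneq eL => <-].
apply: le_trans (lerD (counting_step le H1) H2); rewrite -big_split.
rewrite le_eqVlt; apply/orP; left; apply/eqP; apply: eq_bigr => x _ /=.
by rewrite /prodL !big_cons; ring.
Qed.

(** Telescoping over the pairs of [L]. *)
Lemma counting_lemma L : uniq L -> all lt_pair L ->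
  \sum_x prodL Phi L x <= \sum_x prodL Psi L x + (size L)%:R * (c * \sum_(x : X) 1).
Proof.
move=> uL lL; rewrite -lerBlDl -sumrB.
apply: le_trans (counting_lemma_aux uL lL (chi := fun=> 1) _).
  by rewrite le_eqVlt; apply/orP; left; apply/eqP; apply: eq_bigr => x _; rewrite mul1r.
by move=> e _; exact: splits_one.
Qed.

End CountingLemma.

(** * Containers: every multigraph is almost below a blow-up with few heavy tuples *)

Section Pairs.
Variables (s : nat) (V : finType).

(** The list of increasing pairs of positions. *)
Definition lt_pairs : seq ('I_s * 'I_s) := [seq e <- index_enum ('I_s * 'I_s)%type | lt_pair e].

Lemma lt_pairs_uniq : uniq lt_pairs.
Proof. by rewrite filter_uniq // index_enum_uniq. Qed.

Lemma lt_pairs_lt : all (@lt_pair s) lt_pairs.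
Proof. exact: filter_all. Qed.

Lemma tuple_weight_pairs (C : V -> V -> nat) (x : {ffun 'I_s -> V}) : (forall x y, C x y = C y x) ->
  tuple_weight C x = (\sum_(e <- lt_pairs) C (x e.1) (x e.2))%N.
Proof.
move=> Cs; rewrite /tuple_weight pair_big_dep big_filter /=.
pose h (e : 'I_s * 'I_s) := (e.2, e.1).
have hK : involutive h by case.
rewrite (reindex_inj (inv_inj hK)) /=.
by apply: eq_big => [e|e _] //; rewrite Cs.
Qed.

End Pairs.

Lemma sum_bool_card (R : pzSemiRingType) (V : finType) (P : pred V) :
  \sum_x (P x)%:R = #|P|%:R :> R.
Proof.
rewrite -sum1_card natr_sum [RHS]big_mkcond; apply: eq_bigr => x _.
by rewrite unfold_in; case: (P x).
Qed.

Lemma sumr_card1 (R : pzSemiRingType) (V : finType) : \sum_(x : V) 1 = #|V|%:R :> R.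
Proof. by rewrite sumr_const. Qed.

Lemma noninj_le (R : realType) (s : nat) (V : finType) (x : {ffun 'I_s -> V}) :
  (~~ injectiveb x)%:R <= \sum_(e <- lt_pairs s) (x e.1 == x e.2)%:R :> R.
Proof.
case: injectivePn => [[i [j ij E]]|_]; last by rewrite sumr_ge0.
wlog lij : i j ij E / (i < j)%N.
  move=> H; case: (ltngtP i j) => ij'; [exact: (H i j) | | by rewrite (val_inj ij') eqxx in ij].
  by apply: (H j i) => //; rewrite eq_sym.
rewrite big_filter (bigD1 (i, j)) //= E eqxx /=.
by rewrite lerDl sumr_ge0.
Qed.

Lemma sum_eq_pair (R : realType) (s : nat) (V : finType) (e : 'I_s * 'I_s) :
  lt_pair e -> #|V|%:R * \sum_(x : {ffun 'I_s -> V}) (x e.1 == x e.2)%:R =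
    #|{ffun 'I_s -> V}|%:R :> R.
Proof.
move=> le; have ne : e.2 != e.1.
  by apply: contraTneq le; rewrite /lt_pair => ->; rewrite ltnn.
rewrite -(sum_upd _ e.1) -sumr_card1; apply: eq_bigr => x _.
rewrite (bigD1 (x e.2)) //= upd_at upd_ne // eqxx big1 ?addr0 // => u /negbTE un.
by rewrite upd_at upd_ne // un.
Qed.

Section Container.
Variables (R : realType) (s q : nat).

(** Every [G] whose injective tuples have weight at most [q] is, up to a
    proportion [eps] of the pairs, below a blow-up [c (p x) (p y)] with at most
    a proportion [eta] of tuples of weight more than [q]. The type [T] does not
    depend on [G] or [V]. *)
Lemma container_lemma (eps eta : R) : 0 < eps <= 1 -> 0 < eta ->
  exists (T : finType) (n0 : nat), forall (V : finType) (G : V -> V -> nat),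
    (n0 <= #|V|)%N -> (forall x y, G x y = G y x) -> (forall x y, G x y <= q)%N ->
    (forall x : {ffun 'I_s -> V}, injective x -> tuple_weight G x <= q)%N ->
  exists (p : V -> T) (c : T -> T -> nat),
  [/\ forall t t', c t t' = c t' t, forall t t', (c t t' <= q)%N,
      \sum_x \sum_y (c (p x) (p y) < G x y)%N%:R <= eps * #|V|%:R ^+ 2 &
      \sum_(x : {ffun 'I_s -> V}) (q < tuple_weight (fun x y => c (p x) (p y)) x)%N%:R
         <= eta * #|{ffun 'I_s -> V}|%:R].
Proof.
move=> /andP[eps0 eps1] eta0.
pose eps' : R := eps / q.+1%:R.
have eps'0 : 0 < eps' by rewrite divr_gt0 ?ltr0n.
have eps'1 : eps' <= 1.
  by rewrite ler_pdivrMr ?ltr0n // mul1r (le_trans eps1) // ler1n.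
pose l : R := (size (lt_pairs s))%:R.
pose P : R := #|{ffun 'I_s * 'I_s -> 'I_q.+1}|%:R.
have l0 : 0 <= l by rewrite ler0n.
have P0 : 0 <= P by rewrite ler0n.
pose tau : R := eta * eps' ^+ size (lt_pairs s).
have tau0 : 0 < tau by rewrite mulr_gt0 ?exprn_gt0.
(* The precision required of the weak regularity lemma. *)
pose kap : R := tau / (4 * (P * l + 1)).
have Pl1 : 0 < P * l + 1 by rewrite ltr_wpDl // mulr_ge0.
have kap0 : 0 < kap by rewrite divr_gt0 // mulr_gt0.
pose k : nat := (Num.truncn (kap ^- 2)).+1.
have kE : 1 <= k%:R * kap ^+ 2.
  rewrite -ler_pdivrMr ?exprn_gt0 // mul1r ltW //.
  by rewrite /k truncnS_gt.
pose n0 : nat := (Num.truncn (4 * (P * l + 1) / tau)).+1.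
exists {ffun 'I_q.+1 -> boxes k}, n0 => V G nV Gs Gq Ginj.
set n : R := #|V|%:R.
have nn0 : 4 * (P * l + 1) <= n * tau.
  rewrite -ler_pdivrMr // ltW // (lt_le_trans (truncnS_gt _)) // ler_nat //.
have V0 : (0 < #|V|)%N by rewrite (leq_trans _ nV).
have n_gt0 : 0 < n by rewrite ltr0n.
pose f (v : 'I_q.+1) x y : R := (v <= G x y)%N%:R.
have f01 v x y : 0 <= f v x y <= 1 by rewrite /f; case: leqP; rewrite lexx ler01.
have /choice [pS HpS] : forall v : 'I_q.+1, exists pS : (V -> boxes k) * (boxes k -> boxes k -> R),
    cut_le (fun x y => f v x y - pS.2 (pS.1 x) (pS.1 y)) (kap * n ^+ 2).
  move=> v; have [|p [S H]] := @weak_regularity R V kap k (f v) kap0; last by exists (p, S).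
  apply: (@le_trans _ _ (\sum_(x : V) \sum_(y : V) 1)).
    apply: ler_sum => x _; apply: ler_sum => y _.
    by have /andP[? ?] := f01 v x y; rewrite expr_le1.
  rewrite !sumr_const -mulrnA natrM -expr2 mulrA.
  by rewrite ler_peMl // exprn_ge0 // ler0n.
pose p x : {ffun 'I_q.+1 -> boxes k} := [ffun v => (pS v).1 x].
pose W v t t' := avg2 p (f v) t t'.
(* The cell multiplicity is the largest level [v] that is dense in the cell. *)
pose c t t' : nat := \max_(v < q.+1 | eps' <= W v t t') v.
have cq t t' : (c t t' <= q)%N by apply/bigmax_leqP => v _; rewrite -ltnS.
have Ws v t t' : W v t t' = W v t' t.
  by apply: avg2_sym => x y; rewrite /f Gs.
have cs t t' : c t t' = c t' t by apply: eq_bigl => v; rewrite Ws.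
have Wc x y : eps' <= W (inord (c (p x) (p y))) (p x) (p y).
  have H0 : eps' <= W ord0 (p x) (p y).
    suff -> : W ord0 (p x) (p y) = 1 by [].
    by rewrite -(@avg2_const R V _ p (fun _ _ => 1) x y).
  have [] := @eq_bigmax_cond _ [pred v | eps' <= W v (p x) (p y)] (fun v => val v).
    by apply/card_gt0P; exists ord0; rewrite inE.
  move=> v; rewrite inE => Hv E.
  suff -> : inord (c (p x) (p y)) = v by [].
  by apply: val_inj; rewrite /= inordK ?ltnS ?cq // /c -E; apply: eq_bigl => z; rewrite inE.
exists p, c; split=> //.
  pose phi v x y : R := (W v (p x) (p y) < eps')%R%:R.
  have H x y : (c (p x) (p y) < G x y)%N%:R <= \sum_v f v x y * phi v x y.
    case: ltnP => lt; last by apply: sumr_ge0 => v _; rewrite mulr_ge0.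
    have Gv : val (inord (G x y) : 'I_q.+1) = G x y by rewrite /= inordK // ltnS Gq.
    rewrite (bigD1 (inord (G x y))) //= /f Gv leqnn mul1r /phi.
    rewrite ltNge (contraTN _ lt) ?lerDl; first by rewrite sumr_ge0 // => v _; rewrite mulr_ge0.
    move=> h; rewrite -leqNgt -{1}Gv.
    exact: (@leq_bigmax_cond _ [pred v | eps' <= W v (p x) (p y)] (fun v => val v)).
  apply: (@le_trans _ _ (\sum_v \sum_x \sum_y phi v x y * W v (p x) (p y))).
    apply: (@le_trans _ _ (\sum_v \sum_x \sum_y phi v x y * f v x y)).
      rewrite [leRHS]exchange_big; apply: ler_sum => x _.
      rewrite [leRHS]exchange_big; apply: ler_sum => y _.
      by apply: le_trans (H x y) _; apply: ler_sum => v _; rewrite mulrC.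
    rewrite le_eqVlt; apply/orP; left; apply/eqP; apply: eq_bigr => v _.
    rewrite avg2_adjoint; apply: eq_bigr => x _; apply: eq_bigr => y _.
    by rewrite (@avg2_const R V _ p (fun t t' => (W v t t' < eps')%R%:R)).
  apply: (@le_trans _ _ (\sum_(v < q.+1) \sum_(x : V) \sum_(y : V) eps')).
    apply: ler_sum => v _; apply: ler_sum => x _; apply: ler_sum => y _.
    by rewrite /phi; case: ltP; rewrite ?mul1r ?mul0r => h; rewrite ltW.
  rewrite !sumr_const card_ord -!mulrnA -mulr_natr !natrM /eps' -/n expr2.
  by rewrite le_eqVlt; apply/orP; left; apply/eqP; field; rewrite addrC natr1 pnatr_eq0.
set C := fun x y => c (p x) (p y).
have Cs x y : C x y = C y x by rewrite /C cs.
pose N : R := \sum_(x : {ffun 'I_s -> V}) (q < tuple_weight C x)%N%:R.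
rewrite -/N; set nx : R := #|{ffun 'I_s -> V}|%:R.
have nx0 : 0 <= nx by rewrite ler0n.
pose pat (v : {ffun 'I_s * 'I_s -> 'I_q.+1}) : bool := (q < \sum_(e <- lt_pairs s) v e)%N.
(* Each heavy tuple of the blow-up is counted by its own pattern of levels. *)
have S1 : N * eps' ^+ size (lt_pairs s) <=
   \sum_(v | pat v) \sum_(x : {ffun 'I_s -> V}) prodL (fun e x y => W (v e) (p x) (p y)) (lt_pairs s) x.
  rewrite exchange_big /N mulr_suml; apply: ler_sum => x _.
  have PW v : 0 <= prodL (fun e x y => W (v e) (p x) (p y)) (lt_pairs s) x.
    by apply: prodr_ge0 => e _; apply: avg2_ge0 => ? ?; rewrite ler0n.
  case: ltnP => lt; last by rewrite mul0r sumr_ge0.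
  pose v0 : {ffun 'I_s * 'I_s -> 'I_q.+1} := [ffun e => inord (C (x e.1) (x e.2))].
  rewrite mul1r (bigD1 v0) /=; last first.
    rewrite /pat (leq_trans lt) // (tuple_weight_pairs x Cs); apply: leq_sum => e _.
    by rewrite ffunE inordK // ltnS cq.
  apply: ler_wpDr; first by rewrite sumr_ge0.
  have -> : eps' ^+ size (lt_pairs s) = \prod_(e <- lt_pairs s) eps'.
    by rewrite big_const_seq count_predT iter_mulr_1.
  rewrite /prodL; apply: ler_prod => e _; rewrite ltW //= ffunE; exact: Wc.
(* A tuple realizing a heavy pattern in [G] cannot be injective. *)
have Pf v x : pat v -> prodL (fun e => f (v e)) (lt_pairs s) x <= (~~ injectiveb x)%:R.
  move=> Hv; case: (boolP (injectiveb x)) => [/injectiveP ix|_] /=; last first.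
    apply: prodr_ile1 => e _; exact: f01.
  suff /allPn[e eL /negbTE Hf] : ~~ all (fun e => v e <= G (x e.1) (x e.2))%N (lt_pairs s).
    by rewrite /prodL (big_rem e) //= {1}/f Hf mul0r.
  apply: contraL Hv => /allP Ha; rewrite /pat -leqNgt.
  apply: leq_trans (Ginj x ix); rewrite (tuple_weight_pairs x Gs).
  by rewrite big_seq_cond [leqRHS]big_seq_cond; apply: leq_sum => e; rewrite andbT => /Ha.
have Sf v : pat v -> \sum_(x : {ffun 'I_s -> V}) prodL (fun e => f (v e)) (lt_pairs s) x <= l * nx / n.
  move=> Hv; rewrite ler_pdivlMr // mulrC.
  apply: (@le_trans _ _ (n * \sum_(x : {ffun 'I_s -> V}) \sum_(e <- lt_pairs s) (x e.1 == x e.2)%:R)).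
    rewrite ler_pM2l //; apply: ler_sum => x _.
    by apply: le_trans (Pf v x Hv) (noninj_le _ _).
  rewrite exchange_big mulr_sumr /= big_seq.
  rewrite (eq_bigr (fun=> nx)); last by move=> e /(allP (lt_pairs_lt s)) le; rewrite sum_eq_pair.
  by rewrite -big_seq big_const_seq count_predT iter_addr_0 /l mulr_natl.
have S2 v : pat v ->
   \sum_(x : {ffun 'I_s -> V}) prodL (fun e x y => W (v e) (p x) (p y)) (lt_pairs s) x <= l * nx / n + l * (2 * kap * nx).
  move=> Hv; apply: le_trans (lerD (Sf v Hv) (lexx _)).
  rewrite -[nx]sumr_card1; apply: counting_lemma => //.
  - move=> e x y; apply/andP; split; last exact/avg2_le1/f01.
    by apply: avg2_ge0 => ? ?; rewrite ler0n.
  - move=> e g h g01 h01; have fc : cut_le (fun x y => f (v e) x y -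
       (fun a b => (pS (v e)).2 (a (v e)) (b (v e))) (p x) (p y)) (kap * n ^+ 2).
      move=> A B; suff -> : \sum_(x in A) \sum_(y in B) (f (v e) x y -
         (pS (v e)).2 (p x (v e)) (p y (v e))) = \sum_(x in A) \sum_(y in B) (f (v e) x y -
         (pS (v e)).2 ((pS (v e)).1 x) ((pS (v e)).1 y)) by exact: HpS.
      by apply: eq_bigr => x _; apply: eq_bigr => y _; rewrite !ffunE.
    have := @avg2_cut R V _ p _ (fun a b => (pS (v e)).2 (a (v e)) (b (v e))) _ g h fc g01 h01.
    rewrite mulrA ler_norml => /andP[H _].
    rewrite lerNl in H; apply: le_trans H; rewrite -sumrN le_eqVlt; apply/orP; left.
    apply/eqP; apply: eq_bigr => x _; rewrite -sumrN; apply: eq_bigr => y _.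
    by rewrite -mulrN opprB.
  - exact: lt_pairs_uniq.
  - exact: lt_pairs_lt.
have S3 : N * eps' ^+ size (lt_pairs s) <= P * (l * nx / n + l * (2 * kap * nx)).
  apply: le_trans S1 _; apply: le_trans (ler_sum _ S2) _.
  rewrite big_mkcond -[P]sumr_card1 mulr_suml; apply: ler_sum => v _; rewrite mul1r.
  have kap0' : 0 <= kap by exact: ltW.
  case: (pat v) => //; apply: addr_ge0; last by do 3! [apply: mulr_ge0 => //].
  by apply: divr_ge0; rewrite ?mulr_ge0 // ltW.
suff S4 : P * (l * nx / n + l * (2 * kap * nx)) <= tau * nx.
  have := le_trans S3 S4; rewrite /tau mulrAC ler_pM2r ?exprn_gt0 //.
have Pl0 : 0 <= P * l by rewrite mulr_ge0.
have A1 : P * l / n <= tau / 4 by rewrite ler_pdivrMr //; lra.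
have A2 : P * l * (2 * kap) <= tau / 2.
  have -> : P * l * (2 * kap) = (tau / 2) * (P * l / (P * l + 1)).
    by rewrite /kap; field; rewrite gt_eqF.
  apply: ler_piMr; first by rewrite divr_ge0 // ltW.
  by rewrite ler_pdivrMr // mul1r lerDl.
have -> : P * (l * nx / n + l * (2 * kap * nx)) = (P * l / n + P * l * (2 * kap)) * nx.
  by field; rewrite gt_eqF.
by rewrite ler_wpM2r //; lra.
Qed.
End Container.

(** * Greedy construction of heavy tuples from a degree condition *)

Lemma sum_ltS (R : nmodType) (s : nat) (k : 'I_s) (F : 'I_s -> R) :
  \sum_(j < s | (j < k.+1)%N) F j = \sum_(j < s | (j < k)%N) F j + F k.
Proof.
rewrite (bigD1 k) //= addrC; congr (_ + _); apply: eq_bigl => j.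
by rewrite ltnS ltn_neqAle andbC.
Qed.

Lemma sum_lt_const (R : pzSemiRingType) (s k : nat) (a : R) : (k <= s)%N ->
  \sum_(i < s | (i < k)%N) a = k%:R * a.
Proof. by move=> ks; rewrite -(big_ord_widen s (fun=> a) ks) sumr_const card_ord mulr_natl. Qed.

Section Greedy.
Variables (R : realType) (V : finType) (s q : nat) (C : V -> V -> nat) (theta : nat -> nat).
Notation X := {ffun 'I_s -> V}.
Implicit Types (x : X) (M : {set V}) (k : nat).
Hypothesis Cq : forall x y : V, (C x y <= q)%N.

(** The multiplicity inside the first [k] entries of [x]. *)
Definition prefix_sum k x : nat := (\sum_(j < s | j < k) \sum_(i < s | i < j) C (x j) (x i))%N.

(** The multiplicity that the greedy construction guarantees after [k] steps. *)
Definition threshold_sum k : nat := (\sum_(j < s | j < k) theta j)%N.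

(** The first [k] entries of [x] lie in [M] and have reached the guarantee. *)
Definition good_prefix M k x : bool :=
  [forall i : 'I_s, (i < k)%N ==> (x i \in M)] && (threshold_sum k <= prefix_sum k x)%N.

Lemma prefix_sum_full x : prefix_sum s x = tuple_weight C x.
Proof. by apply: eq_bigl => j; rewrite ltn_ord. Qed.

Lemma good_prefix_mem M k x (i : 'I_s) : good_prefix M k x -> (i < k)%N -> x i \in M.
Proof. by move=> /andP[/forallP/(_ i)/implyP H _]. Qed.

Lemma prefix_sum_upd (k : 'I_s) x u :
  prefix_sum k.+1 (upd x k u) = (prefix_sum k x + \sum_(i < s | i < k) C u (x i))%N.
Proof.
rewrite /prefix_sum sum_ltS; congr addn.
  apply: eq_bigr => j jk; apply: eq_bigr => i ij.
  by rewrite !upd_ne // neq_ltn ?jk // (ltn_trans ij jk).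
by apply: eq_bigr => i ik; rewrite upd_at upd_ne // neq_ltn ik.
Qed.

Lemma good_prefix_upd M (k : 'I_s) x u : good_prefix M k x -> u \in M ->
  (theta k <= \sum_(i < s | i < k) C u (x i))%N -> good_prefix M k.+1 (upd x k u).
Proof.
move=> ox uM th; apply/andP; split.
  apply/forallP => i; apply/implyP => ik; rewrite ffunE; case: eqP => // /eqP nik.
  by apply: good_prefix_mem ox _; rewrite ltn_neqAle nik -ltnS.
rewrite prefix_sum_upd /threshold_sum (@sum_ltS nat) leq_add //.
by case/andP: ox.
Qed.

Variables (M : {set V}) (gam kap mu : R).
Hypothesis deg : forall x : V, x \in M -> gam * #|M|%:R <= \sum_(y in M) (C y x)%:R.
Hypothesis kap0 : 0 < kap.
Hypothesis Mmu : mu * #|V|%:R <= #|M|%:R.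
Hypothesis V0 : (0 < #|V|)%N.

(** The proportion of [M] available at each greedy step. *)
Definition step_const : R := kap / (s * q.+1)%:R.

Lemma step_const_ge0 : 0 <= step_const.
Proof. by apply: divr_ge0; [exact: ltW | exact: ler0n]. Qed.

(** The number of tuples with a good prefix of length [k]. The later
    coordinates are free, so that these numbers are comparable for all [k]. *)
Definition good_count k : R := \sum_(x : X) (good_prefix M k x)%:R.

(** The average over [y] in [M] of the multiplicity from [y] to the prefix is
    at least [k * gam], which exceeds [theta k - 1]; as this multiplicity is an
    integer and bounded, it reaches [theta k] for a proportion of the [y]. *)
Lemma greedy_choices (k : 'I_s) x : (0 < theta k)%N ->
  (theta k)%:R - 1 + kap <= k%:R * gam -> good_prefix M k x ->
  step_const * #|M|%:R <= \sum_(y in M) (theta k <= \sum_(i < s | i < k) C y (x i))%N%:R.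
Proof.
move=> th0 hk ox.
set m : R := #|M|%:R; have m0 : 0 <= m by rewrite ler0n.
have s0 : (0 < s)%N by apply: leq_ltn_trans (ltn_ord k).
pose Sx y : nat := (\sum_(i < s | i < k) C y (x i))%N.
pose Y : R := \sum_(y in M) (theta k <= Sx y)%N%:R.
have H1 : k%:R * gam * m <= \sum_(y in M) (Sx y)%:R.
  under eq_bigr do rewrite natr_sum.
  rewrite exchange_big /=.
  have -> : k%:R * gam * m = \sum_(i < s | (i < k)%N) gam * m.
    by rewrite sum_lt_const ?mulrA // ltnW.
  apply: ler_sum => i ik; apply: deg; exact: good_prefix_mem ox ik.
have H2 : \sum_(y in M) (Sx y)%:R <= \sum_(y in M) ((theta k)%:R - 1 + (s * q.+1)%:R * (theta k <= Sx y)%N%:R : R).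
  apply: ler_sum => y _; case: leqP => h.
    have : (Sx y <= theta k - 1 + s * q.+1)%N.
      apply: leq_trans (leq_addl _ _).
      apply: (@leq_trans (\sum_(i < s) q.+1)); last by rewrite sum_nat_const card_ord.
      rewrite /Sx big_mkcond; apply: leq_sum => i _; case: ifP => // _.
      exact: leq_trans (Cq _ _) (leqnSn _).
    by rewrite -(ler_nat R) natrD natrB // mulr1.
  rewrite mulr0 addr0 lerBrDr natr1 ler_nat //.
have H3 : \sum_(y in M) ((theta k)%:R - 1 + (s * q.+1)%:R * (theta k <= Sx y)%N%:R : R) =
   ((theta k)%:R - 1) * m + (s * q.+1)%:R * Y.
  by rewrite big_split /= sumr_const mulr_natr -mulr_sumr.
have D0 : 0 < (s * q.+1)%:R :> R by rewrite ltr0n muln_gt0 s0.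
rewrite -/(Y) /step_const mulrAC ler_pdivrMr // [Y * _]mulrC.
have := le_trans H1 H2; rewrite H3 => H4.
have := ler_wpM2r m0 hk; rewrite mulrDl; lra.
Qed.

Lemma greedy_step (k : 'I_s) : (0 < theta k)%N ->
  (theta k)%:R - 1 + kap <= k%:R * gam -> step_const * mu * good_count k <= good_count k.+1.
Proof.
move=> th0 hk; have n0 : 0 < #|V|%:R :> R by rewrite ltr0n.
have c0 := step_const_ge0.
rewrite -(ler_pM2l n0) -(sum_upd _ k) /good_count !mulr_sumr; apply: ler_sum => x _.
case: (boolP (good_prefix M k x)) => ox; last by rewrite !mulr0 sumr_ge0.
rewrite mulr1; apply: (@le_trans _ _ (step_const * #|M|%:R)).
  by rewrite mulrCA ler_wpM2l // mulrC.
apply: le_trans (greedy_choices th0 hk ox) _.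
rewrite big_mkcond; apply: ler_sum => u _; case: ifP => uM; last exact: ler0n.
by case: leqP => h; [rewrite (good_prefix_upd ox uM h) | exact: ler0n].
Qed.

Lemma greedy (k0 k1 : nat) : (k0 <= k1 <= s)%N ->
  (forall k, (k0 <= k < k1)%N -> (0 < theta k)%N /\ (theta k)%:R - 1 + kap <= k%:R * gam) ->
  0 <= mu -> (step_const * mu) ^+ (k1 - k0) * good_count k0 <= good_count k1.
Proof.
move=> /andP[k01 k1s] H mu0.
have c0 : 0 <= step_const * mu by rewrite mulr_ge0 // step_const_ge0.
have [j Ej] : exists j, k1 = (k0 + j)%N by exists (k1 - k0)%N; rewrite subnKC.
subst k1.
rewrite addKn; elim: j {k01} k1s H => [|j IH] js H; first by rewrite addn0 mul1r.
rewrite addnS in js H *.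
have {}IH := IH (ltnW js) (fun k hk => H k (let: conj a b := andP hk in introT andP (conj a (leqW b)))).
have [th0 hk] : (0 < theta (k0 + j))%N /\ (theta (k0 + j))%:R - 1 + kap <= (k0 + j)%:R * gam.
  by apply: H; rewrite leq_addr ltnSn.
have := @greedy_step (Ordinal js) th0 hk; apply: le_trans.
by rewrite exprS -mulrA ler_wpM2l.
Qed.

Lemma greedy_start : theta 0 = 0%N -> (0 < s)%N ->
  mu * #|{ffun 'I_s -> V}|%:R <= good_count 1.
Proof.
move=> th s0; have n0 : 0 < #|V|%:R :> R by rewrite ltr0n.
pose k := Ordinal s0.
rewrite -(ler_pM2l n0) /good_count -(sum_upd _ k) -(sumr_card1 R {ffun 'I_s -> V}) !mulr_sumr.
apply: ler_sum => x _; rewrite mulr1 mulrC; apply: le_trans Mmu _.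
rewrite -sum1_card natr_sum big_mkcond; apply: ler_sum => u _; case: ifP => uM; last exact: ler0n.
rewrite (@good_prefix_upd _ k x u) //; last by rewrite /= th.
apply/andP; split; first by apply/forallP => i; rewrite ltn0.
by rewrite /threshold_sum big_pred0.
Qed.

End Greedy.

(** * Peeling low-degree vertices bounds the total multiplicity *)

Section Degrees.
Variables (R : realType) (V : finType) (C : V -> V -> nat).
Hypothesis Cs : forall x y, C x y = C y x.
Implicit Types (M : {set V}).

(** The degree of [x] into [M], diagonal term included. *)
Definition deg_in M x : R := \sum_(y in M) (C y x)%:R.
(** The sum of the degrees in [M], hence over ordered pairs. *)
Definition deg_total M : R := \sum_(x in M) deg_in M x.

Lemma deg_total_del M x : x \in M -> deg_total M <= deg_total (M :\ x) + 2 * deg_in M x.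
Proof.
move=> xM; rewrite /deg_total (big_setD1 x) //= [_ + 2 * _]addrC mulr2n mulrDl mul1r -addrA lerD2l.
rewrite (eq_bigr (fun z => (C x z)%:R + deg_in (M :\ x) z)); last first.
  by move=> z _; rewrite /deg_in (big_setD1 x).
rewrite big_split /= lerD2r /deg_in [leRHS](big_setD1 x) //= ler_wpDl ?ler0n //.
by apply: ler_sum => z _; rewrite Cs.
Qed.

(** Removing vertices of degree at most [gam * #|M'|] down to size [k]. Each
    removal from a set of size [m] lowers the total by at most [2 * gam * m],
    which is the increment of [gam * (m ^+ 2 + m)] from [m - 1] to [m]. *)
Lemma peel (gam : R) (k : nat) M : (k <= #|M|)%N ->
  (forall M', M' \subset M -> (k < #|M'|)%N ->
     exists2 x, x \in M' & deg_in M' x <= gam * #|M'|%:R) ->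
  exists M', [/\ M' \subset M, #|M'| = k &
    deg_total M <= deg_total M' + gam * ((#|M|%:R ^+ 2 + #|M|%:R) - (k%:R ^+ 2 + k%:R))].
Proof.
move=> kM; have [j Ej] : exists j, #|M| = (k + j)%N by exists (#|M| - k)%N; rewrite subnKC.
elim: j M {kM} Ej => [|j IH] M Ej H.
  by exists M; rewrite Ej addn0 subrr mulr0 addr0.
have [|x xM dx] := H M (subxx _); first by rewrite Ej addnS ltnS leq_addr.
have E1 : #|M :\ x| = (k + j)%N by have := cardsD1 x M; rewrite xM Ej addnS => -[].
have [|M' [sM cM tM]] := IH _ E1.
  by move=> M' sM; apply: H; exact: fintype.subset_trans sM (subD1set _ _).
exists M'; split=> //; first exact: fintype.subset_trans sM (subD1set _ _).
apply: le_trans (deg_total_del xM) _; move: dx tM; rewrite E1 Ej addnS -natr1.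
move: (deg_total _) (deg_total _) (deg_in _ _) => u v w; lra.
Qed.

End Degrees.

(** The number of tuples whose weight exceeds [q]. *)
Definition heavy_count (R : realType) (V : finType) (s q : nat) (C : V -> V -> nat) : R :=
  \sum_(x : {ffun 'I_s -> V}) (q < tuple_weight C x)%N%:R.

Lemma card_ffun_gt0 (R : realType) (V : finType) (s : nat) : (0 < #|V|)%N ->
  0 < #|{ffun 'I_s -> V}|%:R :> R.
Proof. by move=> V0; rewrite ltr0n card_ffun expn_gt0 V0. Qed.

Lemma good_count_le_heavy (R : realType) (V : finType) s q (C : V -> V -> nat) theta (M : {set V}) :
  (q < threshold_sum s theta s)%N -> good_count R s C theta M s <= heavy_count R s q C.
Proof.
move=> th; apply: ler_sum => x _; case: (boolP (good_prefix _ _ _ _ _)) => [/andP[_]|_]; last by rewrite ler0n.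
by rewrite prefix_sum_full => h; rewrite (leq_trans th h).
Qed.

Section SumUpper.
Variables (R : realType) (s q : nat) (theta : nat -> nat) (gam kap : R).
Hypothesis s0 : (0 < s)%N.
Hypothesis th0 : theta 0 = 0%N.
Hypothesis th : forall k, (1 <= k < s)%N ->
  (0 < theta k)%N /\ (theta k)%:R - 1 + kap <= k%:R * gam.
Hypothesis thq : (q < threshold_sum s theta s)%N.
Hypothesis kap0 : 0 < kap.

(** A set of positive density whose minimum degree beats [gam] would carry too
    many heavy tuples. *)
Lemma low_degree (mu : R) : 0 < mu -> exists2 eta : R, 0 < eta &
  forall (V : finType) (C : V -> V -> nat), (forall x y, C x y <= q)%N ->
   (0 < #|V|)%N -> heavy_count R s q C <= eta * #|{ffun 'I_s -> V}|%:R ->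
   forall M : {set V}, mu * #|V|%:R <= #|M|%:R ->
   exists2 x, x \in M & deg_in R C M x <= gam * #|M|%:R.
Proof.
move=> mu0.
have c0 : 0 < step_const s q kap * mu.
  by rewrite mulr_gt0 // divr_gt0 // ltr0n muln_gt0 s0.
pose c := (step_const s q kap * mu) ^+ (s - 1) * mu.
have c1 : 0 < c by rewrite mulr_gt0 // exprn_gt0.
exists (c / 2) => [|V C Cq V0 Hbad M Mmu]; first by rewrite divr_gt0.
apply: contrapT => Hn.
have deg x : x \in M -> gam * #|M|%:R <= \sum_(y in M) (C y x)%:R.
  by move=> xM; case: (leP (deg_in R C M x) (gam * #|M|%:R)) => [h|/ltW //]; case: Hn; exists x.
have k1s : (1 <= s <= s)%N by rewrite s0 leqnn.
have := greedy Cq deg kap0 Mmu V0 k1s th (ltW mu0).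
have := greedy_start C Mmu V0 th0 s0.
have := good_count_le_heavy R C M thq.
have nx0 := card_ffun_gt0 R s V0.
move: Hbad nx0; move: (heavy_count _ _ _ _) (#|{ffun 'I_s -> V}|%:R) (good_count _ _ _ _ _ s) (good_count _ _ _ _ _ 1%N).
move=> b nx u v H1 H0 H2 H3.
move=> H4; have := ler_wpM2l (exprn_ge0 (s - 1) (ltW c0)) H3; rewrite mulrA -/c => H5.
have : c * nx <= c / 2 * nx by apply: le_trans H5 (le_trans H4 (le_trans H2 H1)).
rewrite ler_pM2r // ; lra.
Qed.

Hypothesis gam0 : 0 <= gam.

Lemma sum_upper (eps : R) : 0 < eps -> exists2 eta : R, 0 < eta & exists n0 : nat,
  forall (V : finType) (C : V -> V -> nat), (forall x y, C x y = C y x) ->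
   (forall x y, C x y <= q)%N ->
   (n0 <= #|V|)%N -> heavy_count R s q C <= eta * #|{ffun 'I_s -> V}|%:R ->
   forall M : {set V}, deg_total R C M <= gam * #|M|%:R ^+ 2 + eps * #|V|%:R ^+ 2.
Proof.
move=> eps0; have q0 : 0 < q.+1%:R :> R by rewrite ltr0n.
pose mu : R := Num.min (1 / 4) (eps / (8 * q.+1%:R)).
have mu0 : 0 < mu by rewrite lt_min !divr_gt0 // mulr_gt0.
have mu4 : mu <= 1 / 4 by rewrite ge_min lexx.
have muq : q.+1%:R * mu <= eps / 8.
  rewrite mulrC -ler_pdivlMr //; apply: le_trans (_ : eps / (8 * q.+1%:R) <= _).
    by rewrite ge_min lexx orbT.
  by rewrite invfM mulrA.
have [eta eta0 Heta] := low_degree mu0; exists eta => //.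
exists (maxn (Num.truncn mu^-1).+1 (Num.truncn (2 * gam / eps)).+1) => V C Cs Cq.
rewrite geq_max => /andP[n1 n2] Hbad.
have V0 : (0 < #|V|)%N by rewrite (leq_trans _ n1).
set n : R := #|V|%:R.
have mun : 1 <= mu * n.
  rewrite mulrC -ler_pdivrMr // mul1r ltW // (lt_le_trans (truncnS_gt _)) // ler_nat //.
have gn : gam <= eps / 2 * n.
  have : 2 * gam / eps <= n by rewrite ltW // (lt_le_trans (truncnS_gt _)) // ler_nat.
  rewrite ler_pdivrMr //; lra.
pose k := (Num.truncn (mu * n)).+1.
have kn : k%:R <= 2 * (mu * n).
  rewrite /k -[X in X <= _]natr1; have : (Num.truncn (mu * n))%:R <= mu * n.
    by rewrite truncn_le // mulr_ge0 ?ltW ?ltr0n.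
  lra.
have n0 : 0 < n by rewrite ltr0n.
have tq (M' : {set V}) : deg_total R C M' <= q%:R * #|M'|%:R ^+ 2.
  apply: (@le_trans _ _ (\sum_(x in M') \sum_(y in M') q%:R)).
    by apply: ler_sum => x _; apply: ler_sum => y _; rewrite ler_nat.
  by rewrite !sumr_const -[_ *+ _ *+ _]mulr_natr -[_ *+ _]mulr_natr expr2 mulrA.
have k0 : 0 <= k%:R :> R by rewrite ler0n.
have Hk : q%:R * k%:R ^+ 2 <= eps / 2 * n ^+ 2.
  have k2 : k%:R ^+ 2 <= (2 * (mu * n)) ^+ 2.
    by rewrite ler_sqr ?nnegrE // (le_trans k0).
  apply: le_trans (ler_wpM2l (ler0n _ q) k2) _.
  have -> : q%:R * (2 * (mu * n)) ^+ 2 = (4 * (q%:R * mu) * mu) * n ^+ 2 :> R by ring.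
  apply: ler_wpM2r; first by rewrite exprn_ge0 // ltW.
  have qmu : q%:R * mu <= eps / 8 by apply: le_trans muq; apply: ler_wpM2r; [exact: ltW | rewrite ler_nat].
  have qmu0 : 0 <= q%:R * mu by apply: mulr_ge0; [exact: ler0n | exact: ltW].
  have := ler_pM (mulr_ge0 (ler0n R 4) qmu0) (ltW mu0) (_ : 4 * (q%:R * mu) <= eps / 2) mu4.
  by move=> /(_ ltac:(lra)); lra.
move=> M; set m : R := #|M|%:R.
have m0 : 0 <= m by rewrite ler0n.
have mn : m <= n by rewrite ler_nat max_card.
case: (leqP k #|M|) => [kM|Mk]; last first.
  have mk : m ^+ 2 <= k%:R ^+ 2 by rewrite ler_sqr ?nnegrE // ler_nat ltnW.
  have := tq M; rewrite -/m; have := ler_wpM2l (ler0n R q) mk.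
  have : 0 <= gam * m ^+ 2 by rewrite mulr_ge0 // exprn_ge0.
  have : 0 <= eps / 2 * n ^+ 2 by rewrite mulr_ge0 ?exprn_ge0 // ltW // divr_gt0.
  lra.
have [|M' [_ cM tM]] := @peel R V C Cs gam k M kM.
  move=> M' _ kM'; apply: (Heta V C Cq V0 Hbad).
  have : (k%:R <= #|M'|%:R :> R) by rewrite ler_nat ltnW.
  by apply: le_trans; rewrite ltW // truncnS_gt.
apply: le_trans tM _; rewrite -/m.
have := tq M'; rewrite cM => tM'.
have H2 : gam * (m ^+ 2 + m - (k%:R ^+ 2 + k%:R)) <= gam * m ^+ 2 + eps / 2 * n ^+ 2.
  apply: (@le_trans _ _ (gam * (m ^+ 2 + m))).
    by rewrite ler_wpM2l // lerBlDr lerDl addr_ge0 // exprn_ge0.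
  rewrite mulrDr lerD2l; apply: (@le_trans _ _ (gam * n)); first by rewrite ler_wpM2l.
  by rewrite expr2 mulrA ler_wpM2r // ltW.
lra.
Qed.

End SumUpper.

(** * Logarithmic gaps and stability below the constant multigraph *)

Section LogGaps.
Variable R : realType.

(** The logarithm of the number of multiplicities from [0] to [v]. *)
Definition lnS (v : nat) : R := ln v.+1%:R.

Lemma lnS_ge0 v : 0 <= lnS v.
Proof. by rewrite ln_ge0 // ler1n. Qed.

Lemma lnS_lt_tangent a v : v != a -> lnS v - lnS a < a.+1%:R^-1 * (v%:R - a%:R).
Proof.
move=> va; have p0 w : (w.+1%:R : R) \is Num.pos by rewrite posrE ltr0n.
rewrite /lnS -ln_div //.
have y0 : 0 < v.+1%:R / a.+1%:R :> R by rewrite divr_gt0 ?ltr0n.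
have : ln (v.+1%:R / a.+1%:R : R) != 0.
  rewrite ln_eq0 // -subr_eq0 -[X in _ - X](@divff _ a.+1%:R) ?pnatr_eq0 //.
  by rewrite -mulrBl mulf_neq0 ?invr_eq0 ?pnatr_eq0 // subr_eq0 eqr_nat eqSS.
move=> /expR_gt1Dx; rewrite lnK //.
suff -> : a.+1%:R^-1 * (v%:R - a%:R) = v.+1%:R / a.+1%:R - 1 :> R.
  by move=> h; rewrite ltrBrDl.
by rewrite -!natr1; field; rewrite natr1 pnatr_eq0.
Qed.

Lemma lnS_incr_lt u v : (u < v)%N -> lnS v.+1 - lnS v < lnS u.+1 - lnS u.
Proof.
move=> uv; have p0 w : (w.+1%:R : R) \is Num.pos by rewrite posrE ltr0n.
have q0 w : 0 < w.+1%:R :> R by rewrite ltr0n.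
rewrite /lnS -!ln_div // ltr_ln ?posrE ?divr_gt0 //.
by rewrite ltr_pdivrMr // mulrAC ltr_pdivlMr // -!natrM ltr_nat; nia.
Qed.

Lemma finite_gap (h : nat -> R) (P : pred nat) (q : nat) : (forall v, P v -> 0 < h v) ->
  exists2 kap, 0 < kap & forall v, (v <= q)%N -> P v -> kap <= h v.
Proof.
move=> hP; elim: q => [|q [kap k0 H]].
  case: (boolP (P 0%N)) => P0; last by exists 1 => // v; rewrite leqn0 => /eqP ->; rewrite (negbTE P0).
  by exists (h 0%N); [exact: hP | move=> v; rewrite leqn0 => /eqP ->].
case: (boolP (P q.+1)) => Pq.
  exists (Num.min kap (h q.+1)); first by rewrite lt_min k0 hP.
  move=> v; rewrite leq_eqVlt => /orP[/eqP ->|]; first by rewrite ge_min lexx orbT.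
  by rewrite ltnS => vq Pv; rewrite ge_min H.
exists kap => // v; rewrite leq_eqVlt => /orP[/eqP ->|]; first by rewrite (negbTE Pq).
exact: H.
Qed.

(** The tangent at [a] dominates, with a gap above [a]. *)
Lemma lnS_gap_tangent (a q : nat) : exists2 kap : R, 0 < kap &
  forall v, (v <= q)%N ->
    lnS v <= lnS a + a.+1%:R^-1 * (v%:R - a%:R) - kap * (a < v)%N%:R.
Proof.
have H v : (a < v)%N -> 0 < lnS a + a.+1%:R^-1 * (v%:R - a%:R) - lnS v.
  by move=> va; have := @lnS_lt_tangent a v; rewrite gtn_eqF // => /(_ isT); move: (_ * _) => t; lra.
have [kap k0 Hk] := finite_gap q H; exists kap => // v vq.
case: ltnP => va; first by have := Hk v vq va; rewrite mulr1; move: (_ * _) => t; lra.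
rewrite mulr0 subr0; have [->|ne] := eqVneq v a; first by rewrite subrr mulr0 addr0.
by have := lnS_lt_tangent ne; move: (_ * _) => t; lra.
Qed.

(** The secant through [b] and [b.+1] dominates, with a gap elsewhere. *)
Lemma lnS_gap_secant (b q : nat) : exists2 kap : R, 0 < kap &
  forall v, (v <= q)%N ->
    lnS v <= lnS b.+1 + (lnS b.+1 - lnS b) * (v%:R - b.+1%:R)
             - kap * ((v != b) && (v != b.+1))%:R.
Proof.
pose h v := lnS b.+1 + (lnS b.+1 - lnS b) * (v%:R - b.+1%:R) - lnS v.
have hS v : h v.+1 - h v = (lnS b.+1 - lnS b) - (lnS v.+1 - lnS v).
  by rewrite /h -[v.+1%:R]natr1; ring.
have hb : h b = 0 by rewrite /h -natr1; ring.
have hb1 : h b.+1 = 0 by rewrite /h; ring.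
have up j : 0 < h (b.+1 + j.+1)%N.
  elim: j => [|j IH].
    have := hS b.+1; rewrite hb1 addn1 => E.
    by have := @lnS_incr_lt b b.+1 (ltnSn b); lra.
  have := hS (b.+1 + j.+1)%N; rewrite -addnS => E.
  have := @lnS_incr_lt b (b.+1 + j.+1)%N; rewrite addSn ltnS leq_addr => /(_ isT).
  by move: IH E; rewrite !addSn !addnS; lra.
have dn j : (j < b)%N -> 0 < h (b - j.+1)%N.
  elim: j => [|j IH] jb.
    have := hS (b - 1)%N; rewrite subn1 prednK // hb => E.
    by have := @lnS_incr_lt b.-1 b; rewrite prednK // leqnn => /(_ isT); lra.
  have Ej : (b - j.+2).+1 = (b - j.+1)%N by rewrite -subSn.
  have := hS (b - j.+2)%N; rewrite Ej => E.
  have := @lnS_incr_lt (b - j.+2)%N b; rewrite Ej.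
  by move=> /(_ (leq_subr _ _)); have := IH (ltnW jb); lra.
have H v : (v != b) && (v != b.+1) -> 0 < h v.
  move=> /andP[v1 v2]; case: (ltngtP v b) => [lt|gt|E]; last by rewrite E eqxx in v1.
    have -> : v = (b - (b - v).-1.+1)%N by rewrite prednK ?subn_gt0 // subKn // ltnW.
    by apply: dn; rewrite prednK ?subn_gt0 // leq_subr.
  have -> : v = (b.+1 + (v - b.+1).-1.+1)%N by rewrite prednK; lia.
  exact: up.
have [kap k0 Hk] := finite_gap q H; exists kap => // v vq.
case: (boolP (_ && _)) => va; first by rewrite mulr1 lerBrDr addrC -lerBrDr; exact: Hk.
rewrite mulr0 subr0 -subr_ge0 -/(h v); suff -> : h v = 0 by [].
by move: va; rewrite negb_and !negbK => /orP[/eqP ->|/eqP ->].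
Qed.

End LogGaps.

(** The sum over all ordered pairs of vertices, diagonal included. *)
Definition sum2 (R : realType) (V : finType) (f : V -> V -> R) : R := \sum_x \sum_y f x y.

Section Sum2.
Variables (R : realType) (V : finType).
Implicit Types f g : V -> V -> R.

Lemma sum2_le f g : (forall x y, f x y <= g x y) -> sum2 f <= sum2 g.
Proof. by move=> H; apply: ler_sum => x _; apply: ler_sum => y _. Qed.

Lemma eq_sum2 f g : (forall x y, f x y = g x y) -> sum2 f = sum2 g.
Proof. by move=> H; apply: eq_bigr => x _; apply: eq_bigr => y _. Qed.

Lemma sum2D f g : sum2 (fun x y => f x y + g x y) = sum2 f + sum2 g.
Proof. by rewrite /sum2 -big_split; apply: eq_bigr => x _; rewrite big_split. Qed.

Lemma sum2Z (c : R) f : sum2 (fun x y => c * f x y) = c * sum2 f.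
Proof. by rewrite /sum2 mulr_sumr; apply: eq_bigr => x _; rewrite mulr_sumr. Qed.

Lemma sum2_const (c : R) : @sum2 R V (fun _ _ => c) = c * #|V|%:R ^+ 2.
Proof.
by rewrite /sum2 !sumr_const -[_ *+ _ *+ _]mulr_natr -[c *+ _]mulr_natr expr2 mulrA.
Qed.

Lemma sum2_ge0 f : (forall x y, 0 <= f x y) -> 0 <= sum2 f.
Proof. by move=> H; apply: sumr_ge0 => x _; apply: sumr_ge0 => y _. Qed.

Lemma deg_total_setT (C : V -> V -> nat) : deg_total R C [set: V]%SET = sum2 (fun x y => (C y x)%:R).
Proof.
by apply: eq_big => [x|x _]; rewrite ?inE //; apply: eq_bigl => y; rewrite inE.
Qed.

End Sum2.

Lemma sum_ord_bin2 s : (\sum_(j < s) j = 'C(s, 2))%N.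
Proof. by rewrite -(big_mkord xpredT (fun j => j)) bin2_sum. Qed.

(** A function with few heavy tuples rarely exceeds [a], or its logarithmic
    sum is smaller than that of the constant [a] by a quadratic amount. *)
Lemma stability_below (R : realType) (s q a b : nat) : (2 <= s)%N ->
  q = (a * 'C(s, 2) + b)%N -> (b <= s - 2)%N ->
  forall delta : R, 0 < delta -> exists beta eta : R, exists n0 : nat,
  [/\ 0 < beta, 0 < eta & forall (V : finType) (C : V -> V -> nat),
     (forall x y, C x y = C y x) -> (forall x y, C x y <= q)%N -> (n0 <= #|V|)%N ->
     heavy_count R s q C <= eta * #|{ffun 'I_s -> V}|%:R ->
     sum2 (fun x y => (a < C x y)%N%:R) <= delta * #|V|%:R ^+ 2 \/
     sum2 (fun x y => lnS R (C x y)) <= (lnS R a - beta) * #|V|%:R ^+ 2].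
Proof.
move=> s2 Eq bs delta d0.
have [kap k0 Hk] := lnS_gap_tangent R a q.
pose al : R := a.+1%:R^-1.
have al0 : 0 < al by rewrite invr_gt0 ltr0n.
pose eps := kap * delta / (4 * al).
have eps0 : 0 < eps by rewrite divr_gt0 // mulr_gt0.
(* These sum to [a * 'C(s, 2) + (s - 1)], which is more than [q]. *)
pose theta k := if k is 0 then 0%N else (k * a + 1)%N.
have s0 : (0 < s)%N by exact: ltnW.
have th k : (1 <= k < s)%N -> (0 < theta k)%N /\ (theta k)%:R - 1 + eps <= k%:R * (a%:R + eps).
  case: k => [//|k] _; split; first by rewrite /theta addn1.
  rewrite /theta natrD natrM addrK mulrDr lerD2l.
  by rewrite ler_peMl ?ler1n // ltW.
have thq : (q < threshold_sum s theta s)%N.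
  have : (threshold_sum s theta s = a * 'C(s, 2) + (s - 1))%N.
    rewrite /threshold_sum; case: s s0 {th Eq s2 bs} => // s' _.
    rewrite (eq_bigl xpredT); last by move=> j; rewrite ltn_ord.
    rewrite -sum_ord_bin2 !big_ord_recl /= !add0n.
    rewrite big_split /= sum_nat_const card_ord muln1 subn1 /=; congr addn.
    by rewrite big_distrr /=; apply: eq_bigr => j _; rewrite mulnC.
  lia.
have [eta eta0 [n0 H]] := @sum_upper R s q theta (a%:R + eps) eps s0 erefl th thq eps0
   (addr_ge0 (ler0n _ _) (ltW eps0)) eps eps0.
exists (kap * delta / 2), eta, n0; split=> //; first by rewrite divr_gt0 // mulr_gt0.
move=> V C Cs Cq nV Hbad.
have [?|far] := leP (sum2 (fun x y => (a < C x y)%N%:R)) (delta * #|V|%:R ^+ 2); [by left|right].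
have := H V C Cs Cq nV Hbad [set: V]%SET; rewrite deg_total_setT cardsT -mulrDl.
have -> : sum2 (fun x y => (C y x)%:R : R) = sum2 (fun x y => (C x y)%:R).
  by apply: eq_sum2 => x y; rewrite Cs.
move=> HD.
apply: (@le_trans _ _ (sum2 (fun x y => (lnS R a - al * a%:R) + (al * (C x y)%:R + - kap * (a < C x y)%N%:R)))).
  by apply: sum2_le => x y; have := Hk _ (Cq x y); rewrite -/al; lra.
rewrite sum2D sum2_const sum2D !sum2Z.
have H1 := ler_wpM2l (ltW al0) HD.
have H2 := ler_wpM2l (ltW k0) (ltW far).
have E : al * eps = kap * delta / 4 by rewrite /eps; field; rewrite gt_eqF.
have H3 : al * ((a%:R + eps + eps) * #|V|%:R ^+ 2) =
   al * a%:R * #|V|%:R ^+ 2 + 2 * (kap * delta / 4) * #|V|%:R ^+ 2.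
  by rewrite -E; ring.
rewrite H3 in H1; move: H1 H2.
move: (#|V|%:R ^+ 2) => n2.
rewrite !mulrBl !mulrA; lra.
Qed.

(** * Classifying the vertices by a clique *)

(** Greedy thresholds: full multiplicity up to an [r.+1]-clique, then a deficit
    of one at each further vertex. *)
Definition theta_turan (r a k : nat) : nat := if (k <= r)%N then (k * a)%N else (k * a - 1)%N.

Section CliqueClasses.
Variables (R : realType) (V : finType) (s r q b : nat) (C : V -> V -> nat).
Hypothesis Cs : forall x y, C x y = C y x.
Hypothesis Cq : forall x y, (C x y <= q)%N.
Hypothesis r0 : (0 < r)%N.
Hypothesis rs : (r < s)%N.
Notation X := {ffun 'I_s -> V}.
Notation a := b.+1.

(** The multiplicity is neither [b] nor [b.+1]. *)
Definition atypical (y z : V) : bool := (C y z != b) && (C y z != a).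

(** Position [r], the first one after the clique. *)
Definition next_ord : 'I_s := Ordinal rs.

Notation th := (theta_turan r a).

(** Placing [y] after the first [r] entries gives a good prefix of length
    [r.+1]; when these entries form a clique, [y] extends it. *)
Definition extends_at (M : {set V}) (x : X) (y : V) : bool :=
  good_prefix C th M r.+1 (upd x next_ord y).

Variables (M : {set V}) (x : X) (gam A : R).
Hypothesis okx : good_prefix C th M r x.
Hypothesis deg : forall z, z \in M -> gam * #|M|%:R <= \sum_(y in M) (C y z)%:R.
Hypothesis clean : forall j i : 'I_s, (j < r)%N -> (i < j)%N -> ~~ atypical (x j) (x i).

(** The [i]-th vertex of the clique. *)
Definition root (i : 'I_r) : V := x (widen_ord (ltnW rs) i).

Lemma sum_root (F : V -> nat) : (\sum_(i < s | i < r) F (x i) = \sum_(i < r) F (root i))%N.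
Proof.
rewrite (big_ord_narrow (ltnW rs)); apply: eq_bigr => i _; congr (F (x _)).
Qed.

Lemma root_mem i : root i \in M.
Proof. exact: (good_prefix_mem (i := widen_ord (ltnW rs) i) okx (ltn_ord i)). Qed.

Lemma threshold_sum_turanE k : (k <= r)%N ->
  threshold_sum s th k = (\sum_(j < s | j < k) \sum_(i < s | i < j) a)%N.
Proof.
move=> kr; apply: eq_bigr => j jk.
rewrite (big_ord_narrow (ltnW (ltn_ord j))) sum_nat_const card_ord /theta_turan.
by rewrite (leq_trans (ltnW jk) kr).
Qed.

(** No pair of the clique exceeds [a] and the total is at least that of
    constant [a], so all its pairs have multiplicity exactly [a]. *)
Lemma clique_lt (j i : 'I_s) : (j < r)%N -> (i < j)%N -> C (x j) (x i) = a.
Proof.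
have Cle (j1 i1 : 'I_s) : (j1 < r)%N -> (i1 < j1)%N -> (C (x j1) (x i1) <= a)%N.
  move=> jr ij; have := clean jr ij; rewrite /atypical negb_and !negbK.
  by case/orP => /eqP ->; rewrite ?leqnSn ?leqnn.
have /andP[_] := okx; rewrite (threshold_sum_turanE (leqnn r)) // /prefix_sum => H.
move=> jr ij; apply/eqP; rewrite eqn_leq Cle //= leqNgt; apply/negP => lt.
move: H; rewrite leqNgt => /negP; apply.
rewrite [X in (X < _)%N](bigD1 j) // [X in (_ < X)%N](bigD1 j) //= -addSn leq_add //.
  rewrite [X in (X < _)%N](bigD1 i) // [X in (_ < X)%N](bigD1 i) //= -addSn leq_add //.
  by apply: leq_sum => i' /andP[? _]; exact: Cle.
apply: leq_sum => j' /andP[? _]; apply: leq_sum => i' ?; exact: Cle.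
Qed.

Lemma clique (j i : 'I_s) : (j < r)%N -> (i < r)%N -> i != j -> C (x j) (x i) = a.
Proof.
move=> jr ir; rewrite neq_ltn => /orP[ij|ji]; first exact: clique_lt.
by rewrite Cs clique_lt.
Qed.

(** The class of [y]: the unique clique vertex to which [y] is joined with
    multiplicity [b], when it is joined to all others with multiplicity [a]. *)
Definition class (y : V) : option 'I_r :=
  [pick i : 'I_r | [&& y \in M, C y (root i) == b & [forall j, (j != i) ==> (C y (root j) == a)]]].

Lemma classP y i : class y = Some i ->
  [/\ y \in M, C y (root i) = b & forall j, j != i -> C y (root j) = a].
Proof.
rewrite /class; case: pickP => // k /and3P[yM /eqP Cb /forallP H] [<-]; split=> // j jk.
by apply/eqP; exact: (implyP (H j)).
Qed.

Lemma extends_atP y : y \in M -> (r * a <= \sum_(i < r) C y (root i))%N -> extends_at M x y.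
Proof.
move=> yM H; apply: (@good_prefix_upd V s C th M next_ord x y okx yM).
by rewrite /theta_turan leqnn sum_root.
Qed.

(** Two vertices of class [i] joined with multiplicity at least [a] form an
    [r.+1]-clique with the clique vertices other than the [i]-th. *)
Lemma class_extends y y' (i : 'I_r) : class y = Some i -> class y' = Some i ->
  (a <= C y y')%N -> extends_at M (upd x (widen_ord (ltnW rs) i) y) y'.
Proof.
set i' := widen_ord _ i => /classP[yM _ Hy] /classP[y'M _ Hy'] ayy'.
have ge (j : 'I_s) z : (forall k : 'I_r, k != i -> C z (root k) = a) -> (j < r)%N -> j != i' -> C z (x j) = a.
  move=> Hz jr ji; have E : j = widen_ord (ltnW rs) (Ordinal jr) by apply: val_inj.
  rewrite E; apply: Hz; apply: contraNneq ji => Ei; apply/eqP/val_inj.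
  by rewrite /= -Ei.
apply: (@good_prefix_upd V s C th M next_ord (upd x i' y) y') => //; last first.
  rewrite /theta_turan leqnn.
  have -> : (r * a = \sum_(j < s | j < r) a)%N.
    by rewrite (big_ord_narrow (ltnW rs)) sum_nat_const card_ord.
  apply: leq_sum => j jr; rewrite ffunE; case: eqP => [_|/eqP ji]; first by rewrite Cs.
  by rewrite (ge j y').
apply/andP; split.
  apply/forallP => j; apply/implyP => jr; rewrite ffunE; case: eqP => // _.
  exact: good_prefix_mem okx jr.
rewrite (threshold_sum_turanE (leqnn r)) //; apply: leq_sum => j jr; apply: leq_sum => k kj.
have kr := ltn_trans kj jr.
rewrite !ffunE; case: (eqVneq j i') => ji; case: (eqVneq k i') => ki.
- by move: kj; rewrite ji ki ltnn.
- by rewrite (ge k y).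
- by rewrite Cs (ge j y).
- by rewrite clique // neq_ltn kj.
Qed.

Definition unclassified : R := \sum_y (class y == None)%:R.

Hypothesis cost1 : \sum_y (extends_at M x y)%:R <= A.
Hypothesis cost2 : \sum_(i < r) \sum_y (atypical y (root i))%:R <= A.

Let K := (r * q + 2)%N.

(** A vertex that does not extend the clique and has typical pairs to it has
    total at most [r * a - 1] to the clique, with equality only if it is
    classified. *)
Lemma unclassified_pointwise y : y \in M ->
  (\sum_(i < r) C y (root i))%:R + (class y == None)%:R <=
    (r * a)%:R - 1 + K%:R * ((extends_at M x y)%:R + \sum_(i < r) (atypical y (root i))%:R) :> R.
Proof.
move=> yM; set S := (\sum_(i < r) C y (root i))%N.
have ra : (1 <= r * a)%N by rewrite muln_gt0 r0.
have [big|nbig] := boolP (extends_at M x y || [exists i, atypical y (root i)]).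
  set Z := _%:R + \sum_(i < r) _; have Z1 : 1 <= Z.
    rewrite /Z; case/orP: big => [->|/existsP[i oi]]; first by rewrite lerDl sumr_ge0.
    rewrite (bigD1 i) //= oi addrCA lerDl addr_ge0 ?ler0n // sumr_ge0 // => *; exact: ler0n.
  have SK : (S + 1 <= K)%N.
    suff : (S <= r * q)%N by rewrite /K; lia.
    rewrite -[X in (_ <= X * _)%N]card_ord -sum_nat_const; apply: leq_sum => i _; exact: Cq.
  have : K%:R <= K%:R * Z by rewrite ler_peMr.
  have : (S%:R + 1 <= K%:R :> R) by rewrite natr1 -addn1 ler_nat.
  have : (1 <= (r * a)%:R :> R) by rewrite ler1n.
  have : (class y == None)%:R <= 1 :> R by case: (_ == _).
  lra.
move: nbig; rewrite negb_or negb_exists => /andP[next /forallP nodd].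
rewrite (negbTE next) add0r big1 ?mulr0 ?addr0; last by move=> i _; rewrite (negbTE (nodd i)).
rewrite lerBrDr; suff : (S + (class y == None) + 1 <= r * a)%N by rewrite -(ler_nat R) !natrD.
have Slt : (S < r * a)%N by rewrite ltnNge; apply: contra next; exact: extends_atP.
case: eqP => cN; last by rewrite addn0 addn1.
rewrite leqNgt; apply/negP => lt; have SE : (S + 1 = r * a)%N by rewrite /= in lt; lia.
have Cv i : C y (root i) = (a - (C y (root i) == b))%N.
  have := nodd i; rewrite /atypical negb_and !negbK => /orP[/eqP ->|/eqP ->].
    by rewrite eqxx subn1.
  by rewrite gtn_eqF // subn0.
have E1 : (S + \sum_(i < r) (C y (root i) == b) = r * a)%N.
  rewrite /S -big_split /= -[X in (_ = X * _)%N]card_ord -sum_nat_const.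
  by apply: eq_bigr => i _; rewrite {1}Cv; case: (_ == _) => /=; rewrite ?subn0 ?addn0 ?subn1 ?addn1.
have E2 : (\sum_(i < r) (C y (root i) == b) = 1)%N by lia.
have [i Hi] : exists i, C y (root i) == b.
  apply/existsP; apply: contraPT E2; rewrite negb_exists => /forallP H.
  by rewrite big1 // => i _; rewrite (negbTE (H i)).
move: cN; rewrite /class; case: pickP => // /(_ i); rewrite yM Hi /= => /negP[].
apply/forallP => j; apply/implyP => ji; case: (boolP (C y (root j) == b)) => [jb|/negbTE jb]; last by rewrite Cv jb subn0.
move: E2; rewrite (bigD1 i) //= (bigD1 j) //= Hi jb; lia.
Qed.

(** The degrees of the clique vertices force equality almost everywhere. *)
Lemma unclassified_le : gam = a%:R - r%:R^-1 - A / #|V|%:R -> (0 < #|V|)%N ->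
  unclassified <= (#|V|%:R - #|M|%:R) + (r + 2 * K)%:R * A.
Proof.
move=> gE V0; have n0 : 0 < #|V|%:R :> R by rewrite ltr0n.
have A0 : 0 <= A by apply: le_trans cost1; rewrite sumr_ge0.
set m : R := #|M|%:R; have m0 : 0 <= m by rewrite ler0n.
have mn : m <= #|V|%:R by rewrite ler_nat max_card.
have r0' : 0 < r%:R :> R by rewrite ltr0n.
have split_unclass : unclassified <= (#|V|%:R - m) + \sum_(y in M) (class y == None)%:R.
  rewrite /unclassified (bigID (mem M)) /= addrC lerD2r.
  apply: (@le_trans _ _ (\sum_(y | y \notin M) 1)); first by apply: ler_sum => y _; case: (_ == _).
  have -> : #|V|%:R = m + \sum_(y | y \notin M) 1 :> R.
    by rewrite -(@sumr_card1 R V) (bigID (mem M)) /= sumr_const.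
  by rewrite addrAC subrr add0r.
apply: le_trans split_unclass _; rewrite lerD2l.
have H1 := @ler_sum _ _ (index_enum V) (mem M) _ _ (fun y yM => unclassified_pointwise yM).
have L : r%:R * (gam * m) <= \sum_(y in M) (\sum_(i < r) C y (root i))%:R.
  under eq_bigr do rewrite natr_sum.
  rewrite exchange_big /=.
  have -> : r%:R * (gam * m) = \sum_(i < r) gam * m by rewrite sumr_const card_ord mulr_natl.
  by apply: ler_sum => i _; apply: deg; exact: root_mem.
have U : \sum_(y in M) ((extends_at M x y)%:R + \sum_(i < r) (atypical y (root i))%:R) <= 2 * A :> R.
  rewrite big_split /= [2 * A]mulr_natl mulr2n; apply: lerD.
    apply: le_trans cost1; rewrite [leRHS](bigID (mem M)) /= lerDl sumr_ge0 //.
  apply: le_trans cost2; rewrite exchange_big; apply: ler_sum => i _.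
  by rewrite [leRHS](bigID (mem M)) /= lerDl sumr_ge0.
have U' := ler_wpM2l (ler0n R K) U.
move: H1; rewrite !big_split /= sumr_const -mulr_sumr -[_ *+ #|M|]mulr_natr -/m => H1.
have E : r%:R * (gam * m) = ((r * a)%:R - 1) * m - r%:R * A * (m / #|V|%:R).
  by rewrite gE natrM; field; rewrite !gt_eqF.
have mr : m / #|V|%:R <= 1 by rewrite ler_pdivrMr // mul1r.
have := ler_wpM2l (mulr_ge0 (ltW r0') A0) mr; rewrite natrD natrM.
move: H1 L U'; rewrite E.
have -> : \sum_(i in M) -1 = - m :> R by rewrite sumrN sumr_const.
set S1 := \sum_(i in M) _; set S2 := \sum_(i in M) _; set S3 := \sum_(i in M) _.
move: (m / _) => mv; lra.
Qed.

Lemma class_size i : gam = a%:R - r%:R^-1 - A / #|V|%:R -> (0 < #|V|)%N ->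
  \sum_y (class y == Some i)%:R <= r%:R^-1 * #|V|%:R + q.+1%:R * A.
Proof.
move=> gE V0; have n0 : 0 < #|V|%:R :> R by rewrite ltr0n.
have A0 : 0 <= A by apply: le_trans cost1; rewrite sumr_ge0.
set m : R := #|M|%:R; have m0 : 0 <= m by rewrite ler0n.
have mn : m <= #|V|%:R by rewrite ler_nat max_card.
have cM : \sum_y (class y == Some i)%:R = \sum_(y in M) (class y == Some i)%:R :> R.
  rewrite [RHS]big_mkcond; apply: eq_bigr => y _; case: ifPn => // yM.
  by case: eqP => // /classP[]; rewrite (negbTE yM).
have L : gam * m <= \sum_(y in M) (C y (root i))%:R by apply: deg; exact: root_mem.
have P y : y \in M ->
  (C y (root i))%:R <= a%:R - (class y == Some i)%:R + q%:R * (atypical y (root i))%:R :> R.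
  move=> _; case: (eqVneq (class y) (Some i)) => [/classP[_ -> _]|_].
    by rewrite -natr1 addrK lerDl mulr_ge0 ?ler0n.
  rewrite subr0; case: (boolP (atypical _ _)) => [_|].
    by rewrite mulr1 -natrD ler_nat (leq_trans (Cq _ _)) // leq_addl.
  rewrite mulr0 addr0 ler_nat /atypical negb_and !negbK => /orP[/eqP ->|/eqP ->] //.
have H := @ler_sum _ _ (index_enum V) (mem M) _ _ P.
have U : \sum_(y in M) (atypical y (root i))%:R <= A.
  apply: le_trans cost2; rewrite (bigD1 i) //= [X in _ <= X + _](bigID (mem M)) /=.
  by rewrite -addrA lerDl addr_ge0 // sumr_ge0 // => j _; rewrite sumr_ge0.
rewrite cM; move: H; rewrite big_split big_split /= sumrN sumr_const -mulr_sumr -[_ *+ #|M|]mulr_natr -/m => H.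
have U' := ler_wpM2l (ler0n R q) U.
have mr : m / #|V|%:R <= 1 by rewrite ler_pdivrMr // mul1r.
have H3 := ler_wpM2l A0 mr.
have r0' : 0 <= r%:R^-1 :> R by rewrite invr_ge0 ler0n.
have H4 := ler_wpM2l r0' mn.
have E : gam * m = a%:R * m - r%:R^-1 * m - A * (m / #|V|%:R).
  by rewrite gE; field; rewrite !gt_eqF // ltr0n.
rewrite -natr1 mulrDl mul1r; move: L H; rewrite E.
move: H3 H4 U'; move: (m / _) (a%:R * m) (r%:R^-1 * m) (r%:R^-1 * #|V|%:R) => ? ? ? ?; lra.
Qed.

Hypothesis cost3 :
  \sum_(i < s | (i < r)%N) sum2 (fun y y' => (extends_at M (upd x i y) y')%:R : R) <= A * #|V|%:R.

Lemma class_inside :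
  sum2 (fun y y' => [&& class y == class y', class y != None & a <= C y y']%N%:R) <= A * #|V|%:R.
Proof.
apply: le_trans cost3; rewrite /sum2 [leRHS]exchange_big; apply: ler_sum => y _.
rewrite [leRHS]exchange_big; apply: ler_sum => y' _.
case: (boolP [&& _, _ & _]) => [/and3P[/eqP E cN ayy']|_]; last by rewrite sumr_ge0.
case cy: (class y) cN => [i|//] _.
rewrite (bigD1 (widen_ord (ltnW rs) i)) //= (class_extends cy) -?E //.
by rewrite lerDl sumr_ge0.
Qed.

End CliqueClasses.

(** * A good clique exists, and near-extremal functions are nearly Turan *)

Section ExistsClique.
Variables (R : realType) (V : finType) (s r b : nat) (C : V -> V -> nat).
Hypothesis rs : (r < s)%N.
Hypothesis V0 : (0 < #|V|)%N.
Notation X := {ffun 'I_s -> V}.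
Notation th := (theta_turan r b.+1).
Variables (M : {set V}) (c1 sig beta tau : R).
Notation n := (#|V|%:R : R).
Notation nx := (#|{ffun 'I_s -> V}|%:R : R).
Hypothesis Nr : c1 * nx <= good_count R s C th M r.
Hypothesis Nr1 : good_count R s C th M r.+1 <= sig * nx.
Hypothesis atypical_le : sum2 (fun y z => (atypical b C y z)%:R) <= beta * n ^+ 2.
Hypothesis tau01 : 0 < tau <= 1.
Hypothesis small : sig * s.+1%:R + beta * (s%:R + s%:R ^+ 2) < tau * c1.

(* Four costs of a tuple: its extensions, the atypical pairs to its entries, its
   extensions after one replacement, and its atypical inner pairs. *)
Let S1 (x : X) : R := \sum_y (extends_at b C rs M x y)%:R.
Let S2 (x : X) : R := \sum_(i < s) \sum_y (atypical b C y (x i))%:R.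
Let S3 (x : X) : R := \sum_(i < s) sum2 (fun y y' => (extends_at b C rs M (upd x i y) y')%:R).
Let S4 (x : X) : R := \sum_(j < s) \sum_(i < s | (i < j)%N) (atypical b C (x j) (x i))%:R.

Lemma sum_S1 : \sum_x S1 x <= sig * nx * n.
Proof.
rewrite /S1 (sum_upd (fun x => (good_prefix C th M r.+1 x)%:R)) mulrC.
by apply: ler_wpM2r; [exact: ler0n | exact: Nr1].
Qed.

Lemma sum_S3 : \sum_x S3 x <= s%:R * sig * nx * n ^+ 2.
Proof.
rewrite /S3 exchange_big /=.
have -> : s%:R * sig * nx * n ^+ 2 = \sum_(i < s) sig * nx * n ^+ 2.
  by rewrite sumr_const card_ord -[RHS]mulr_natl; ring.
apply: ler_sum => i _.
rewrite (sum_upd2 (fun x => (good_prefix C th M r.+1 x)%:R) i (next_ord rs)) mulrC.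
by apply: ler_wpM2r; [rewrite exprn_ge0 ?ler0n | exact: Nr1].
Qed.

Lemma atypical_sum_at (i : 'I_s) : n * \sum_(x : X) \sum_y (atypical b C y (x i))%:R <= nx * (beta * n ^+ 2).
Proof.
rewrite -(sum_upd _ i) -(sumr_card1 R X) mulr_suml; apply: ler_sum => x _.
rewrite mul1r exchange_big; apply: le_trans atypical_le; apply: ler_sum => y _.
by apply: ler_sum => z _; rewrite upd_at.
Qed.

Lemma sum_S2 : \sum_x S2 x <= s%:R * beta * nx * n.
Proof.
have n0 : 0 < n by rewrite ltr0n.
rewrite -(ler_pM2l n0) /S2 exchange_big mulr_sumr /=.
have -> : n * (s%:R * beta * nx * n) = \sum_(i < s) nx * (beta * n ^+ 2).
  by rewrite sumr_const card_ord -[RHS]mulr_natl; ring.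
by apply: ler_sum => i _; exact: atypical_sum_at.
Qed.

Lemma atypical_sum_at2 (j i : 'I_s) : i != j ->
  \sum_(x : X) (atypical b C (x j) (x i))%:R <= nx * beta.
Proof.
move=> ij; have n0 : 0 < n ^+ 2 by rewrite exprn_gt0 ?ltr0n.
rewrite -(ler_pM2l n0) -(sum_upd2 _ j i) mulrCA [_ ^+ 2 * _]mulrC.
rewrite -(sumr_card1 R X) mulr_suml; apply: ler_sum => x _; rewrite mul1r.
apply: le_trans atypical_le; apply: ler_sum => y _; apply: ler_sum => z _.
by rewrite upd_at upd_ne 1?eq_sym // upd_at.
Qed.

Lemma sum_S4 : \sum_x S4 x <= s%:R ^+ 2 * beta * nx.
Proof.
have b0 : 0 <= nx * beta.
  have n0 : 0 < n ^+ 2 by rewrite exprn_gt0 ?ltr0n.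
  apply: mulr_ge0; first exact: ler0n.
  by rewrite -(ler_pM2r n0) mul0r (le_trans _ atypical_le) // sum2_ge0.
rewrite /S4 exchange_big /=.
have -> : s%:R ^+ 2 * beta * nx = \sum_(j < s) \sum_(i < s) nx * beta.
  by rewrite !sumr_const card_ord -[RHS]mulr_natl -[X in _ = _ * X]mulr_natl; ring.
apply: ler_sum => j _; rewrite exchange_big big_mkcond /=; apply: ler_sum => i _.
by case: ifP => // ij; apply: atypical_sum_at2; rewrite neq_ltn ij.
Qed.

(** By averaging, some good prefix of length [r] has no atypical pair, few
    extensions, few atypical pairs to the rest, and few extensions after the
    replacement of any one of its vertices. *)
Lemma exists_clique : exists x : X, [/\ good_prefix C th M r x,
  forall j i : 'I_s, (j < r)%N -> (i < j)%N -> ~~ atypical b C (x j) (x i),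
  \sum_y (extends_at b C rs M x y)%:R <= tau * n,
  \sum_(i < r) \sum_y (atypical b C y (root rs x i))%:R <= tau * n &
  \sum_(i < s | (i < r)%N) sum2 (fun y y' => (extends_at b C rs M (upd x i y) y')%:R : R) <= tau * n * n].
Proof.
have n0 : 0 < n by rewrite ltr0n.
have n20 : 0 < n ^+ 2 by rewrite exprn_gt0.
have S10 x : 0 <= S1 x by rewrite sumr_ge0.
have S20 x : 0 <= S2 x by apply: sumr_ge0 => i _; rewrite sumr_ge0.
have S30 x : 0 <= S3 x by apply: sumr_ge0 => i _; apply: sum2_ge0 => *; exact: ler0n.
have S40 x : 0 <= S4 x by apply: sumr_ge0 => i _; rewrite sumr_ge0.
pose cost x := n * S1 x + n * S2 x + S3 x + n ^+ 2 * S4 x.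
have [x [okx cx]] : exists x : X, good_prefix C th M r x /\ cost x < tau * n ^+ 2.
  apply: contrapT => Hn.
  have H : tau * n ^+ 2 * good_count R s C th M r <= \sum_x cost x.
    rewrite /good_count mulr_sumr; apply: ler_sum => x _.
    case: (boolP (good_prefix _ _ _ _ _)) => okx; last first.
      by rewrite mulr0 !addr_ge0 // mulr_ge0 // ltW.
    by rewrite mulr1 leNgt; apply/negP => h; apply: Hn; exists x.
  have nx0 : 0 < nx by exact: card_ffun_gt0.
  have T : \sum_x cost x <= (sig * s.+1%:R + beta * (s%:R + s%:R ^+ 2)) * (nx * n ^+ 2).
    rewrite /cost !big_split /= -!mulr_sumr -natr1.
    have := ler_wpM2l (ltW n0) sum_S1; have := ler_wpM2l (ltW n0) sum_S2.
    have := sum_S3; have := ler_wpM2l (ltW n20) sum_S4; lra.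
  have H' := ler_wpM2l (ltW (mulr_gt0 (andP tau01).1 n20)) Nr.
  have := le_trans H' (le_trans H T).
  rewrite (_ : tau * n ^+ 2 * (c1 * nx) = tau * c1 * (nx * n ^+ 2)); last by ring.
  by rewrite ler_pM2r ?mulr_gt0 // leNgt small.
have /andP[t0 t1] := tau01.
have P1 := mulr_ge0 (ltW n0) (S10 x); have P2 := mulr_ge0 (ltW n0) (S20 x).
have P3 := S30 x; have P4 := mulr_ge0 (ltW n20) (S40 x).
exists x; split=> //.
- move=> j i jr ij; apply/negP => oij.
  suff : 1 <= S4 x.
    move=> /(ler_wpM2l (ltW n20)) h; have := ler_wpM2r (ltW n20) t1.
    by move: cx; rewrite /cost; lra.
  rewrite /S4 (bigD1 j) //= (bigD1 i) //= oij -addrA lerDl addr_ge0 // sumr_ge0 // => k _.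
  by rewrite sumr_ge0.
- by rewrite -(ler_pM2l n0) -/(S1 x) mulrCA -expr2; move: cx; rewrite /cost; lra.
- apply: (@le_trans _ _ (S2 x)).
    rewrite /S2 (bigID (fun i : 'I_s => (i < r)%N)) /= (big_ord_narrow (ltnW rs)) lerDl.
    by apply: sumr_ge0 => i _; rewrite sumr_ge0.
  by rewrite -(ler_pM2l n0) mulrCA -expr2; move: cx; rewrite /cost; lra.
apply: (@le_trans _ _ (S3 x)).
  rewrite /S3 [leRHS](bigID (fun i : 'I_s => (i < r)%N)) /= lerDl.
  by apply: sumr_ge0 => i _; apply: sum2_ge0 => *; exact: ler0n.
by rewrite -mulrA -expr2; move: cx; rewrite /cost; lra.
Qed.

End ExistsClique.

Lemma threshold_sum_turan (s r t q a : nat) : s = (r + t)%N -> (1 <= t)%N ->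
  (q + t = a * 'C(s, 2))%N -> (0 < a)%N -> threshold_sum s (theta_turan r a) s = q.+1.
Proof.
move=> sE t1 qE a0.
suff : (threshold_sum s (theta_turan r a) s + (t - 1) = a * 'C(s, 2))%N by lia.
have cE : (\sum_(j < s) (r < j) = t - 1)%N.
  rewrite sE big_split_ord /= big1 ?add0n; last by move=> i _; rewrite ltnNge ltnW.
  case: t t1 {sE qE} => // t _; rewrite big_ord_recl /= addn0 ltnn add0n.
  rewrite (eq_bigr (fun=> 1%N)); first by rewrite sum_nat_const card_ord muln1 subn1.
  by move=> i _; rewrite /= addnS ltnS leq_addr.
rewrite -cE /threshold_sum (eq_bigl xpredT); last by move=> j; rewrite ltn_ord.
rewrite -big_split -sum_ord_bin2 big_distrr /=; apply: eq_bigr => j _.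
rewrite /theta_turan; case: leqP => jr; first by rewrite addn0 mulnC.
have ja : (1 <= j * a)%N by rewrite muln_gt0 a0 andbT (leq_ltn_trans _ jr).
by rewrite subnK // mulnC.
Qed.

Section NearTuran.
Variables (R : realType) (s r t q b : nat).
Notation a := b.+1.
Hypothesis sE : s = (r + t)%N.
Hypothesis t1 : (1 <= t)%N.
Hypothesis tr : (t <= r)%N.
Hypothesis qE : (q + t = a * 'C(s, 2))%N.
Notation th := (theta_turan r a).

Lemma r_gt0 : (0 < r)%N. Proof. exact: leq_trans t1 tr. Qed.

Lemma theta_turan_gt0 k : (1 <= k)%N -> (0 < th k)%N.
Proof.
move=> k1; rewrite /theta_turan; case: (leqP k r) => kr; first by rewrite muln_gt0 k1.
by have := r_gt0; nia.
Qed.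

Lemma theta_turan_le k (g kap : R) : (1 <= k)%N ->
  ((k <= r)%N -> kap + k%:R * g <= 1) -> ((r < k)%N -> kap + k%:R * g <= 2) ->
  (th k)%:R - 1 + kap <= k%:R * (a%:R - g).
Proof.
move=> k1 H1 H2; rewrite /theta_turan; case: (leqP k r) => kr.
  by rewrite natrM; have := H1 kr; lra.
rewrite natrB ?natrM; last by rewrite muln_gt0 k1.
by have := H2 kr; lra.
Qed.

Lemma turan_sum_upper (eps : R) : 0 < eps -> exists2 eta : R, 0 < eta & exists n0 : nat,
  forall (V : finType) (C : V -> V -> nat), (forall x y, C x y = C y x) ->
   (forall x y, C x y <= q)%N ->
   (n0 <= #|V|)%N -> heavy_count R s q C <= eta * #|{ffun 'I_s -> V}|%:R ->
   forall M : {set V}, deg_total R C M <= (a%:R - r%:R^-1) * #|M|%:R ^+ 2 + eps * #|V|%:R ^+ 2.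
Proof.
move=> eps0; have r0 := r_gt0; have r0' : 0 < r%:R :> R by rewrite ltr0n.
have s0 : (0 < s)%N by lia.
pose e := eps / 2; have e0 : 0 < e by rewrite divr_gt0.
have th_ok k : (1 <= k < s)%N -> (0 < th k)%N /\ (th k)%:R - 1 + e <= k%:R * (a%:R - (r%:R^-1 - e)).
  move=> /andP[k1 ks]; split; first exact: theta_turan_gt0.
  have ek : e <= k%:R * e by rewrite ler_peMl ?ler1n // ltW.
  apply: theta_turan_le => // kr.
    have : k%:R * r%:R^-1 <= 1 :> R by rewrite ler_pdivrMr // mul1r ler_nat.
    by lra.
  have : k%:R * r%:R^-1 <= 2 :> R by rewrite ler_pdivrMr // -natrM ler_nat; lia.
  by lra.
have thq : (q < threshold_sum s th s)%N by rewrite (threshold_sum_turan sE t1 qE).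
have g0 : 0 <= a%:R - (r%:R^-1 - e).
  have : r%:R^-1 <= 1 :> R by rewrite invf_le1 // ler1n.
  have : 1 <= a%:R :> R by rewrite ler1n.
  lra.
have [eta eta0 [n0 H]] := @sum_upper R s q th _ e s0 erefl th_ok thq e0 g0 e e0.
exists eta => //; exists n0 => V C Cs Cq nV Hb M.
apply: le_trans (H V C Cs Cq nV Hb M) _.
have : #|M|%:R ^+ 2 <= #|V|%:R ^+ 2 :> R by rewrite ler_sqr ?nnegrE ?ler0n // ler_nat max_card.
move=> /(ler_wpM2l (ltW e0)); rewrite opprB addrA mulrDl.
have -> : eps = e + e by rewrite /e; lra.
rewrite [(e + e) * _]mulrDl; move: (_ ^+ 2) (_ ^+ 2) => u v; lra.
Qed.

(** Near-extremal total multiplicity and few atypical pairs give a partial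
    partition into [r] classes that is almost complete, almost balanced from
    above, and has few inner pairs of multiplicity [a] or more. *)
Lemma near_turan (delta : R) : 0 < delta -> exists beta eta : R, exists n0 : nat,
  [/\ 0 < beta, 0 < eta & forall (V : finType) (C : V -> V -> nat),
     (forall x y, C x y = C y x) -> (forall x y, C x y <= q)%N -> (n0 <= #|V|)%N ->
     heavy_count R s q C <= eta * #|{ffun 'I_s -> V}|%:R ->
     (a%:R - r%:R^-1 - beta) * #|V|%:R ^+ 2 <= sum2 (fun x y => (C x y)%:R) ->
     sum2 (fun x y => (atypical b C x y)%:R) <= beta * #|V|%:R ^+ 2 ->
     exists u : V -> option 'I_r,
     [/\ \sum_x (u x == None)%:R <= delta * #|V|%:R,
         forall i, \sum_x (u x == Some i)%:R <= (r%:R^-1 + delta) * #|V|%:R &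
         sum2 (fun x y => [&& u x == u y, u x != None & a <= C x y]%N%:R) <= delta * #|V|%:R ^+ 2]].
Proof.
move=> d0; have r0 := r_gt0; have r0' : 0 < r%:R :> R by rewrite ltr0n.
have rs : (r < s)%N by lia.
have s0 : (0 < s)%N by lia.
pose K := (r + 2 * (r * q + 2) + q.+1)%N.
have K0 : 1 <= K%:R :> R by rewrite ler1n /K addnS.
pose tau : R := Num.min (1 / (4 * r%:R ^+ 2)) (delta / (2 * K%:R)).
have r20 : 0 < 4 * r%:R ^+ 2 :> R by rewrite mulr_gt0 // exprn_gt0.
have tau0 : 0 < tau by rewrite lt_min !divr_gt0 // mulr_gt0 // (lt_le_trans _ K0).
have tau1 : tau * (4 * r%:R ^+ 2) <= 1 by rewrite -ler_pdivlMr // ge_min lexx.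
have tau2 : K%:R * tau <= delta / 2.
  rewrite mulrC -ler_pdivlMr ?(lt_le_trans _ K0) //; apply: le_trans (_ : delta / (2 * K%:R) <= _).
    by rewrite ge_min lexx orbT.
  by rewrite invfM mulrA.
have r1 : 1 <= r%:R :> R by rewrite ler1n.
have rr : r%:R <= r%:R ^+ 2 :> R by rewrite expr2 ler_peMr // ltW.
have tau3 : tau * r%:R ^+ 2 <= 1 / 4 by lra.
have tau4 : tau * r%:R <= 1 / 4 by apply: le_trans tau3; rewrite ler_wpM2l // ltW.
have tau5 : tau <= 1 / 4 by apply: le_trans tau4; rewrite ler_peMr // ltW.
have tau01 : 0 < tau <= 1 by rewrite tau0; lra.
have dle : delta / 2 <= delta by lra.
pose lam : R := Num.min (1 / 2) (delta / 2).
have lam0 : 0 < lam by rewrite lt_min !divr_gt0.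
have lam1 : lam <= 1 / 2 by rewrite ge_min lexx.
have lam2 : lam <= delta / 2 by rewrite ge_min lexx orbT.
pose eps : R := tau * lam / 16.
have eps0 : 0 < eps by rewrite divr_gt0 // mulr_gt0.
have [eta1 eta10 [n1 Hsum]] := turan_sum_upper eps0.
pose kap : R := 1 / (4 * r%:R).
have kap0 : 0 < kap by rewrite divr_gt0 // mulr_gt0.
pose gam : R := a%:R - r%:R^-1 - tau.
have rtau : 2 * (tau * r%:R) + kap <= r%:R^-1.
  rewrite -(ler_pM2r r0') mulVf ?gt_eqF // mulrDl /kap.
  have -> : 1 / (4 * r%:R) * r%:R = 1 / 4 :> R by field; rewrite gt_eqF.
  have -> : 2 * (tau * r%:R) * r%:R = 2 * (tau * r%:R ^+ 2) by ring.
  lra.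
(* Both greedy phases still work with the slightly smaller degree [gam]; only
   the step from an r-clique to an (r+1)-clique does not. *)
have phase k : (1 <= k < s)%N -> k != r ->
    (0 < th k)%N /\ (th k)%:R - 1 + kap <= k%:R * gam.
  move=> /andP[k1 ks] kr; split; first exact: theta_turan_gt0.
  have -> : gam = a%:R - (r%:R^-1 + tau) by rewrite /gam opprD addrA.
  apply: theta_turan_le => // kr'.
    have kr1 : (k.+1%:R <= r%:R :> R) by rewrite ler_nat ltn_neqAle kr.
    have A1 : k%:R * r%:R^-1 <= 1 - r%:R^-1 :> R.
      rewrite ler_pdivrMr // mulrBl mul1r mulVf ?gt_eqF //.
      by move: kr1; rewrite -natr1; lra.
    have A2 : k%:R * tau <= tau * r%:R by rewrite mulrC ler_wpM2l ?ler_nat // ltW.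
    have A3 : 0 <= tau * r%:R by rewrite mulr_ge0 // ltW.
    by rewrite mulrDr; lra.
  have kr1 : (k.+1%:R <= 2 * r%:R :> R).
    have k2r : (k.+1 <= 2 * r)%N by move: ks tr; rewrite sE; clear; lia.
    by move: k2r; rewrite -(ler_nat R) natrM.
  have A1 : k%:R * r%:R^-1 <= 2 - r%:R^-1 :> R.
    rewrite ler_pdivrMr // mulrBl mulVf ?gt_eqF //.
    by move: kr1; rewrite -natr1; lra.
  have A2 : k%:R * tau <= 2 * (tau * r%:R).
    rewrite mulrC [2 * _]mulrCA ler_wpM2l ?ltW // .
    by move: kr1; rewrite -natr1; lra.
  by rewrite mulrDr; lra.
have c0 : 0 < step_const s q kap * (1 / 2).
  by rewrite mulr_gt0 // divr_gt0 // ltr0n muln_gt0 s0.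
pose c := step_const s q kap * (1 / 2).
pose c1 := c ^+ (r - 1) * (1 / 2).
have c10 : 0 < c1 by rewrite mulr_gt0 // exprn_gt0.
pose sig : R := tau * c1 / (4 * s.+1%:R).
have ss0 : 0 < s.+1%:R :> R by rewrite ltr0n.
have sig0 : 0 < sig by apply: divr_gt0; apply: mulr_gt0 => //; rewrite ltr0n.
pose beta : R := Num.min eps (tau * c1 / (4 * (s%:R + s%:R ^+ 2))).
have sp : 0 < s%:R + s%:R ^+ 2 :> R by rewrite addr_gt0 ?exprn_gt0 // ltr0n.
have beta0 : 0 < beta.
  by rewrite lt_min eps0; apply: divr_gt0; apply: mulr_gt0 => //; rewrite ltr0n.
have beta1 : beta <= eps by rewrite ge_min lexx.
have beta2 : beta * (s%:R + s%:R ^+ 2) <= tau * c1 / 4.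
  rewrite -ler_pdivlMr //; apply: le_trans (_ : tau * c1 / (4 * (s%:R + s%:R ^+ 2)) <= _).
    by rewrite ge_min lexx orbT.
  by rewrite invfM mulrA.
have small : sig * s.+1%:R + beta * (s%:R + s%:R ^+ 2) < tau * c1.
  have -> : sig * s.+1%:R = tau * c1 / 4 by rewrite /sig; field; rewrite addrC natr1 gt_eqF.
  by have := mulr_gt0 tau0 c10; lra.
pose eta : R := Num.min eta1 (sig * c ^+ (s - r.+1)).
have eta0 : 0 < eta by rewrite lt_min eta10 mulr_gt0 // exprn_gt0.
pose n2 := (Num.truncn (a%:R / eps)).+1.
pose n3 := (Num.truncn (4 / lam)).+1.
exists beta, eta, (maxn n1 (maxn n2 n3)); split=> // V C Cs Cq.
rewrite !geq_max => /and3P[nV1 nV2 nV3] Hbad HD Hodd.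
have V0 : (0 < #|V|)%N by rewrite (leq_trans _ nV2).
set n : R := #|V|%:R.
have n0 : 0 < n by rewrite ltr0n.
have an : a%:R <= eps * n.
  by rewrite mulrC -ler_pdivrMr // ltW // (lt_le_trans (truncnS_gt _)) // ler_nat.
have ln4 : 4 <= lam * n.
  by rewrite mulrC -ler_pdivrMr // ltW // (lt_le_trans (truncnS_gt _)) // ler_nat.
have nx0 := card_ffun_gt0 R s V0.
have Hbad1 : heavy_count R s q C <= eta1 * #|{ffun 'I_s -> V}|%:R.
  by apply: le_trans Hbad _; rewrite ler_pM2r // ge_min lexx.
have Hs := Hsum V C Cs Cq nV1 Hbad1.
pose k := (Num.truncn ((1 - lam) * n)).+1.
have k_lt : (1 - lam) * n < k%:R by exact: truncnS_gt.
have k_le : k%:R <= (1 - lam / 2) * n.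
  rewrite /k -[X in X <= _]natr1; have : (Num.truncn ((1 - lam) * n))%:R <= (1 - lam) * n.
    by rewrite truncn_le // mulr_ge0 // ?(ltW n0) // subr_ge0; lra.
  lra.
have k0 : 0 <= k%:R :> R by rewrite ler0n.
have lamn0 : 0 < lam * n by rewrite mulr_gt0.
have kn : k%:R <= n by lra.
(* Otherwise peeling leaves a set whose total violates [turan_sum_upper]. *)
have [M [Mk deg]] : exists M : {set V}, (k < #|M|)%N /\
    forall z, z \in M -> gam * #|M|%:R <= \sum_(y in M) (C y z)%:R.
  apply: contrapT => Hn.
  have [|M' _ kM'|M' [_ cM tM]] := @peel R V C Cs gam k [set: V]%SET.
  - by rewrite cardsT -(ler_nat R).
  - apply: contrapT => Hn'; apply: Hn; exists M'; split=> // z zM.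
    case: (leP (deg_in R C M' z) (gam * #|M'|%:R)) => [h|/ltW //]; case: Hn'; by exists z.
  move: tM; rewrite cardsT -/n deg_total_setT.
  have -> : sum2 (fun x y => (C y x)%:R : R) = sum2 (fun x y => (C x y)%:R).
    by apply: eq_sum2 => x y; rewrite Cs.
  have := Hs M'; rewrite cM -/n /gam; move: HD; rewrite -/n.
  set g := a%:R - r%:R^-1; move: (sum2 _) (deg_total _ _ _) => D D' HD HM HT.
  have ga : g - tau <= a%:R.
    have : 0 <= r%:R^-1 :> R by rewrite invr_ge0 ltW.
    by rewrite /g; lra.
  have dk : 0 <= n - k%:R by rewrite subr_ge0.
  have H1 := ler_wpM2r dk ga.
  have H2 : a%:R * (n - k%:R) <= eps * n * n.
    apply: le_trans (_ : a%:R * n <= _); first by rewrite ler_wpM2l ?ler0n // lerBlDr lerDl.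
    by apply: ler_wpM2r; [exact: ltW | exact: an].
  have H3 : lam / 2 * n * n <= n ^+ 2 - k%:R ^+ 2.
    have h1 : lam / 2 * n <= n - k%:R by rewrite lerBrDr -lerBrDl -[X in _ <= X - _]mul1r -mulrBl.
    rewrite subr_sqr; apply: (ler_pM _ (ltW n0) h1); last by rewrite lerDl.
    by apply: mulr_ge0; [apply: divr_ge0; [exact: (ltW lam0)|] | exact: (ltW n0)].
  have H4 := ler_wpM2l (ltW tau0) H3.
  have bn : beta * n ^+ 2 <= eps * n ^+ 2 by rewrite ler_wpM2r // exprn_ge0 // ltW.
  have E : tau * (lam / 2 * n * n) = 8 * (eps * n ^+ 2) by rewrite /eps; field.
  have pos : 0 < eps * n ^+ 2 by rewrite mulr_gt0 // exprn_gt0.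
  rewrite E in H4; rewrite -mulrA -expr2 in H2.
  move: HD HT H1 H2 H4 HM bn pos; rewrite !mulrBr !mulrBl !mulrDr; lra.
set m : R := #|M|%:R.
have mk : (1 - lam) * n <= m by apply: le_trans (ltW k_lt) _; rewrite ler_nat ltnW.
have Mmu : (1 / 2) * n <= m.
  apply: (le_trans _ mk); apply: ler_wpM2r; first exact: ltW.
  by lra.
have half0 : 0 <= 1 / 2 :> R by rewrite divr_ge0.
have N1 := greedy_start C Mmu V0 (erefl : th 0 = 0%N) s0.
have Nr : c1 * #|{ffun 'I_s -> V}|%:R <= good_count R s C th M r.
  have rsb : (1 <= r <= s)%N by rewrite r0 ltnW.
  have ph k' : (1 <= k' < r)%N -> (0 < th k')%N /\ (th k')%:R - 1 + kap <= k'%:R * gam.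
    move=> /andP[h1 h2]; apply: phase; first by rewrite h1 (ltn_trans h2).
    by rewrite neq_ltn h2.
  have := greedy Cq deg kap0 Mmu V0 rsb ph half0; apply: le_trans.
  by rewrite /c1 -mulrA ler_wpM2l // exprn_ge0 // ltW.
have Nr1 : good_count R s C th M r.+1 <= sig * #|{ffun 'I_s -> V}|%:R.
  have rsb : (r.+1 <= s <= s)%N by rewrite rs leqnn.
  have ph k' : (r.+1 <= k' < s)%N -> (0 < th k')%N /\ (th k')%:R - 1 + kap <= k'%:R * gam.
    move=> /andP[h1 h2]; apply: phase; first by rewrite h2 (leq_trans _ h1).
    by rewrite neq_ltn h1 orbT.
  have thq : (q < threshold_sum s th s)%N by rewrite (threshold_sum_turan sE t1 qE).
  have G := le_trans (greedy Cq deg kap0 Mmu V0 rsb ph half0) (good_count_le_heavy R C M thq).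
  have cp : 0 < c ^+ (s - r.+1) by rewrite exprn_gt0.
  rewrite -(ler_pM2l cp); apply: le_trans G _; apply: le_trans Hbad _.
  by rewrite mulrA ler_pM2r // [_ * sig]mulrC ge_min lexx orbT.
have [x [okx clean cost1 cost2 cost3]] := exists_clique rs V0 Nr Nr1 Hodd tau01 small.
have gE : gam = a%:R - r%:R^-1 - tau * n / n by rewrite mulfK ?gt_eqF.
exists (class b C rs M x); split.
- have Hun := unclassified_le Cq r0 okx deg cost1 cost2 gE V0.
  apply: le_trans Hun _.
  have : (r + 2 * (r * q + 2))%:R * (tau * n) <= delta / 2 * n.
    rewrite mulrA ler_wpM2r ?(ltW n0) //; apply: le_trans tau2.
    by rewrite ler_wpM2r ?ler_nat ?leq_addr // ltW.
  have : lam * n <= delta / 2 * n by rewrite ler_wpM2r // ltW.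
  by rewrite -/n -/m; lra.
- move=> i; apply: le_trans (class_size Cq r0 okx deg cost1 cost2 i gE V0) _.
  rewrite mulrDl lerD2l mulrA ler_wpM2r ?(ltW n0) //.
  apply: (@le_trans _ _ (K%:R * tau)); first by rewrite ler_wpM2r ?ler_nat ?leq_addl // ltW.
  exact: le_trans tau2 dle.
apply: le_trans (class_inside Cs okx clean cost3) _.
rewrite -mulrA -expr2 ler_wpM2r ?exprn_ge0 ?ler0n //.
apply: (@le_trans _ _ (K%:R * tau)); first by rewrite ler_peMl // ltW.
exact: le_trans tau2 dle.
Qed.

End NearTuran.

(** * Balanced partitions and stability in the Turan case *)

Section Balance.
Variables (V : finType) (r : nat).
Implicit Types (u : V -> option 'I_r) (p : V -> 'I_r).

(** The number of vertices assigned to [i] by a partial assignment. *)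
Definition part_size u i : nat := (\sum_x (u x == Some i))%N.

(** The sizes of the parts differ pairwise by at most one. *)
Definition balanced p : Prop := forall i j, (\sum_x (p x == i) <= \sum_x (p x == j) + 1)%N.

Lemma sum_part_size u : (\sum_i part_size u i + \sum_x (u x == None) = #|V|)%N.
Proof.
rewrite /part_size exchange_big -big_split -sum1_card; apply: eq_bigr => x _ /=.
case: (u x) => [i|]; last by rewrite big1.
rewrite (bigD1 i) //= eqxx big1 ?addn0 // => j ji.
by rewrite (inj_eq Some_inj) eq_sym (negbTE ji).
Qed.

(** Assign the remaining vertices one at a time to a smallest part. *)
Lemma balanced_extension u : (0 < r)%N ->
  (forall i j, (part_size u i <= #|V| %/ r)%N \/ (part_size u i <= part_size u j + 1)%N) ->
  exists2 p, balanced p & forall x i, u x = Some i -> p x = i.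
Proof.
move=> r0.
have [k Ek] : exists k, (\sum_x (u x == None) = k)%N by exists (\sum_x (u x == None))%N.
elim: k u Ek => [|k IH] u Ek Inv.
  have unN x : u x != None.
    by apply: contraPneq Ek => ux; rewrite (bigD1 x) //= ux eqxx.
  exists (fun x => odflt (Ordinal r0) (u x)); last by move=> x i ->.
  have E i : (\sum_x (odflt (Ordinal r0) (u x) == i) = part_size u i)%N.
    by apply: eq_bigr => x _; have := unN x; case: (u x).
  move=> i j; rewrite !E; case: (Inv i j) => // if_; rewrite leqNgt; apply/negP => lt.
  have := sum_part_size u; rewrite Ek addn0 => S.
  have : (\sum_i part_size u i < \sum_(i < r) #|V| %/ r)%N.
    rewrite (bigD1 j) // [X in (_ < X)%N](bigD1 j) //= -addSn leq_add //; first lia.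
    by apply: leq_sum => l _; case: (Inv l j) => //; lia.
  by rewrite S sum_nat_const card_ord mulnC ltnNge leq_trunc_div.
have [x ux] : exists x, u x = None.
  apply: contrapT => Hn; have : (\sum_x (u x == None) = 0)%N.
    by apply: big1 => x _; case: eqP => // ux; case: Hn; exists x.
  by rewrite Ek.
pose i0 := [arg min_(i < Ordinal r0) part_size u i].
have min0 i : (part_size u i0 <= part_size u i)%N.
  by rewrite /i0; case: arg_minnP => // j _; apply.
pose u' y := if y == x then Some i0 else u y.
have su' i : (part_size u' i = part_size u i + (i == i0))%N.
  rewrite /part_size (bigD1 x) //= [in RHS](bigD1 x) //= /u' eqxx ux.
  rewrite (inj_eq Some_inj) add0n addnC [i0 == i]eq_sym; congr addn.
  by apply: eq_bigr => y /negbTE ->.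
have [||p bp pu] := IH u'.
- apply/eqP; rewrite -eqSS -Ek; apply/eqP.
  rewrite [in RHS](bigD1 x) //= (bigD1 x) //= /u' eqxx ux /= add0n add1n; congr _.+1.
  by apply: eq_bigr => y /negbTE ->.
- move=> i j; rewrite !su'; case: (eqVneq i i0) => [->|ne].
    by right; apply: leq_add => //; apply: leq_trans (min0 j) (leq_addr _ _).
  rewrite addn0; case: (Inv i j) => H; [by left | right].
  by apply: leq_trans H _; rewrite leq_add2r leq_addr.
exists p => // y i uy; apply: pu; rewrite /u'; case: eqP => // yx.
by rewrite yx ux in uy.
Qed.

(** Trim each class to at most [#|V| %/ r] vertices, then extend. *)
Lemma balanced_near u : (0 < r)%N -> exists2 p, balanced p &
  (\sum_x (u x != Some (p x)) <=
     \sum_x (u x == None) + \sum_i (part_size u i - #|V| %/ r))%N.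
Proof.
move=> r0; set f := (#|V| %/ r)%N.
pose keep i := take f (enum [pred x | u x == Some i]).
pose u' x := if u x is Some i then (if x \in keep i then Some i else None) else None.
have sk i : (part_size u' i = minn f (part_size u i))%N.
  have -> : part_size u' i = #|keep i|.
    rewrite -sum1_card [RHS]big_mkcond; apply: eq_bigr => x _; rewrite /u'.
    case: (boolP (x \in keep i)) => xk.
      have := mem_take xk; rewrite mem_enum inE => /eqP ->.
      by rewrite xk eqxx.
    case: (u x) => [j|] //; case: ifP => // xj.
    by case: eqP => // -[ji]; rewrite ji (negbTE xk) in xj.
  rewrite (card_uniqP _) ?take_uniq ?enum_uniq // size_take_min -cardE; congr minn.
  by rewrite -sum1_card [LHS]big_mkcond; apply: eq_bigr => x _; rewrite inE; case: (_ == _).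
have [|p bp pu] := @balanced_extension u' r0.
  by move=> i j; left; rewrite sk geq_minl.
exists p => //.
have H1 : (\sum_x (u x != Some (p x)) <= \sum_x (u' x == None))%N.
  apply: leq_sum => x _; case E: (u' x) => [i|]; last by case: (_ != _).
  rewrite (pu _ _ E); move: E; rewrite /u'; case: (u x) => [j|] //; case: ifP => // _ [->].
  by rewrite eqxx.
apply: leq_trans H1 _.
have S1 := sum_part_size u; have S2 := sum_part_size u'.
have S3 : (\sum_i part_size u i = \sum_i part_size u' i + \sum_i (part_size u i - f))%N.
  by rewrite -big_split; apply: eq_bigr => i _ /=; rewrite sk minnE; lia.
lia.
Qed.

End Balance.

(** A function with few heavy tuples is almost below the Turan multigraph of a
    balanced partition, or its logarithmic sum is smaller than that of Turan
    multigraphs by a quadratic amount. *)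
Lemma stability_turan (R : realType) (s r t q b : nat) :
  s = (r + t)%N -> (1 <= t)%N -> (t <= r)%N -> (q + t = b.+1 * 'C(s, 2))%N ->
  forall delta : R, 0 < delta -> exists beta eta : R, exists n0 : nat,
  [/\ 0 < beta, 0 < eta & forall (V : finType) (C : V -> V -> nat),
     (forall x y, C x y = C y x) -> (forall x y, C x y <= q)%N -> (n0 <= #|V|)%N ->
     heavy_count R s q C <= eta * #|{ffun 'I_s -> V}|%:R ->
     (exists2 p : V -> 'I_r, balanced p &
       sum2 (fun x y => ((b.+1 < C x y) || ((p x == p y) && (b < C x y)))%N%:R)
         <= delta * #|V|%:R ^+ 2) \/
     sum2 (fun x y => lnS R (C x y)) <=
       (lnS R b.+1 - (lnS R b.+1 - lnS R b) / r%:R - beta) * #|V|%:R ^+ 2].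
Proof.
move=> sE t1 tr qE delta d0.
have r0 : (0 < r)%N by exact: leq_trans t1 tr.
have r0' : 0 < r%:R :> R by rewrite ltr0n.
pose d : R := delta / (8 * (r%:R + 1)).
have rp : 0 < r%:R + 1 :> R by rewrite addr_gt0.
have dd : d * (8 * (r%:R + 1)) = delta by rewrite /d divfK // gt_eqF // mulr_gt0.
have dgt0 : 0 < d by rewrite divr_gt0 // mulr_gt0.
have dr : 0 < d * r%:R by rewrite mulr_gt0.
have [beta' [eta1 [n1 [b0 e10 Hnear]]]] := near_turan sE t1 tr qE dgt0.
have [kap k0 Hk] := lnS_gap_secant R b q.
pose al := lnS R b.+1 - lnS R b.
have al0 : 0 < al by rewrite subr_gt0 /lnS ltr_ln ?posrE ?ltr0n // ltr_nat.
pose bt : R := Num.min beta' d.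
have bt0 : 0 < bt by rewrite lt_min b0.
have btb : bt <= beta' by rewrite ge_min lexx.
have btd : bt <= d by rewrite ge_min lexx orbT.
pose eps := kap * bt / (2 * al).
have eps0 : 0 < eps by rewrite divr_gt0 // mulr_gt0.
have epsE : al * eps = kap * bt / 2 by rewrite /eps; field; rewrite gt_eqF.
have [eta2 e20 [n2 Hsum]] := turan_sum_upper sE t1 tr qE eps0.
pose beta := Num.min (kap * bt / 2) (al * bt).
have beta0 : 0 < beta by rewrite lt_min divr_gt0 ?mulr_gt0.
have beta1 : beta <= kap * bt / 2 by rewrite ge_min lexx.
have beta2 : beta <= al * bt by rewrite ge_min lexx orbT.
pose n3 := (Num.truncn (8 * r%:R / delta)).+1.
exists beta, (Num.min eta1 eta2), (maxn n1 (maxn n2 n3)); split=> //; first by rewrite lt_min e10.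
move=> V C Cs Cq; rewrite !geq_max => /and3P[nV1 nV2 nV3] Hbad.
have nx0 : 0 <= #|{ffun 'I_s -> V}|%:R :> R by rewrite ler0n.
have Hb1 : heavy_count R s q C <= eta1 * #|{ffun 'I_s -> V}|%:R.
  by apply: le_trans Hbad _; rewrite ler_wpM2r // ge_min lexx.
have Hb2 : heavy_count R s q C <= eta2 * #|{ffun 'I_s -> V}|%:R.
  by apply: le_trans Hbad _; rewrite ler_wpM2r // ge_min lexx orbT.
set n : R := #|V|%:R.
have V0 : (0 < #|V|)%N by rewrite (leq_trans _ nV3).
have n0 : 0 < n by rewrite ltr0n.
have n20 : 0 < n ^+ 2 by rewrite exprn_gt0.
have rn : 8 * r%:R <= delta * n.
  by rewrite mulrC -[_ * n]mulrC -ler_pdivrMr // mulrC ltW // (lt_le_trans (truncnS_gt _)) // ler_nat.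
have [?|far] := leP (sum2 (fun x y => lnS R (C x y)))
  ((lnS R b.+1 - al / r%:R - beta) * n ^+ 2); [by right|left].
set W := sum2 (fun x y => (atypical b C x y)%:R : R).
set D := sum2 (fun x y => (C x y)%:R : R).
have HD : D <= (b.+1%:R - r%:R^-1 + eps) * n ^+ 2.
  have := Hsum V C Cs Cq nV2 Hb2 [set: V]%SET; rewrite deg_total_setT cardsT -mulrDl.
  by rewrite (eq_sum2 (g := fun x y => (C x y)%:R)) // => x y; rewrite Cs.
have Hln : sum2 (fun x y => lnS R (C x y)) <= (lnS R b.+1 - al * b.+1%:R) * n ^+ 2 + (al * D - kap * W).
  apply: (@le_trans _ _ (sum2 (fun x y => (lnS R b.+1 - al * b.+1%:R) +
     (al * (C x y)%:R + - kap * (atypical b C x y)%:R)))).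
    by apply: sum2_le => x y; have := Hk _ (Cq x y); rewrite -/al -/(atypical b C x y); lra.
  by rewrite sum2D sum2_const sum2D !sum2Z -/D -/W mulNr.
have W0 : 0 <= W by apply: sum2_ge0 => x y; exact: ler0n.
have H1 := lt_le_trans far Hln.
have H2 := ler_wpM2l (ltW al0) HD.
have E2 : al * ((b.+1%:R - r%:R^-1 + eps) * n ^+ 2) =
   al * b.+1%:R * n ^+ 2 - al / r%:R * n ^+ 2 + kap * bt / 2 * n ^+ 2 by rewrite -epsE; ring.
rewrite E2 in H2.
have B1 := ler_wpM2r (ltW n20) beta1; have B2 := ler_wpM2r (ltW n20) beta2.
have HW : W <= bt * n ^+ 2.
  rewrite -(ler_pM2l k0) mulrA.
  move: H1 H2 B1; rewrite !mulrBl; lra.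
have HD' : (b.+1%:R - r%:R^-1 - bt) * n ^+ 2 <= D.
  rewrite -(ler_pM2l al0).
  have E3 : al * ((b.+1%:R - r%:R^-1 - bt) * n ^+ 2) =
    al * b.+1%:R * n ^+ 2 - al / r%:R * n ^+ 2 - al * bt * n ^+ 2 by ring.
  have kW : 0 <= kap * W by rewrite mulr_ge0 // ltW.
  rewrite E3; move: H1 B2; rewrite !mulrBl; lra.
have [||u [uN uS uI]] := Hnear V C Cs Cq nV1 Hb1.
- by apply: le_trans HD'; rewrite ler_wpM2r ?(ltW n20) // lerD2l lerN2.
- by apply: le_trans HW _; rewrite ler_wpM2r ?(ltW n20).
have [p bp mis] := balanced_near u r0.
exists p => //.
pose ms x : R := (u x != Some (p x))%:R.
have Hms : \sum_x ms x <= d * n + r%:R * (d * n + 1).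
  rewrite /ms -natr_sum; apply: (@le_trans _ _ (\sum_x (u x == None) + \sum_i (part_size u i - #|V| %/ r))%N%:R).
    by rewrite ler_nat.
  rewrite natrD natr_sum; apply: lerD => //.
  have -> : r%:R * (d * n + 1) = \sum_(i < r) (d * n + 1) by rewrite sumr_const card_ord mulr_natl.
  rewrite natr_sum; apply: ler_sum => i _.
  have fn : r%:R^-1 * n <= (#|V| %/ r)%:R + 1.
    rewrite mulrC ler_pdivrMr // natr1 -natrM ler_nat ltnW //; exact: ltn_ceil.
  have ps : (part_size u i)%:R <= (r%:R^-1 + d) * n by rewrite natr_sum; exact: uS.
  have dn0 : 0 < d * n by rewrite mulr_gt0.
  case: (leqP (part_size u i) (#|V| %/ r)) => h; first by rewrite (eqP (h : _ - _ == 0)%N); lra.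
  rewrite natrB ?(ltnW h) //; move: ps; rewrite mulrDl; lra.
apply: (@le_trans _ _ (sum2 (fun x y => (atypical b C x y)%:R + (ms x + (ms y +
   [&& u x == u y, u x != None & b < C x y]%N%:R))))).
  apply: sum2_le => x y; rewrite /ms.
  have p0 (c : bool) : 0 <= c%:R :> R by exact: ler0n.
  case: (ltnP b.+1 (C x y)) => [h|h] /=.
    have -> : atypical b C x y = true by rewrite /atypical !neq_ltn h (ltn_trans (ltnSn _) h) !orbT.
    by rewrite lerDl !addr_ge0.
  case: (boolP ((p x == p y) && _)) => [/andP[/eqP pxy ->]|_]; last by rewrite !addr_ge0.
  case: (eqVneq (u x) (Some (p x))) => [->|_]; last by rewrite addrCA lerDl !addr_ge0.
  case: (eqVneq (u y) (Some (p y))) => [->|_] /=; last by rewrite add0r addrCA lerDl !addr_ge0.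
  by rewrite pxy eqxx /= !add0r lerDr.
rewrite sum2D sum2D sum2D -/W.
have M1 : sum2 (fun x _ : V => ms x) = n * \sum_x ms x.
  by rewrite /sum2 mulr_sumr; apply: eq_bigr => x _; rewrite sumr_const mulr_natl.
have M2 : sum2 (fun _ y : V => ms y) = n * \sum_x ms x.
  by rewrite /sum2 sumr_const mulr_natl.
rewrite M1 M2.
have H3 := ler_wpM2l (ltW n0) Hms.
have H4 : bt * n ^+ 2 <= d * n ^+ 2 by rewrite ler_wpM2r // ltW.
have H5 := ler_wpM2r (ltW n0) rn.
have E6 : n * (d * n + r%:R * (d * n + 1)) = d * (r%:R + 1) * n ^+ 2 + r%:R * n by ring.
have E7 : delta * n * n = delta * n ^+ 2 by ring.
have E8 : d * (r%:R + 1) = delta / 8 by rewrite -dd; field.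
have E9 : d * n ^+ 2 <= d * (r%:R + 1) * n ^+ 2.
  by rewrite ler_wpM2r ?(ltW n20) // ler_peMr ?(ltW dgt0) // lerDr ltW.
rewrite E7 in H5; rewrite E6 in H3; rewrite E8 in H3 E9.
move: H3 H4 H5 E9 HW uI; rewrite -/n; move: (n ^+ 2) (d * _) (bt * _) (sum2 _) (\sum_x ms x) => *; lra.
Qed.

(** * Multigraphs as symmetric functions on pairs of vertices *)

Section Edges.
Variable V : finType.
Implicit Types (e : edge V) (x y : V) (C : V -> V -> nat) (G : multigraph V).

Lemma edge_ends e : exists x y, x != y /\ val e = [set x; y]%SET.
Proof. by have /finset.cards2P[x [y [xy E]]] := valP e; exists x, y. Qed.

Lemma edge_of x y : x != y -> exists e, val e = [set x; y]%SET.
Proof.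
move=> xy; have c2 : #|[set x; y]%SET| == 2%N by rewrite cards2 xy.
by exists (Sub [set x; y]%SET c2); rewrite SubK.
Qed.

Lemma edge_neq e x y : val e = [set x; y]%SET -> x != y.
Proof. by move=> E; have := valP e; rewrite E cards2; case: (x != y). Qed.

Lemma set2_inj x y x' y' : x != y -> ([set x; y] == [set x'; y'])%SET =
  ((x' == x) && (y' == y)) || ((x' == y) && (y' == x)).
Proof.
move=> xy; apply/eqP/idP => [E|]; last first.
  by case/orP => /andP[/eqP-> /eqP->] //; rewrite finset.setUC.
have x1 : x' \in [set x; y]%SET by rewrite E finset.set21.
have y1 : y' \in [set x; y]%SET by rewrite E finset.set22.
have x2 : x \in [set x'; y']%SET by rewrite -E finset.set21.
have y2 : y \in [set x'; y']%SET by rewrite -E finset.set22.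
move: x1 y1 x2 y2; rewrite !inE.
case: (eqVneq x' x) => [->|_] /=; case: (eqVneq y' y) => [->|_] //=; rewrite ?orbF ?eqxx //.
- by move=> _ /eqP ->; rewrite [y == x]eq_sym (negbTE xy).
- by move=> /eqP ->; rewrite (negbTE xy).
by move=> -> ->.
Qed.

(** The multigraph of a symmetric function of two vertices; the maximum is over
    the two orders of the endpoints. *)
Definition graph_of C : multigraph V :=
  [ffun e => \max_(z : V * V | val e == [set z.1; z.2]%SET) C z.1 z.2].

Lemma graph_ofE C e x y : (forall x y, C x y = C y x) ->
  val e = [set x; y]%SET -> graph_of C e = C x y.
Proof.
move=> Cs E; rewrite ffunE; have xy := edge_neq E.
rewrite (eq_bigl (fun z : V * V => (z == (x, y)) || (z == (y, x)))); last first.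
  by move=> [x' y']; rewrite E set2_inj.
apply/eqP; rewrite eqn_leq; apply/andP; split.
  by apply/bigmax_leqP => z /orP[/eqP->|/eqP->] //=; rewrite Cs.
have := @leq_bigmax_cond _ (fun z : V * V => (z == (x, y)) || (z == (y, x)))
         (fun z => C z.1 z.2) (x, y).
by rewrite eqxx; apply.
Qed.

(** The multiplicity of a pair of vertices, with value 0 on the diagonal. *)
Definition mult G x y : nat := \max_(e | val e == [set x; y]%SET) G e.

Lemma multE G e x y : val e = [set x; y]%SET -> mult G x y = G e.
Proof.
move=> E; rewrite /mult (eq_bigl (pred1 e)) ?big_pred1_eq // => e'.
by rewrite -E (inj_eq val_inj).
Qed.

Lemma mult_sym G x y : mult G x y = mult G y x.
Proof. by rewrite /mult finset.setUC. Qed.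

Lemma mult_le G q x y : (forall e, G e <= q)%N -> (mult G x y <= q)%N.
Proof. by move=> H; apply/bigmax_leqP. Qed.

Section EdgeSum.
Variable R : realType.

(** Each edge corresponds to two ordered pairs of distinct vertices. *)
Lemma edge_sum (f : edge V -> R) (phi : V -> V -> R) :
  (forall e x y, val e = [set x; y]%SET -> phi x y = f e) ->
  2 * \sum_e f e = sum2 (fun x y => (x != y)%:R * phi x y).
Proof.
move=> H.
transitivity (sum2 (fun x y => \sum_e (val e == [set x; y]%SET)%:R * f e)).
  rewrite /sum2; under [RHS]eq_bigr do rewrite exchange_big.
  rewrite exchange_big mulr_sumr; apply: eq_bigr => e _ /=.
  under eq_bigr do rewrite -mulr_suml.
  rewrite -mulr_suml; congr (_ * _).
  have [a [b [ab Eab]]] := edge_ends e.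
  rewrite (bigD1 a) //= (bigD1 b) //= [X in _ = _ + X](bigD1 b) 1?eq_sym //=.
  rewrite [X in _ + (X + _)](bigD1 a) //= Eab !set2_inj // !eqxx /= orbT.
  rewrite big1; last first.
    by move=> y /negbTE yb; rewrite set2_inj // yb (negbTE ab) andbF.
  rewrite big1; last first.
    by move=> y /negbTE yb; rewrite set2_inj // yb [b == a]eq_sym (negbTE ab) /= andbF.
  rewrite big1 ?addr0 //; last first.
  move=> x /andP[/negbTE xa /negbTE xb]; rewrite big1 // => y _.
  by rewrite set2_inj // xa xb.
apply: eq_sum2 => x y; case: (eqVneq x y) => [->|xy] /=.
  rewrite mul0r big1 // => e _; case: eqP => [E|_]; last by rewrite mul0r.
  by have := edge_neq E; rewrite eqxx.
have [e E] := edge_of xy; rewrite (bigD1 e) //= E eqxx !mul1r (H e) //.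
rewrite big1 ?addr0 // => e' ne; case: eqP => [E'|_]; last by rewrite mul0r.
by move: ne; rewrite -(inj_eq val_inj) /= E E' eqxx.
Qed.

Lemma weight_sum2 G (X : {set V}) :
  2 * (weight G X)%:R = \sum_(x in X) \sum_(y in X) (x != y)%:R * (mult G x y)%:R :> R.
Proof.
rewrite /weight big_mkcond natr_sum (edge_sum (phi := fun x y =>
   (x \in X)%:R * ((y \in X)%:R * (mult G x y)%:R))); last first.
  move=> e x y E; rewrite E finset.subUset !finset.sub1set (multE G E).
  by case: (x \in X); case: (y \in X); rewrite ?mul1r ?mul0r.
rewrite /sum2 [RHS]big_mkcond; apply: eq_bigr => x _; case: ifP => xX; last first.
  by rewrite big1 // => y _; rewrite mul0r mulr0.
rewrite [RHS]big_mkcond; apply: eq_bigr => y _; case: ifP => yX.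
  by rewrite !mul1r.
by rewrite mul0r mulr0 mulr0.
Qed.

(** For an injective tuple the weight is that of the set of its entries. *)
Lemma tuple_weight_mult G s (x : {ffun 'I_s -> V}) : injective x ->
  tuple_weight (mult G) x = weight G [set x i | i : 'I_s]%SET.
Proof.
move=> ix; apply/eqP; rewrite -(eqr_nat R); apply/eqP.
apply: (@mulfI R 2); first by rewrite pnatr_eq0.
rewrite weight_sum2 big_imset /=; last by move=> ? ? _ _; exact: ix.
rewrite (eq_bigr (fun i => \sum_(j in 'I_s) (x i != x j)%:R * (mult G (x i) (x j))%:R)); last first.
  by move=> i _; rewrite big_imset // => ? ? _ _; exact: ix.
rewrite /tuple_weight natr_sum mulr2n mulrDl mul1r.
under eq_bigr do rewrite natr_sum.
rewrite {1}(exchange_big_dep xpredT) //= -big_split /=.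
apply: eq_big => [i|i _]; first by rewrite inE.
rewrite [RHS](bigID (fun j : 'I_s => (i < j)%N)) /=; congr (_ + _).
  apply: eq_big => [j|j ij] //.
  by rewrite (inj_eq ix) neq_ltn ij mul1r mult_sym.
rewrite [RHS](bigD1 i) ?ltnn //= eqxx mul0r add0r.
apply: eq_big => [j|j ij]; first by rewrite /= -leqNgt ltn_neqAle andbC.
by rewrite (inj_eq ix) neq_ltn ij orbT mul1r.
Qed.

End EdgeSum.
End Edges.

Section Weights.
Variable V : finType.
Implicit Types (G : multigraph V) (X : {set V}).

Lemma subset_card_between (A : {set V}) s : (#|A| <= s)%N -> (s <= #|V|)%N ->
  exists X : {set V}, A \subset X /\ #|X| = s.
Proof.
move=> As sV; pose B : {set V} := [set x in take (s - #|A|) (enum (~: A))]%SET.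
have cB : #|B| = (s - #|A|)%N.
  rewrite cardsE (card_uniqP _) ?take_uniq ?enum_uniq // size_take_min -cardE.
  by apply/minn_idPl; have := finset.cardsC A; lia.
exists (A :|: B)%SET; split; first exact: finset.subsetUl.
rewrite finset.cardsU cB (_ : A :&: B = finset.set0)%SET ?finset.cards0 ?subn0 ?subnKC //.
apply/finset.setP => x; rewrite !inE; case: (boolP (x \in A)) => //= xA.
by apply/negbTE; apply: contraL xA => /mem_take; rewrite mem_enum inE.
Qed.

Lemma le_of_weights G s q : (2 <= s)%N -> (s <= #|V|)%N ->
  (forall X, #|X| = s -> weight G X <= q)%N -> forall e, (G e <= q)%N.
Proof.
move=> s2 sV H e.
have [|X [eX cX]] := @subset_card_between (val e) s _ sV; first by rewrite (eqP (valP e)).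
by apply: leq_trans (H X cX); rewrite /weight (bigD1 e) //= leq_addr.
Qed.

Lemma weight_submultigraph G G' X : submultigraph G G' -> (weight G X <= weight G' X)%N.
Proof. by move=> H; apply: leq_sum => e _; exact: H. Qed.

Lemma sum_neq_in (R : realType) X :
  \sum_(x in X) \sum_(y in X) (x != y)%:R = #|X|%:R ^+ 2 - #|X|%:R :> R.
Proof.
transitivity (\sum_(x in X) (#|X|%:R - 1) : R); last first.
  by rewrite sumr_const -[LHS]mulr_natr mulrBl mul1r expr2.
apply: eq_bigr => x xX; rewrite (bigD1 x) //= eqxx add0r.
rewrite (eq_bigr (fun=> 1)); last by move=> y /andP[_]; rewrite eq_sym => ->.
have <- : \sum_(y in X) 1 = #|X|%:R :> R by rewrite sumr_const.
by rewrite [in RHS](bigD1 x) //= addrAC subrr add0r.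
Qed.

Lemma card_edges_in X : #|[set e : edge V | val e \subset X]%SET| = 'C(#|X|, 2).
Proof.
rewrite -cards_draws -(card_imset _ (@val_inj _ _ (edge V))); apply: eq_card => A.
rewrite inE; apply/imsetP/andP => [[e + ->]|[AX A2]].
  by rewrite inE => eX; split=> //; exact: (valP e).
by exists (Sub A A2); rewrite ?inE SubK.
Qed.

Lemma weight_const a X : weight [ffun=> a] X = (a * 'C(#|X|, 2))%N.
Proof.
rewrite /weight (eq_bigr (fun=> a)); last by move=> e _; rewrite ffunE.
by rewrite sum_nat_cond_const card_edges_in mulnC.
Qed.

End Weights.

(** * Counting multigraphs through containers *)

Lemma sum_leq_ord (R : pzSemiRingType) (q m : nat) : (m <= q)%N ->
  \sum_(v < q.+1) (v <= m)%N%:R = m.+1%:R :> R.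
Proof.
move=> mq; rewrite -[RHS]mulr1 -(@sum_lt_const R q.+1 m.+1 1) // [RHS]big_mkcond.
by apply: eq_bigr => v _; rewrite ltnS; case: (_ <= _)%N.
Qed.

Lemma expR_lnS (R : realType) v : expR (lnS R v) = v.+1%:R.
Proof. by rewrite lnK // posrE ltr0n. Qed.

Section BoundedMultigraphs.
Variables (R : realType) (V : finType) (q : nat).
Notation bmg := {ffun edge V -> 'I_q.+1}.
Implicit Types (g : bmg) (D : multigraph V).

(** Multigraphs with multiplicities at most [q] form a finite type; this is
    its embedding into all multigraphs. *)
Definition unbound g : multigraph V := [ffun e => val (g e)].

Lemma unbound_inj : injective unbound.
Proof.
move=> g h /ffunP H; apply/ffunP => e; apply: val_inj.
by have := H e; rewrite !ffunE.
Qed.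

Lemma card_mgE (A : classical_sets.set (multigraph V)) :
  (forall G, A G -> forall e, (G e <= q)%N) ->
  card_mg A = #|[pred g : bmg | `[< A (unbound g) >]]|.
Proof.
move=> Aq; rewrite /card_mg.
pose B : {fset multigraph V} := [fset unbound g | g in [fset x in [pred g : bmg | `[< A (unbound g) >]]]]%fset.
have AB : A = [set` B]%classic.
  rewrite predeqE => G; split=> [AG|/=].
    pose g0 : bmg := [ffun e => inord (G e)].
    have g0E : unbound g0 = G by apply/ffunP => e; rewrite !ffunE /= inordK // ltnS Aq.
    apply/imfsetP; exists g0; last by rewrite g0E.
    have Ag : A (unbound g0) by rewrite g0E.
    rewrite inE /=; exact/asboolP.
  by case/imfsetP => g /=; rewrite inE /= => /asboolP Ag ->.
rewrite {1}AB set_fsetK card_imfset /=; last exact: unbound_inj.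
rewrite -(card_uniqP (fset_uniq _)); apply: eq_card => g.
by rewrite !inE.
Qed.

Lemma count_below D : (forall e, D e <= q)%N ->
  #|[pred g : bmg | [forall e, (g e <= D e)%N]]|%:R = expR (\sum_e lnS R (D e)).
Proof.
move=> Dq; rewrite -sum_bool_card expR_sum.
transitivity (\prod_e \sum_(v < q.+1) (v <= D e)%N%:R : R); last first.
  by apply: eq_bigr => e _; rewrite sum_leq_ord ?Dq // expR_lnS.
rewrite bigA_distr_bigA; apply: eq_bigr => g _ /=.
case: forallP => [H|H]; first by rewrite big1 // => e _; rewrite H.
have [e He] : exists e, ~~ (g e <= D e)%N.
  by apply/existsP; rewrite -negb_forall; apply/forallP.
by rewrite (bigD1 e) //= (negbTE He) mul0r.
Qed.

(** The number of [g] exceeding [D] on at most [K] edges: give weight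
    [expR (- zeta)] to each excess, so that the count is bounded by a sum of
    products, that is, by a product over the edges. *)
Lemma count_close D (zeta K : R) : (forall e, D e <= q)%N -> 0 < zeta ->
  #|[pred g : bmg | #|[pred e | (D e < g e)%N]|%:R <= K]|%:R <=
    expR (zeta * K + \sum_e lnS R (D e) + q%:R * expR (- zeta) * #|{: edge V}|%:R).
Proof.
move=> Dq z0; rewrite -sum_bool_card.
pose wt g := \prod_e expR (- zeta * (D e < g e)%N%:R).
apply: (@le_trans _ _ (\sum_g expR (zeta * K) * wt g)).
  apply: ler_sum => g _ /=; case: (boolP (_ <= K)) => [H|_]; last first.
    by rewrite mulr_ge0 ?expR_ge0 // prodr_ge0 // => e _; exact: expR_ge0.
  rewrite /wt -expR_sum -expRD -mulr_sumr sum_bool_card mulNr -mulrBr.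
  rewrite -[X in X <= _]expR0 ler_expR mulr_ge0 ?(ltW z0) // subr_ge0.
  exact: H.
rewrite -mulr_sumr -addrA expRD ler_pM2l ?expR_gt0 //.
rewrite /wt -(bigA_distr_bigA (fun e (v : 'I_q.+1) => expR (- zeta * (D e < v)%N%:R))).
have -> : q%:R * expR (- zeta) * #|{: edge V}|%:R = \sum_(e : edge V) q%:R * expR (- zeta).
  by rewrite sumr_const mulr_natr.
rewrite -big_split expR_sum; apply: ler_prod => e _; apply/andP; split.
  by apply: sumr_ge0 => v _; exact: expR_ge0.
rewrite expRD expR_lnS.
set z := expR (- zeta); have zp : 0 < z by exact: expR_gt0.
have H : \sum_(v < q.+1) expR (- zeta * (D e < v)%N%:R) <= (D e).+1%:R + q%:R * z.
  rewrite -(sum_leq_ord R (Dq e)).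
  have -> : q%:R * z = \sum_(v < q.+1) (if v == ord0 then 0 else z).
    rewrite (bigD1 ord0) //= add0r (eq_bigr (fun=> z)); last by move=> v /negbTE ->.
    by rewrite sumr_const cardC1 card_ord mulr_natl.
  rewrite -big_split; apply: ler_sum => v _ /=.
  case: leqP => h; first by rewrite mulr0 expR0 lerDl; case: ifP => // _; exact: ltW.
  rewrite mulr1 add0r; case: eqP => // v0; by rewrite v0 in h.
apply: le_trans H _; apply: (@le_trans _ _ ((D e).+1%:R * (1 + q%:R * z))).
  rewrite mulrDr mulr1 lerD2l ler_peMl ?ler1n // mulr_ge0 // ltW //.
by rewrite ler_pM2l ?ltr0n // expR_ge1Dx.
Qed.

End BoundedMultigraphs.

Lemma card_edges_le (R : realType) (V : finType) : #|{: edge V}|%:R <= #|V|%:R ^+ 2 :> R.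
Proof.
have H : 2 * \sum_(e : edge V) 1 <= #|V|%:R ^+ 2 :> R.
  rewrite (edge_sum (phi := fun _ _ => 1)) // -[leRHS]mul1r -sum2_const.
  by apply: sum2_le => x y; case: (_ != _); rewrite ?mulr1 ?mul0r.
rewrite sumr_card1 in H; apply: le_trans H.
by rewrite ler_peMl ?ler0n // ler1n.
Qed.

Section Enumeration.
Variables (R : realType) (s q : nat) (E : forall n, classical_sets.set (multigraph 'I_n)).
Arguments E : clear implicits.
Hypothesis s2 : (2 <= s)%N.
Hypothesis Edown : forall n G G', (s <= n)%N -> E n G' -> submultigraph G G' -> E n G.

Lemma F_le n (G : multigraph 'I_n) : (s <= n)%N -> F n s q G -> forall e, (G e <= q)%N.
Proof. by move=> sn FG; apply: (@le_of_weights _ G s q s2) => //; rewrite card_ord. Qed.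

Lemma F_card_gt0 n : (s <= n)%N -> (0 < card_mg (F n s q))%N.
Proof.
move=> sn; rewrite (@card_mgE _ q); last by move=> G; exact: F_le.
have F0 : F n s q (unbound [ffun=> ord0 : 'I_q.+1]).
  by move=> X _; rewrite /weight big1 // => e _; rewrite !ffunE.
by apply/card_gt0P; exists [ffun=> ord0]; rewrite inE; exact: F0.
Qed.

Lemma ln_F_ge n (D : multigraph 'I_n) : (s <= n)%N -> F n s q D ->
  \sum_e lnS R (D e) <= ln (card_mg (F n s q))%:R.
Proof.
move=> sn FD; rewrite -ler_expR lnK ?posrE ?ltr0n ?F_card_gt0 //.
rewrite -(@count_below R _ q); last exact: F_le.
rewrite (@card_mgE _ q); last by move=> G; exact: F_le.
rewrite ler_nat; apply/subset_leq_card/fintype.subsetP => g; rewrite !inE => /forallP H.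
have Fg : F n s q (unbound g); last exact: Fg.
move=> X cX; apply: leq_trans (FD X cX).
by apply: weight_submultigraph => e; have := H e; rewrite ffunE.
Qed.

(** A symmetric function with few heavy tuples is almost below a member of
    [E n], or its logarithmic sum over ordered pairs is smaller by a quadratic
    amount than twice the logarithm of the number of multigraphs. *)
Hypothesis stab : forall delta : R, 0 < delta -> exists beta eta : R, exists n0 : nat,
  [/\ 0 < beta, 0 < eta & forall n (C : 'I_n -> 'I_n -> nat),
     (forall x y, C x y = C y x) -> (forall x y, C x y <= q)%N -> (n0 <= n)%N ->
     heavy_count R s q C <= eta * #|{ffun 'I_s -> 'I_n}|%:R ->
     (exists2 G', E n G' &
       sum2 (fun x y => ((x != y) && (mult G' x y < C x y)%N)%:R) <= delta * n%:R ^+ 2) \/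
     sum2 (fun x y => lnS R (C x y)) <= 2 * ln (card_mg (F n s q))%:R - beta * n%:R ^+ 2].

(** The edge-wise minimum of [G] and [G'] is the member of [E n] close to [G]. *)
Lemma close_to_family n (G G' : multigraph 'I_n) (C : 'I_n -> 'I_n -> nat) (d1 d2 : R) :
  (s <= n)%N -> F n s q G -> E n G' ->
  sum2 (fun x y => (C x y < mult G x y)%N%:R) <= d1 * n%:R ^+ 2 ->
  sum2 (fun x y => ((x != y) && (mult G' x y < C x y)%N)%:R) <= d2 * n%:R ^+ 2 ->
  nearby s q (E n) (d1 + d2) G.
Proof.
move=> sn FG EG' H1 H2; split=> //.
pose G2 : multigraph 'I_n := [ffun e => minn (G e) (G' e)].
exists G2; first by apply: Edown EG' _ => // e; rewrite ffunE geq_minr.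
rewrite /delta_close card_ord cardsE -sum_bool_card.
set S := \sum_e _; suff : 2 * S <= (d1 + d2) * n%:R ^+ 2.
  by have S0 : 0 <= S by [rewrite sumr_ge0]; lra.
rewrite (edge_sum (phi := fun x y => (mult G' x y < mult G x y)%N%:R)); last first.
  move=> e x y Exy; rewrite !(multE _ Exy) ffunE /minn /=.
  case: (ltngtP (G e) (G' e)) => h; rewrite ?eqxx //; last by rewrite h eqxx.
  by rewrite gtn_eqF.
rewrite mulrDl; apply: le_trans (lerD H1 H2); rewrite -sum2D; apply: sum2_le => x y.
case: (eqVneq x y) => [_|xy] /=; first by rewrite mul0r addr_ge0.
rewrite mul1r; case: ltnP => h //; last by rewrite addr_ge0.
by case: (ltnP (C x y)) => h1; [rewrite lerDl | rewrite add0r (leq_trans h h1)].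
Qed.

(** Union bound over the containers whose logarithmic sum is small; the others
    only contain multigraphs close to [E n]. *)
Theorem enumeration (delta : R) : 0 < delta -> exists2 beta : R, 0 < beta &
  exists n0 : nat, forall n : nat, (n0 <= n)%N ->
   (card_mg (F n s q `\` nearby s q (E n) delta)%classic)%:R / (card_mg (F n s q))%:R
     <= 2 `^ (- (beta * 'C(n, 2)%:R)) :> R.
Proof.
move=> d0; have d20 : 0 < delta / 2 by rewrite divr_gt0.
have [beta [eta [n1 [b0 e0 Hstab]]]] := stab d20.
have q0 : 0 < q.+1%:R :> R by rewrite ltr0n.
pose z := Num.min (1 / 2) (beta / (16 * q.+1%:R)) : R.
have z0 : 0 < z by rewrite lt_min !divr_gt0 // mulr_gt0.
have z1 : z < 1 by rewrite gt_min; apply/orP; left; lra.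
have zq : q%:R * z <= beta / 16.
  apply: (@le_trans _ _ (q.+1%:R * z)); first by rewrite ler_wpM2r ?(ltW z0) // ler_nat.
  rewrite mulrC -ler_pdivlMr //; apply: le_trans (_ : beta / (16 * q.+1%:R) <= _).
    by rewrite ge_min lexx orbT.
  by rewrite invfM mulrA.
pose zeta := - ln z.
have zeta0 : 0 < zeta by rewrite oppr_gt0 ln_lt0 // z0.
have zE : expR (- zeta) = z by rewrite opprK lnK // posrE.
pose eps := Num.min (Num.min 1 (delta / 2)) (beta / (16 * zeta)).
have eps0 : 0 < eps by rewrite !lt_min ltr01 d20 divr_gt0 // mulr_gt0.
have eps1 : eps <= 1 by rewrite !ge_min lexx.
have eps2 : eps <= delta / 2 by rewrite !ge_min lexx orbT.
have epsz : zeta * eps <= beta / 16.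
  rewrite mulrC -ler_pdivlMr //; apply: le_trans (_ : beta / (16 * zeta) <= _).
    by rewrite ge_min lexx orbT.
  by rewrite invfM mulrA.
have eps01 : 0 < eps <= 1 by rewrite eps0.
have [T [n2 Hcont]] := @container_lemma R s q eps eta eps01 e0.
pose lT := lnS R #|T|; pose lq := lnS R q * #|{: T * T}|%:R.
have lT0 : 0 <= lT by exact: lnS_ge0.
have lq0 : 0 <= lq by rewrite mulr_ge0 ?lnS_ge0.
pose n3 := (Num.truncn (32 * (lT + lq) / beta)).+1.
exists (beta / 4); first by rewrite divr_gt0.
exists (maxn (maxn s n1) (maxn n2 n3)) => n; rewrite !geq_max => /andP[/andP[sn nn1] /andP[nn2 nn3]].
have n_gt0 : (0 < n)%N by rewrite (leq_trans _ sn) // ltnW.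
have n1R : 1 <= n%:R :> R by rewrite ler1n.
set n2R : R := n%:R ^+ 2.
have n20 : 0 < n2R by rewrite exprn_gt0 // ltr0n.
have nn : n%:R <= n2R by rewrite /n2R expr2 ler_peMl ?ler0n.
have lTn : (lT + lq) * 32 <= beta * n%:R.
  rewrite mulrC [beta * _]mulrC -ler_pdivrMr //.
  by rewrite ltW // (lt_le_trans (truncnS_gt _)) // ler_nat.
set Fn : R := (card_mg (F n s q))%:R.
have F0 : 0 < Fn by rewrite ltr0n F_card_gt0.
pose lF := ln Fn.
have FE : Fn = expR lF by rewrite lnK // posrE.
pose CC (pc : {ffun 'I_n -> T} * {ffun T * T -> 'I_q.+1}) (x y : 'I_n) : nat := pc.2 (pc.1 x, pc.1 y).
(* The containers that can hold a multigraph far from the family. *)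
pose good pc : bool := [forall x, forall y, CC pc x y == CC pc y x] &&
   (sum2 (fun x y => lnS R (CC pc x y)) <= 2 * lF - beta * n2R).
pose K : R := eps * n2R.
pose M : R := zeta * K + (lF - beta / 2 * n2R) + q%:R * expR (- zeta) * n2R.
have count pc : good pc ->
  #|[pred g : {ffun edge 'I_n -> 'I_q.+1} | #|[pred e | (graph_of (CC pc) e < g e)%N]|%:R <= K]|%:R <= expR M.
  move=> /andP[/forallP Csym Hln].
  have Cs x y : CC pc x y = CC pc y x by apply/eqP; have /forallP := Csym x; apply.
  have Dq e : (graph_of (CC pc) e <= q)%N.
    by have [x [y [_ Ee]]] := edge_ends e; rewrite (graph_ofE Cs Ee) -ltnS ltn_ord.
  apply: le_trans (count_close K Dq zeta0) _; rewrite ler_expR /M.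
  have H1 : q%:R * expR (- zeta) * #|{: edge 'I_n}|%:R <= q%:R * expR (- zeta) * n2R.
    rewrite ler_wpM2l ?mulr_ge0 ?expR_ge0 // /n2R.
    by have := card_edges_le R 'I_n; rewrite card_ord.
  have H2 : 2 * \sum_e lnS R (graph_of (CC pc) e) <= 2 * lF - beta * n2R.
    rewrite (edge_sum (phi := fun x y => lnS R (CC pc x y))); last first.
      by move=> e x y Ee; rewrite (graph_ofE Cs Ee).
    apply: le_trans Hln; apply: sum2_le => x y.
    by case: (_ != _); rewrite ?mul1r ?mul0r // lnS_ge0.
  by move: H1 H2; move: (\sum_e _) (_ * #|{: edge 'I_n}|%:R) => u v; lra.
have cover (g : {ffun edge 'I_n -> 'I_q.+1}) :
  (F n s q `\` nearby s q (E n) delta)%classic (unbound g) ->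
  exists2 pc, good pc & #|[pred e | (graph_of (CC pc) e < g e)%N]|%:R <= K.
  move=> [FG nG]; set G := unbound g in FG nG.
  have [||||p [c [csym cq Hout Hbad]]] := @Hcont 'I_n (mult G).
  - by rewrite card_ord.
  - exact: mult_sym.
  - by move=> x y; apply: mult_le; exact: F_le.
  - move=> x ix; rewrite (tuple_weight_mult R _ ix); apply: FG.
    by rewrite card_imset // card_ord.
  rewrite card_ord in Hout.
  pose C x y := c (p x) (p y).
  have Cs x y : C x y = C y x by exact: csym.
  pose pc : {ffun 'I_n -> T} * {ffun T * T -> 'I_q.+1} :=
    ([ffun x => p x], [ffun tt => inord (c tt.1 tt.2)]).
  have CE x y : CC pc x y = C x y by rewrite /CC /= !ffunE /= inordK // ltnS cq.
  exists pc.
    apply/andP; split.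
      by apply/forallP => x; apply/forallP => y; rewrite !CE Cs.
    rewrite (eq_sum2 (g := fun x y => lnS R (C x y))); last by move=> x y; rewrite CE.
    case: (Hstab n C Cs (fun x y => cq _ _) nn1 Hbad) => [[G' EG' H']|//].
    case: nG; have -> : delta = delta / 2 + delta / 2 by lra.
    apply: (close_to_family sn FG EG' _ H').
    by apply: le_trans Hout _; rewrite ler_wpM2r // ltW.
  rewrite -sum_bool_card; set S := \sum_e _.
  suff : 2 * S <= K by have S0 : 0 <= S by [rewrite sumr_ge0]; lra.
  rewrite /S (edge_sum (phi := fun x y => (C x y < mult G x y)%N%:R)).
    apply: le_trans Hout; apply: sum2_le => x y.
    by case: (_ != _); rewrite ?mul1r ?mul0r.
  move=> e x y Ee; rewrite (multE _ Ee) /= ffunE (@graph_ofE _ (CC pc) e x y) ?CE //.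
  by move=> x' y'; rewrite !CE Cs.
pose NP : R := #|{: {ffun 'I_n -> T} * {ffun T * T -> 'I_q.+1}}|%:R.
have bound : (card_mg (F n s q `\` nearby s q (E n) delta)%classic)%:R <= NP * expR M.
  rewrite (@card_mgE _ q); last by move=> G [FG _]; exact: F_le.
  rewrite -sum_bool_card.
  apply: (@le_trans _ _ (\sum_(pc | good pc) #|[pred g : {ffun edge 'I_n -> 'I_q.+1} |
       #|[pred e | (graph_of (CC pc) e < g e)%N]|%:R <= K]|%:R)).
    under [leRHS]eq_bigr do rewrite -sum_bool_card.
    rewrite exchange_big; apply: ler_sum => g _ /=.
    case: asboolP => [Ag|_]; last by rewrite sumr_ge0.
    have [pc gpc Hpc] := cover g Ag.
    by rewrite (bigD1 pc) //= Hpc lerDl sumr_ge0.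
  apply: (@le_trans _ _ (\sum_(pc | good pc) expR M)); first exact: ler_sum.
  rewrite big_mkcond /NP -sumr_card1 mulr_suml; apply: ler_sum => pc _.
  by rewrite mul1r; case: (good pc); rewrite ?expR_ge0.
have NPle : NP <= expR (beta / 16 * n2R).
  rewrite /NP card_prod !card_ffun card_ord card_ord natrM !natrX.
  apply: (@le_trans _ _ (expR lT ^+ n * expR (lnS R q) ^+ #|{: T * T}|)).
    rewrite !expR_lnS ler_wpM2r ?exprn_ge0 ?ler0n //.
    by rewrite lerXn2r ?nnegrE ?ler0n // ler_nat.
  rewrite -!expRM_natl -expRD ler_expR -[X in _ + X]mulrC -/lq.
  have A1 : n%:R * lT + lq <= n%:R * (lT + lq) by rewrite mulrDr lerD2l ler_peMl.
  have A2 : n%:R * ((lT + lq) * 32) <= n%:R * (beta * n%:R) by rewrite ler_wpM2l.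
  have A3 : n%:R * (beta * n%:R) = beta * n2R by rewrite /n2R; ring.
  have A4 : 0 <= beta * n2R by rewrite mulr_ge0 // ltW.
  by lra.
have two : 2 `^ (- (beta / 4 * 'C(n, 2)%:R)) = expR (- (beta / 4 * 'C(n, 2)%:R) * ln 2) :> R.
  by rewrite /powR pnatr_eq0.
rewrite ler_pdivrMr // two FE -expRD.
apply: le_trans bound _; apply: le_trans (ler_wpM2r (expR_ge0 _) NPle) _.
rewrite -expRD ler_expR /M zE /K.
have C2 : 'C(n, 2)%:R * ln 2 <= n2R :> R.
  have : 'C(n, 2)%:R * ln 2 <= 'C(n, 2)%:R * 2 :> R.
    by rewrite ler_wpM2l ?ler0n // ltW // ln_sublinear.
  have : 'C(n, 2)%:R * 2 <= n2R.
    rewrite -natrM /n2R -natrX ler_nat muln2 bin2.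
    apply: (@leq_trans (n * n.-1)); last by rewrite -mulnn leq_mul2l leq_pred orbT.
    by rewrite -[leqRHS]odd_double_half leq_addl.
  lra.
have P1 : beta / 4 * ('C(n, 2)%:R * ln 2) <= beta / 4 * n2R.
  by rewrite ler_wpM2l // ltW // divr_gt0.
have P2 : zeta * (eps * n2R) <= beta / 16 * n2R by rewrite mulrA ler_wpM2r // ltW.
have P3 : q%:R * z * n2R <= beta / 16 * n2R by rewrite ler_wpM2r // ltW.
have P4 : 0 <= beta * n2R by rewrite mulr_ge0 // ltW.
have -> : - (beta / 4 * 'C(n, 2)%:R) * ln 2 = - (beta / 4 * ('C(n, 2)%:R * ln 2)) :> R by ring.
move: P1 P2 P3 P4.
move: (_ * (_ * ln 2)) (zeta * _) (q%:R * z * n2R) => u v w.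
lra.
Qed.

End Enumeration.

(** * Turan multigraphs and the two cases *)

Lemma bin2_natr (R : comPzRingType) (n : nat) : 2 * 'C(n, 2)%:R = n%:R ^+ 2 - n%:R :> R.
Proof.
case: n => [|n]; first by rewrite mulr0 expr0n subrr.
have E : ('C(n.+1, 2) * 2 = n.+1 * n)%N by rewrite bin2 /= muln2 halfK oddM /= andNb subn0.
rewrite mulrC -natrM E natrM -natr1; ring.
Qed.

Lemma sum2_neq (R : realType) (V : finType) :
  sum2 (fun x y : V => (x != y)%:R) = #|V|%:R ^+ 2 - #|V|%:R :> R.
Proof.
rewrite -cardsT -sum_neq_in; apply: eq_big => [x|x _]; first by rewrite inE.
by apply: eq_bigl => y; rewrite inE.
Qed.

Section TuranMultigraph.
Variables (V : finType) (r b : nat) (p : V -> 'I_r).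

(** The Turan multigraph of the partition into the fibres of [p]. *)
Definition turan_mg : multigraph V :=
  graph_of (fun x y => if p x == p y then b else b.+1).

Lemma turan_mgE e x y : val e = [set x; y]%SET ->
  turan_mg e = if p x == p y then b else b.+1.
Proof. by move=> E; rewrite /turan_mg (graph_ofE _ E) // => x' y'; rewrite eq_sym. Qed.

Variable R : realType.

Lemma sum_same_part (X : {set V}) :
  \sum_(x in X) \sum_(y in X) (p x == p y)%:R =
  \sum_i (\sum_(x in X) (p x == i)%:R) ^+ 2 :> R.
Proof.
under [RHS]eq_bigr do rewrite expr2 mulr_suml.
rewrite [RHS]exchange_big; apply: eq_bigr => x xX /=.
rewrite [RHS](bigD1 (p x)) //= eqxx mul1r [X in _ = _ + X]big1 ?addr0; last first.
  by move=> i ix; rewrite eq_sym (negbTE ix) mul0r.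
by apply: eq_bigr => y _; rewrite eq_sym.
Qed.

Lemma sum_part_in (X : {set V}) : \sum_i \sum_(x in X) (p x == i)%:R = #|X|%:R :> R.
Proof.
rewrite exchange_big -sum1_card natr_sum; apply: eq_bigr => x _ /=.
by rewrite (bigD1 (p x)) //= eqxx big1 ?addr0 // => i; rewrite eq_sym => /negbTE ->.
Qed.

(** A set of [r + t] vertices has at least [t] pairs inside the parts: a part
    of size [k] has [k * (k - 1) / 2 >= k - 1] pairs. *)
Lemma turan_weight_le (X : {set V}) t : #|X| = (r + t)%N ->
  (weight turan_mg X + t <= b.+1 * 'C(#|X|, 2))%N.
Proof.
move=> cX; rewrite -(ler_nat R) natrD natrM -(@ler_pM2l R 2) // mulrDr weight_sum2.
have -> : \sum_(x in X) \sum_(y in X) (x != y)%:R * (mult turan_mg x y)%:R =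
    b.+1%:R * (\sum_(x in X) \sum_(y in X) (x != y)%:R)
    - (\sum_(x in X) \sum_(y in X) (p x == p y)%:R - #|X|%:R) :> R.
  rewrite -sum1_card natr_sum -sumrB mulr_sumr -sumrB; apply: eq_bigr => x xX.
  rewrite mulr_sumr (bigD1 x) //= [X in _ = X - _](bigD1 x) //= [X in _ = _ - (X - _)](bigD1 x) //=.
  rewrite !eqxx mul0r mulr0 !add0r addrAC subrr add0r -sumrB; apply: eq_bigr => y /andP[_ yx].
  have xy : x != y by rewrite eq_sym.
  have [e E] := edge_of xy; rewrite xy mul1r mulr1.
  rewrite (multE _ E) (turan_mgE E); case: (_ == _); last by rewrite subr0.
  by rewrite -natr1 addrK.
rewrite sum_neq_in sum_same_part [2 * (_ * _)]mulrCA bin2_natr.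
suff : 2 * t%:R <= \sum_i (\sum_(x in X) (p x == i)%:R) ^+ 2 - #|X|%:R :> R by lra.
have H : \sum_(i < r) (3 * (\sum_(x in X) (p x == i)%:R) - 2) <=
   \sum_i (\sum_(x in X) (p x == i)%:R) ^+ 2 :> R.
  apply: ler_sum => i _; rewrite -natr_sum; set k := (\sum_(x in X) _)%N.
  case: k => [|[|k]]; rewrite ?expr0n ?expr1n /=; [lra | lra |].
  have : 0 <= k%:R ^+ 2 + k%:R :> R by rewrite addr_ge0 ?exprn_ge0.
  by rewrite -!natr1; lra.
apply: le_trans (lerB H (lexx _)).
rewrite big_split /= -mulr_sumr sum_part_in cX sumr_const card_ord natrD.
by rewrite -[(- 2) *+ r]mulr_natr; lra.
Qed.

Hypothesis r0 : (0 < r)%N.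
Hypothesis bal : balanced p.

Lemma part_le i : \sum_x (p x == i)%:R <= #|V|%:R / r%:R + 1 :> R.
Proof.
have r0' : 0 < r%:R :> R by rewrite ltr0n.
rewrite -(ler_pM2r r0') mulrDl divfK ?gt_eqF // mul1r.
have -> : #|V|%:R = \sum_j \sum_x (p x == j)%:R :> R.
  rewrite -cardsT -sum_part_in; apply: eq_bigr => j _; apply: eq_bigl => x; by rewrite inE.
have -> : r%:R = \sum_(j < r) 1 :> R by rewrite sumr_const card_ord.
rewrite mulr_sumr -big_split; apply: ler_sum => j _; rewrite mulr1 /=.
by rewrite -!natr_sum natr1 ler_nat -addn1; exact: bal.
Qed.

(** A balanced part has at most [#|V| / r + 1] vertices, so at most
    [#|V| ^+ 2 / r] ordered pairs of distinct vertices are inside the parts. *)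
Lemma turan_ln : 2 * \sum_e lnS R (turan_mg e) >=
  #|V|%:R ^+ 2 * lnS R b.+1 - #|V|%:R * lnS R b.+1
  - (lnS R b.+1 - lnS R b) / r%:R * #|V|%:R ^+ 2.
Proof.
set al := lnS R b.+1 - lnS R b.
have al0 : 0 <= al.
  by rewrite subr_ge0 /lnS ler_ln ?posrE ?ltr0n // ler_nat.
rewrite (edge_sum (phi := fun x y => lnS R b.+1 - al * (p x == p y)%:R)); last first.
  move=> e x y E; rewrite (turan_mgE E) /al; case: (_ == _); last by rewrite mulr0 subr0.
  by rewrite mulr1; lra.
have -> : sum2 (fun x y => (x != y)%:R * (lnS R b.+1 - al * (p x == p y)%:R)) =
   lnS R b.+1 * sum2 (fun x y : V => (x != y)%:R)
   - al * (sum2 (fun x y => (p x == p y)%:R) - #|V|%:R).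
  rewrite -[#|V|%:R]sumr_card1 /sum2 -sumrB !mulr_sumr -sumrB; apply: eq_bigr => x _.
  rewrite mulr_sumr (bigD1 x) //= [X in _ = X - _](bigD1 x) //= [X in _ = _ - _ * (X - _)](bigD1 x) //=.
  rewrite !eqxx mul0r mulr0 !add0r addrAC subrr add0r mulr_sumr -sumrB; apply: eq_bigr => y yx.
  by rewrite eq_sym yx mul1r mulr1.
rewrite sum2_neq.
have S : sum2 (fun x y => (p x == p y)%:R) - #|V|%:R <= #|V|%:R ^+ 2 / r%:R :> R.
  have -> : sum2 (fun x y => (p x == p y)%:R) = \sum_i (\sum_x (p x == i)%:R) ^+ 2 :> R.
    have := sum_same_part [set: V]%SET.
    rewrite (eq_bigr (fun x => \sum_y (p x == p y)%:R)); last first.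
      by move=> x _; apply: eq_bigl => y; rewrite inE.
    rewrite /sum2 (eq_bigl xpredT) => [->|x]; last by rewrite inE.
    by apply: eq_bigr => i _; congr (_ ^+ 2); apply: eq_bigl => x; rewrite inE.
  have H : \sum_i (\sum_x (p x == i)%:R) ^+ 2 <=
     \sum_i (\sum_x (p x == i)%:R) * (#|V|%:R / r%:R + 1) :> R.
    by apply: ler_sum => i _; rewrite expr2 ler_wpM2l ?part_le // sumr_ge0.
  have E : \sum_i (\sum_x (p x == i)%:R) = #|V|%:R :> R.
    rewrite -cardsT -sum_part_in; apply: eq_bigr => j _; apply: eq_bigl => x; by rewrite inE.
  rewrite lerBlDr; apply: le_trans H _; rewrite -mulr_suml E mulrDr mulr1 lerD2r.
  by rewrite expr2 mulrA.
have := ler_wpM2l al0 S; rewrite mulrA mulrAC.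
move: (al / _ * _) (sum2 _) => u v; lra.
Qed.

End TuranMultigraph.

Lemma turan_mg_bbT (n r b : nat) (p : 'I_n -> 'I_r) : (r <= n)%N -> balanced p ->
  bbT r b.+1 n (turan_mg b p).
Proof.
move=> rn bal.
pose part i : {set 'I_n} := [set x | p x == i]%SET.
have cpart i : #|part i| = (\sum_x (p x == i))%N.
  by rewrite -sum1_card big_mkcond; apply: eq_bigr => x _; rewrite inE; case: (p x == i).
have ne i : exists x, p x = i.
  apply: contrapT => H; have E0 : (\sum_x (p x == i) = 0)%N.
    by apply: big1 => x _; case: eqP => // px; case: H; exists x.
  have le1 j : (\sum_x (p x == j) <= 1)%N by have := bal j i; rewrite E0.
  have S : (\sum_j \sum_x (p x == j) = n)%N.
    rewrite exchange_big /= (eq_bigr (fun=> 1%N)) ?sum_nat_const ?card_ord ?muln1 // => x _.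
    by rewrite (bigD1 (p x)) //= eqxx big1 ?addn0 // => j; rewrite eq_sym => /negbTE ->.
  have : (\sum_j \sum_x (p x == j) < \sum_(j < r) 1)%N.
    rewrite (bigD1 i) // [X in (_ < X)%N](bigD1 i) //= E0 add0n add1n ltnS.
    by apply: leq_sum => j _.
  by rewrite S sum_nat_const card_ord muln1 ltnNge rn.
have part_inj : injective part.
  move=> i j E; have [x px] := ne i.
  have : x \in part j by rewrite -E inE px.
  by rewrite inE px => /eqP.
exists [set part i | i : 'I_r]%SET; split.
- split; last by rewrite card_imset // card_ord.
  apply/and3P; split.
  + rewrite finset.eqEsubset finset.subsetT /=; apply/fintype.subsetP => x _.
    by apply/finset.bigcupP; exists (part (p x)); [exact: imset_f | rewrite inE].
  + apply/finset.trivIsetP => A B /imsetP[i _ ->] /imsetP[j _ ->] ij.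
    rewrite -finset.setI_eq0; apply/eqP/finset.setP => x; rewrite !inE.
    by apply/negbTE; apply: contraNN ij => /andP[/eqP <- /eqP <-].
  + apply/negP => /imsetP[i _ E]; have [x px] := ne i.
    have : x \in part i by rewrite inE px.
    by rewrite -E inE.
- by move=> A B /imsetP[i _ ->] /imsetP[j _ ->]; rewrite !cpart; exact: bal.
- move=> A e /imsetP[i _ ->] eA; have [x [y [_ E]]] := edge_ends e.
  move: eA; rewrite E finset.subUset !finset.sub1set !inE => /andP[/eqP px /eqP py].
  by rewrite (turan_mgE b p E) px py eqxx.
move=> A B x y e /imsetP[i _ ->] /imsetP[j _ ->] ij; rewrite !inE => /eqP px /eqP py E.
rewrite (turan_mgE b p E) px py; case: eqP => // ij'.
by rewrite ij' eqxx in ij.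
Qed.

Lemma submultigraph_trans (V : finType) (G1 G2 G3 : multigraph V) :
  submultigraph G1 G2 -> submultigraph G2 G3 -> submultigraph G1 G3.
Proof. by move=> H1 H2 e; exact: leq_trans (H1 e) (H2 e). Qed.

Section Cases.
Variables (R : realType) (s q : nat) (E : forall n, classical_sets.set (multigraph 'I_n)).
Arguments E : clear implicits.
Hypothesis s2 : (2 <= s)%N.

(** Case (i) satisfies the stability hypothesis of [enumeration]. *)
Lemma below_dichotomy a b : q = (a * 'C(s, 2) + b)%N -> (b <= s - 2)%N ->
  (forall n, (s <= n)%N -> E n = U a n) ->
  forall delta : R, 0 < delta -> exists beta eta : R, exists n0 : nat,
  [/\ 0 < beta, 0 < eta & forall n (C : 'I_n -> 'I_n -> nat),
     (forall x y, C x y = C y x) -> (forall x y, C x y <= q)%N -> (n0 <= n)%N ->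
     heavy_count R s q C <= eta * #|{ffun 'I_s -> 'I_n}|%:R ->
     (exists2 G', E n G' &
       sum2 (fun x y => ((x != y) && (mult G' x y < C x y)%N)%:R) <= delta * n%:R ^+ 2) \/
     sum2 (fun x y => lnS R (C x y)) <= 2 * ln (card_mg (F n s q))%:R - beta * n%:R ^+ 2].
Proof.
move=> qE bs EU delta d0.
have [beta [eta [n0 [b0 e0 H]]]] := stability_below s2 qE bs d0.
pose n1 := (Num.truncn (2 * lnS R a / beta)).+1.
exists (beta / 2), eta, (maxn s (maxn n0 n1)); split=> //; first by rewrite divr_gt0.
move=> n C Cs Cq; rewrite !geq_max => /and3P[sn nn0 nn1] Hbad.
have := H 'I_n C Cs Cq; rewrite card_ord => /(_ nn0 Hbad) [near|far]; [left|right].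
  exists (bbU a n); first by rewrite EU // => e.
  apply: le_trans near; apply: sum2_le => x y.
  case: (eqVneq x y) => [_|xy]; first by rewrite ler0n.
  by have [e Ee] := edge_of xy; rewrite (multE _ Ee) ffunE.
have FU : F n s q (bbU a n) by move=> X cX; rewrite weight_const cX qE leq_addr.
have L := ln_F_ge R s2 sn FU.
have L2 : 2 * \sum_e lnS R (bbU a n e) = (n%:R ^+ 2 - n%:R) * lnS R a.
  rewrite (edge_sum (phi := fun _ _ => lnS R a)); last by move=> e x y _; rewrite ffunE.
  rewrite -[n in RHS]card_ord -sum2_neq mulrC -sum2Z; apply: eq_sum2 => x y; exact: mulrC.
have na : 2 * lnS R a <= beta * n%:R.
  by rewrite mulrC [beta * _]mulrC -ler_pdivrMr // mulrC ltW // (lt_le_trans (truncnS_gt _)) // ler_nat.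
have na2 := ler_wpM2r (ler0n R n) na.
rewrite -[beta * _ * _]mulrA -expr2 in na2.
apply: le_trans far _; move: L L2 na2.
move: (\sum_e _) (ln _) => u v; rewrite !mulrBl; lra.
Qed.

(** Case (ii) satisfies the stability hypothesis of [enumeration]. *)
Lemma turan_dichotomy a t : (1 <= a)%N -> (q + t = a * 'C(s, 2))%N -> (1 <= t)%N -> (2 * t <= s)%N ->
  (forall n, (s <= n)%N -> E n = T (s - t) a n) ->
  forall delta : R, 0 < delta -> exists beta eta : R, exists n0 : nat,
  [/\ 0 < beta, 0 < eta & forall n (C : 'I_n -> 'I_n -> nat),
     (forall x y, C x y = C y x) -> (forall x y, C x y <= q)%N -> (n0 <= n)%N ->
     heavy_count R s q C <= eta * #|{ffun 'I_s -> 'I_n}|%:R ->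
     (exists2 G', E n G' &
       sum2 (fun x y => ((x != y) && (mult G' x y < C x y)%N)%:R) <= delta * n%:R ^+ 2) \/
     sum2 (fun x y => lnS R (C x y)) <= 2 * ln (card_mg (F n s q))%:R - beta * n%:R ^+ 2].
Proof.
case: a => // b _ qE t1 ts ET delta d0.
set r := (s - t)%N in ET.
have sE : s = (r + t)%N by rewrite /r; lia.
have tr : (t <= r)%N by rewrite /r; lia.
have r0 : (0 < r)%N by exact: leq_trans t1 tr.
have [beta [eta [n0 [b0 e0 H]]]] := stability_turan sE t1 tr qE d0.
pose n1 := (Num.truncn (2 * lnS R b.+1 / beta)).+1.
exists (beta / 2), eta, (maxn s (maxn n0 n1)); split=> //; first by rewrite divr_gt0.
move=> n C Cs Cq; rewrite !geq_max => /and3P[sn nn0 nn1] Hbad.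
have rn : (r <= n)%N by apply: leq_trans sn; rewrite /r leq_subr.
have := H 'I_n C Cs Cq; rewrite card_ord => /(_ nn0 Hbad) [[p bp near]|far]; [left|right].
  exists (turan_mg b p).
    rewrite ET //; exists (turan_mg b p); first exact: turan_mg_bbT.
    by move=> e.
  apply: le_trans near; apply: sum2_le => x y.
  case: (eqVneq x y) => [_|xy]; first by rewrite ler0n.
  have [e Ee] := edge_of xy; rewrite (multE _ Ee) (turan_mgE b p Ee) /=.
  case: (p x == p y) => /=; first by case: (ltnP b.+1 (C x y)) => h //=; case: ltnP.
  by rewrite orbF.
have [p bp _] : exists2 p, balanced p & forall x i, (fun _ : 'I_n => None : option 'I_r) x = Some i -> p x = i.
  apply: balanced_extension r0 _ => i j; left.
  by rewrite /part_size big1.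
have FT : F n s q (turan_mg b p).
  move=> X cX; have := @turan_weight_le 'I_n r b p R X t; rewrite cX -sE => /(_ erefl).
  by rewrite -qE leq_add2r.
have L := ln_F_ge R s2 sn FT.
have := turan_ln b R r0 bp; rewrite card_ord => L2.
have na : 2 * lnS R b.+1 <= beta * n%:R.
  by rewrite mulrC [beta * _]mulrC -ler_pdivrMr // mulrC ltW // (lt_le_trans (truncnS_gt _)) // ler_nat.
have na2 := ler_wpM2r (ler0n R n) na.
rewrite -[beta * _ * _]mulrA -expr2 in na2.
apply: le_trans far _; move: L L2 na2.
move: (\sum_e _) (ln _) => u v; rewrite !mulrBl; lra.
Qed.

End Cases.

Unset Implicit Arguments.
Local Open Scope classical_set_scope.

Theorem theorem7 (R : realType) (s q a t b : nat)
    (E : forall n : nat, set (multigraph 'I_n)) :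
  (2 <= s)%N ->
  ((0 <= a)%N /\ q = (a * 'C(s, 2) + b)%N /\ (0 <= b <= s - 2)%N /\
     (forall n : nat, (s <= n)%N -> E n = U a n)) \/
  ((1 <= a)%N /\ (q + t = a * 'C(s, 2))%N /\ (1 <= t)%N /\ (2 * t <= s)%N /\
     (forall n : nat, (s <= n)%N -> E n = T (s - t) a n)) ->
  forall delta : R, 0 < delta ->
  exists2 beta : R, 0 < beta &
    exists n0 : nat, forall n : nat, (n0 <= n)%N ->
      (card_mg (F n s q `\` nearby s q (E n) delta))%:R / (card_mg (F n s q))%:R
        <= 2 `^ (- (beta * 'C(n, 2)%:R)) :> R.
Proof.
move=> s2 [[_ [qE [/andP[_ bs] EU]]]|[a1 [qE [t1 [ts ET]]]]] delta d0.
- apply: (enumeration s2) d0; last exact: (below_dichotomy s2 qE bs EU).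
  move=> n G G' sn; rewrite !EU // => H1 H2; exact: submultigraph_trans H2 H1.
- apply: (enumeration s2) d0; last exact: (turan_dichotomy s2 a1 qE t1 ts ET).
  move=> n G G' sn; rewrite !ET // => -[G2 B H1] H2.
  by exists G2 => //; exact: submultigraph_trans H2 H1.
Qed.
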